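(* Let $(M,d,\mu_M)$ be a proper complete metric space with a positive Radon measure such that there exist $h_M>0$, $\beta\ge0$ and, for any $z\in M$, $c_z>0$, with $$\lim_{r\to\infty}\frac{\mu_M(B(z,r))}{c_zr^\beta e^{rh_M}}=1.$$ Let $(\mathscr{H},\ge)$ be a Hilbert space over $\mathbb{R}$ equipped with a partial order compatible with the norm. Let $\Pi$ be a point process on $M$ satisfying the small variance assumption and with first intensity measure $\mu_M$. Fix $f\in\mathrm{CMVP}^\sharp(\mu_M;\mathscr{H}_+)$. Then $\Pi$-almost every $X$ satisfies: (i) the series $\sum_{x\in X}e^{-sd(x,z)}f(x)$ converges unconditionally in $\mathscr{H}$ for all $s>h_M$ and all $z\in M$; (ii) for all $z\in M$, $$f(z)=\lim_{s\to h_M^+}\frac{\displaystyle\sum_{x\in X}e^{-sd(x,z)}f(x)}{\displaystyle\sum_{x\in X}e^{-sd(x,z)}},$$ where the convergence takes place in the norm topology of $\mathscr{H}$.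
   Context: $B(z,r)=\{x:d(x,z)<r\}$; $o\in M$ is a fixed base point. A non-negative function $\Lambda$ on $\mathbb{N}$ is sub-exponential if $\lim_{t\to\infty}\Lambda(t)e^{-\alpha t}=0$ for every $\alpha>0$. $\mathrm{MVP}(\mu_M;\mathscr{H})$ is the set of locally square-integrable $f:M\to\mathscr{H}$ such that: (a) for any $z\in M$ and $r>0$, $f(z)=\frac{1}{\mu_M(B(z,r))}\int_{B(z,r)}f\,d\mu_M$; (b) there is a non-decreasing sub-exponential function $\Lambda:\mathbb{N}\to\mathbb{R}^+$, depending on $f$, with $\int_{A_k(o)}\|f(x)\|_{\mathscr{H}}^2d\mu_M(x)\le\Lambda(k)e^{2kh_M}$ for all $k\in\mathbb{N}$, where $A_k(o)=\{x\in M:k\le d(x,o)<k+1\}$; (c) $$\lim_{s\to h_M^+}\frac{\int_Me^{-2sd(x,o)}\|f(x)\|_{\mathscr{H}}^2d\mu_M(x)}{\big[\int_Me^{-sd(x,o)}d\mu_M(x)\big]^2}=0.$$ The partial order $\ge$ makes $\mathscr{H}$ a partially ordered vector space: $u_1\ge u_2$ implies $\alpha u_1\ge\alpha u_2$ for all $\alpha\in\mathbb{R}^+$ and $u_1+v\ge u_2+v$ for all $v\in\mathscr{H}$; $\mathscr{H}_+=\{u:u\ge0\}$. It is compatible with the norm if there is a constant $C>0$ such that $u_1\le u_2\le u_3$ implies $\|u_2\|\le C\max(\|u_1\|,\|u_3\|)$. $\mathrm{CMVP}(\mu_M;\mathscr{H}_+)$ is the set of $f\in\mathrm{MVP}(\mu_M;\mathscr{H})$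 that are norm-continuous with values in $\mathscr{H}_+$. $\mathrm{CMVP}^\sharp(\mu_M;\mathscr{H}_+)$ is the set of $f\in\mathrm{CMVP}(\mu_M;\mathscr{H}_+)$ for which there exists a strictly decreasing sequence $(\varepsilon_n)_{n\ge1}$ of positive numbers (depending on $f$), converging to $0$, with $\lim_{n\to\infty}\varepsilon_{n+1}/\varepsilon_n=1$ and $$\sum_{n=1}^\infty\varepsilon_n^{2+2\beta}\int_Me^{-2\varepsilon_nd(x,o)}\|f(x)\|_{\mathscr{H}}^2e^{-2h_Md(x,o)}d\mu_M(x)<\infty.$$ A series converges unconditionally if it converges and its sum does not change under any reordering of its terms. A configuration on $M$ is a collection of points of $M$ (possibly with multiplicities) with finitely many points in each relatively compact set; $\mathrm{Conf}(M)$ is the space of configurations with the usual Borel structure. Sums over $x\in X$ are taken with multiplicity. A point process on $M$ is a Borel probability measure $\Pi$ on $\mathrm{Conf}(M)$; its first intensity measure is $B\mapsto\mathbb{E}_\Pi(\#_B(\mathscr{X}))$, with $\mathscr{X}$ the random configuration and $\#_B$ the number of points in $B$. Small variance assumption: there is a constant $C>0$ depending only on $\Pi$ such that for every $f:M\to\mathbb{C}$ with $\mathbb{E}_\Pi[\sum_{x\in\mathscr{X}}(|f(x)|+|f(x)|^2)]<\infty$, $$\mathrm{Var}_\Pi\Big(\sum_{x\in\mathscr{X}}f(x)\Big)\le C\,\mathbb{E}_\Pi\Big(\sum_{x\in\mathscr{X}}|f(x)|^2\Big).$$ *)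

(* Defs.v *)
From HB Require Import structures.
From mathcomp Require Import all_boot all_order all_algebra.
From mathcomp Require Import all_classical all_reals all_analysis.
From mathcomp Require Import sesquilinear complex.

Set Implicit Arguments.
Unset Strict Implicit.
Unset Printing Implicit Defensive.

Import Order.TTheory GRing.Theory Num.Theory.
Import numFieldNormedType.Exports ComplexField.Normc.

Local Open Scope classical_set_scope.
Local Open Scope ring_scope.
Local Open Scope ereal_scope.

(* Pointedness is needed by the measurable structures of the library; it only
   says that the space is nonempty. *)
#[short(type="completeMetricType")]
HB.structure Definition CompleteMetric (R : numDomainType) :=
  {T of Metric R T & Complete T & Pointed T}.

Definition borel_type (R : realType) (M : completeMetricType R) :=
  g_sigma_algebraType (@open M).

Definition proper_space (R : realType) (M : completeMetricType R) :=
  forall (z : M) (r : R), compact [set x : M | (mdist x z <= r)%R].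

Section metric_measure_space.
Context {R : realType} {M : completeMetricType R}.
Variable mu : {measure set (borel_type M) -> \bar R}.

Definition radon_measure :=
  (forall K : set M, compact K -> mu K < +oo) /\
  (forall B : set (borel_type M), measurable B ->
    mu B = ereal_sup [set mu K | K in [set K : set M | compact K /\ K `<=` B]]).

Definition exponential_growth (h beta : R) :=
  forall z : M, exists2 c : R, (0 < c)%R &
    (fine (mu (ball z r)) / (c * r `^ beta * expR (r * h)))%R
      @[r --> +oo%R] --> (1 : R)%R.

End metric_measure_space.

Section ordered_hilbert.
Context {R : realType} {H : completeNormedModType R}.

Definition hilbert_norm (dot : {dot H for idfun}) :=
  forall u : H, dot u u = (`|u| ^+ 2)%R.

Record vector_space_order (le : H -> H -> Prop) : Prop := {
  vso_refl : forall u, le u u ;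
  vso_anti : forall u v, le u v -> le v u -> u = v ;
  vso_trans : forall v u w, le u v -> le v w -> le u w ;
  vso_scale : forall (a : R) u v, (0 <= a)%R -> le u v ->
    le (a *: u)%R (a *: v)%R ;
  vso_add : forall u v w, le u v -> le (u + w)%R (v + w)%R }.

Definition norm_compatible (le : H -> H -> Prop) :=
  exists2 C : R, (0 < C)%R & forall u1 u2 u3 : H, le u1 u2 -> le u2 u3 ->
    (`|u2| <= C * Num.max `|u1| `|u3|)%R.

End ordered_hilbert.

Section bochner.
Context {d : measure_display} {T : measurableType d} {R : realType}.
Context {V : normedModType R}.
Variable mu : {measure set T -> \bar R}.

Definition simple_fun (s : T -> V) :=
  finite_set (range s) /\ forall v : V, measurable (s @^-1` [set v]).

(* The level set of the value 0 may have infinite measure; its contribution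
   vanishes. *)
Definition simple_integral (D : set T) (s : T -> V) : V :=
  (\sum_(v \in range s) fine (mu (D `&` s @^-1` [set v])) *: v)%R.

Definition strongly_measurable (f : T -> V) :=
  exists2 s : nat -> T -> V, forall n, simple_fun (s n) &
    {ae mu, forall x, s n x @[n --> \oo] --> f x}.

Definition is_bochner_integral (D : set T) (f : T -> V) (I : V) :=
  exists s : nat -> T -> V,
    [/\ forall n, simple_fun (s n) /\
          \int[mu]_(x in D) (`|s n x|%R)%:E < +oo,
        {ae mu, forall x, D x -> s n x @[n --> \oo] --> f x},
        \int[mu]_(x in D) (`|f x - s n x|%R)%:E @[n --> \oo] --> 0 &
        simple_integral D (s n) @[n --> \oo] --> I].

Definition bochner (D : set T) (f : T -> V) : V :=
  xget 0%R [set I | is_bochner_integral D f I].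

End bochner.

Definition sub_exponential (R : realType) (L : nat -> R) :=
  forall a : R, (0 < a)%R ->
    (L t * expR (- (a * t%:R)))%R @[t --> \oo] --> (0 : R)%R.

Section mean_value_property.
Context {R : realType} {M : completeMetricType R}.
Context {H : completeNormedModType R}.
Variable mu : {measure set (borel_type M) -> \bar R}.
Variables (o : M) (h : R).

Definition locally_square_integrable (f : M -> H) :=
  strongly_measurable mu f /\
  forall K : set M, compact K -> \int[mu]_(x in K) ((`|f x| ^+ 2)%R)%:E < +oo.

Definition annulus (k : nat) : set M :=
  [set x | (k%:R <= mdist x o < k.+1%:R)%R].

Record MVP (f : M -> H) : Prop := {
  mvp_L2loc : locally_square_integrable f ;
  (* The average over a ball is only defined if the ball is not negligible. *)
  mvp_mean : forall (z : M) (r : R), (0 < r)%R -> 0 < mu (ball z r) ->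
    f z = ((fine (mu (ball z r)))^-1 *: bochner mu (ball z r) f)%R ;
  mvp_growth : exists L : nat -> R,
    [/\ forall k, (0 <= L k)%R,
        {homo L : j k / (j <= k)%N >-> (j <= k)%R},
        sub_exponential L &
        forall k, \int[mu]_(x in annulus k) ((`|f x| ^+ 2)%R)%:E <=
          (L k * expR (2 * k%:R * h))%:E] ;
  mvp_lim : (\int[mu]_x (expR (- (2 * s * mdist x o)) * `|f x| ^+ 2)%:E) *
      ((\int[mu]_x (expR (- (s * mdist x o)))%:E) ^+ 2)^-1
    @[s --> h^'+] --> 0 }.

Record CMVP (le : H -> H -> Prop) (f : M -> H) : Prop := {
  cmvp_mvp : MVP f ;
  cmvp_continuous : continuous f ;
  cmvp_ge0 : forall x, le 0%R (f x) }.

(* eps n stands for the (n+1)-st term of a sequence indexed from 1. *)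
Definition CMVP_sharp (beta : R) (le : H -> H -> Prop) (f : M -> H) :=
  CMVP le f /\
  exists eps : nat -> R,
    [/\ forall n, (0 < eps n)%R,
        forall n, (eps n.+1 < eps n)%R,
        eps @ \oo --> (0 : R)%R,
        (eps n.+1 / eps n)%R @[n --> \oo] --> (1 : R)%R &
        \sum_(0 <= n <oo) ((eps n `^ (2 + 2 * beta))%:E *
          \int[mu]_x (expR (- (2 * eps n * mdist x o)) * `|f x| ^+ 2 *
                      expR (- (2 * h * mdist x o)))%:E) < +oo].

End mean_value_property.

(* A configuration, i.e. a multiset of points, is encoded by its multiplicity
   function. *)
Section configurations.
Context {T : ptopologicalType}.

Definition locally_finite (X : T -> nat) :=
  forall K : set T, precompact K -> finite_set [set x | K x /\ (0 < X x)%N].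

Record conf := Conf { mult :> T -> nat ; conf_finite : locally_finite mult }.

Lemma locally_finite0 : locally_finite (fun=> 0%N).
Proof. by move=> K _; apply: (sub_finite_set _ (finite_set0 T)) => x []. Qed.

HB.instance Definition _ := gen_eqMixin conf.
HB.instance Definition _ := gen_choiceMixin conf.
HB.instance Definition _ := isPointed.Build conf (Conf locally_finite0).

(* e lists the points of X, each one as many times as its multiplicity; the
   indices sent to None are padding, so that finite configurations are
   covered as well. *)
Definition enumerates (X : conf) (e : nat -> option T) :=
  forall x : T, ([set n | e n = Some x] #= `I_(X x))%card.

(* Unconditional convergence: the series converges to the same S for all
   orderings of the points of X. *)
Definition conf_has_sum {K : numFieldType} {V : normedModType K}
    (X : conf) (g : T -> V) (S : V) :=
  (exists e, enumerates X e) /\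
  forall e, enumerates X e ->
    series (fun n => oapp g 0%R (e n)) @ \oo --> S.

Definition conf_sum {K : numFieldType} {V : normedModType K}
    (X : conf) (g : T -> V) : V :=
  xget 0%R [set S | conf_has_sum X g S].

Definition conf_esum {R : realType} (X : conf) (g : T -> \bar R) : \bar R :=
  \esum_(x in [set: T]) ((X x)%:R%:E * g x).

Definition npoints {R : realType} (X : conf) (B : set T) : \bar R :=
  \esum_(x in B) (X x)%:R%:E.

End configurations.

Arguments conf : clear implicits.

Section point_processes.
Context {R : realType} {M : completeMetricType R}.

(* The Borel structure of the space of configurations is generated by the
   counting functions of relatively compact Borel sets. *)
Definition conf_cylinders : set (set (conf M)) :=
  [set A | exists (B : set M) (k : nat),
    [/\ (@open M).-sigma.-measurable B, precompact B &
        A = [set X | npoints X B = k%:R%:E :> \bar R]]].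

Definition conf_type := g_sigma_algebraType conf_cylinders.

Variable Pi : probability conf_type R.

Definition first_intensity (mu : {measure set (borel_type M) -> \bar R}) :=
  forall B : set (borel_type M), measurable B ->
    \int[Pi]_X npoints (X : conf M) (B : set M) = mu B.

Definition cexpectation (S : conf_type -> R[i]) : R[i] :=
  ((\int[Pi]_X complex.Re (S X)) +i* (\int[Pi]_X complex.Im (S X)))%R%C.

Definition cvariance (S : conf_type -> R[i]) : \bar R :=
  \int[Pi]_X ((normc (S X - cexpectation S) ^+ 2)%R)%:E.

(* A function with values in R[i] is Borel iff its two components are. *)
Definition small_variance :=
  exists2 C : R, (0 < C)%R & forall f : borel_type M -> R[i],
    measurable_fun setT (fun x => complex.Re (f x)) ->
    measurable_fun setT (fun x => complex.Im (f x)) ->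
    \int[Pi]_X conf_esum (X : conf M)
      (fun x => (normc (f x) + normc (f x) ^+ 2)%:E) < +oo ->
    cvariance (fun X => conf_sum (V := R[i]^o) (X : conf M) f) <=
      C%:E * \int[Pi]_X conf_esum (X : conf M)
        (fun x => (normc (f x) ^+ 2)%:E).

End point_processes.

Arguments conf_type {R} M.

(* Main.v *)
Require Import Defs.
From HB Require Import structures.
From mathcomp Require Import all_boot all_order all_algebra finmap.
From mathcomp Require Import all_classical all_reals all_analysis.
From mathcomp Require Import measurable_realfun.
From mathcomp Require Import sesquilinear complex ring lra.

Set Implicit Arguments.
Unset Strict Implicit.
Unset Printing Implicit Defensive.

Import Order.TTheory GRing.Theory Num.Theory.
Import numFieldNormedType.Exports.

Local Open Scope classical_set_scope.
Local Open Scope ring_scope.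

(** Write w_s(x) = exp (- s d(x,z)) for the weight centred at z, F_s(z) for the
    sum of w_s f over the configuration and G_s(z) for the integral of w_s
    against mu.

    The first moment of F_s(z) is G_s(z) f(z): a radial weight is a mixture of
    indicators of balls centred at z, and the average of f over each of these
    is f(z) ([radial_mean_annulus]).  The second moment of the deviation is at
    most a constant times the integral of w_s^2 |f|^2.  Small variance is
    assumed for scalar functions only; it passes to the Hilbert space because
    the variance of a vector is the sum of the variances of its coordinates in
    an orthonormal family spanning the values of f ([variance_vector_sum]).
    The values of f on a dense sequence of M provide this family, by the
    Gram-Schmidt procedure ([hilbert_coordinates]).

    Unconditional convergence.  The series need not converge absolutely, since
    only the integrals of |f|^2 over annuli are controlled, and they may be of
    size exp (2 h k).  But the centred sums over successive annuli around o are
    square summable against an exponential weight, so that almost surely the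
    sums over balls converge ([ae_ball_sums_cvg]).  As f takes its values in a
    normal cone, the sum over any finite set of far points is bounded, up to a
    constant, by the sum over an annulus containing it: convergence along balls
    is convergence along all finite sets ([ball_cvg_tail_small]).  Changing the
    centre of the weight, or increasing s, multiplies it by at most a constant,
    so that one null set serves all s > h and all centres ([ae_tail_small]).

    The limit.  Along s_n = h + eps_n one has G >= c eps_n^(- 1 - beta)
    ([mass_lower]), so the sharpness condition says that the variances of
    F / G are summable over n; hence F / G tends to f(z) along s_n, almost
    surely, for all z in a dense sequence ([ae_scale_sums]).  For the other s
    and z, the weight lies between multiples, close to 1, of the weights at
    s_n and s_(n+1) centred at a nearby point of the sequence.  The order on
    the sums turns into a norm estimate by normality of the cone
    ([sandwich_norm], [sandwich_estimate]), which is useful because the ratio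
    of G at s_(n+1) and at s_n tends to 1 ([mass_ratio]).

    All this applies to f, and also to the constant function 1 with values in
    the reals; dividing the two limits gives the theorem.  For the constant
    function the sharpness condition requires that eps_n^(2 + 2 beta) be
    summable: this holds as soon as f is not 0, because the integrals in the
    condition for f are then bounded below ([ball_energy_ge]). *)

(** * Configurations as lists of points *)

Section lists_in_configurations.
Context {T : ptopologicalType}.
Implicit Types (X : conf T) (D : set T) (l : seq T).

Definition subconf X l := forall x, (count_mem x l <= X x)%N.

Definition full_on X D l := forall x, D x -> count_mem x l = X x.

(** Multisets of points are handled as lists up to permutation: a finite part
    of the configuration is a list, and its sum is a big operator. *)
Definition points_in X D : seq T :=
  flatten [seq nseq (X x) x | x <- fset_set (D `&` [set x | (0 < X x)%N])].

Lemma count_points_in X D x : precompact D ->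
  count_mem x (points_in X D) = if `[< D x >] then X x else 0%N.
Proof.
move=> pD; have fD := conf_finite (X) pD.
rewrite /points_in count_flatten -map_comp sumnE big_map.
under eq_bigr do rewrite /= count_nseq/=.
set F := fset_set _.
have inF y : (y \in F) = (y \in D `&` [set x | (0 < X x)%N]).
  by rewrite in_fset_set.
case: asboolP => Dx.
- have [X0|X0] := posnP (X x).
    rewrite X0 big_seq big1// => y; rewrite inF inE => -[_ /= y0].
    by have [yx|//] := eqVneq y x; rewrite yx X0 in y0.
  rewrite (bigD1_seq x) ?fset_uniq//=; last by rewrite inF inE.
  by rewrite eqxx mul1n big1 ?addn0// => y /negbTE ->.
- rewrite big_seq big1// => y; rewrite inF inE => -[Dy _].
  by have [yx|//] := eqVneq y x; rewrite yx in Dy.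
Qed.

Lemma mem_points_in X D x : precompact D -> x \in points_in X D -> D x.
Proof.
by move=> pD; rewrite -has_pred1 has_count count_points_in//; case: asboolP.
Qed.

Lemma subconf_points_in X D : precompact D -> subconf X (points_in X D).
Proof. by move=> pD x; rewrite count_points_in//; case: ifP. Qed.

Lemma full_on_points_in X D E : precompact E -> D `<=` E ->
  full_on X D (points_in X E).
Proof. by move=> pE DE x /DE Ex; rewrite count_points_in// asboolT. Qed.

Lemma perm_points_in X D l : precompact D -> full_on X D l ->
  perm_eq [seq x <- l | `[< D x >]] (points_in X D).
Proof.
move=> pD fl; apply/allP => x _ /=; rewrite count_points_in// count_filter.
case: asboolP => Dx; apply/eqP.
  by rewrite -fl//; apply: eq_count => y /=; case: eqP => // ->; rewrite asboolT.
by apply/eqP; rewrite -leqn0 -ltnS -(count_pred0 l) ltnS sub_count// => y /= /andP[/eqP-> /asboolP].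
Qed.

End lists_in_configurations.

Section net_convergence.
Context {T : ptopologicalType} {K : numFieldType} {V : normedModType K}.
Implicit Types (X : conf T) (g : T -> V) (S : V).

(** Convergence along the directed set of finite sub-multisets.  It does not
    refer to an order of the points, behaves well under comparison, and gives
    the same limit for every exhaustion. *)
Definition net_sum X g S := forall e : K, 0 < e -> exists2 D, precompact D &
  forall l, subconf X l -> full_on X D l -> `|\sum_(x <- l) g x - S| <= e.

Lemma count_mem_pmap (e : nat -> option T) x N :
  count_mem x (pmap e (iota 0 N)) = size [seq n <- iota 0 N | e n == Some x].
Proof.
rewrite size_filter; elim: (iota 0 N) => //= n s IH.
by case: (e n) => [y|]//=; rewrite IH.
Qed.

Lemma enumerates_count X e x N : enumerates X e ->
  (count_mem x (pmap e (iota 0 N)) <= X x)%N.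
Proof.
move=> /(_ x); set A := (X in (X #= _)%card) => cA.
have fA : finite_set A by apply/finite_setP; exists (X x).
rewrite -(card_fset_set cA).
rewrite count_mem_pmap.
apply: uniq_leq_size; first by rewrite filter_uniq ?iota_uniq.
by move=> n; rewrite mem_filter in_fset_set// inE => /andP[/eqP].
Qed.

Lemma enumerates_full X e x : enumerates X e ->
  \forall N \near \oo, count_mem x (pmap e (iota 0 N)) = X x.
Proof.
move=> eX; move: (eX x); set A := (X in (X #= _)%card) => cA.
have fA : finite_set A by apply/finite_setP; exists (X x).
exists (\max_(n <- fset_set A) n).+1%N => // N /= NA.
apply/eqP; rewrite eqn_leq enumerates_count//= -(card_fset_set cA).
rewrite count_mem_pmap.
apply: uniq_leq_size; first exact: fset_uniq.
move=> n nA; rewrite mem_filter mem_iota add0n leq0n/=.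
apply/andP; split; first by move: nA; rewrite in_fset_set// inE => /eqP.
apply: leq_trans NA; rewrite ltnS.
by rewrite (big_rem n)//= leq_maxl.
Qed.

(** In any enumeration, only finitely many indices carry the points of a
    relatively compact set, so an initial segment is eventually full there. *)
Lemma net_sum_has_sum X g S : (exists e, enumerates X e) -> net_sum X g S ->
  conf_has_sum X g S.
Proof.
move=> eX gS; split => // e {}eX; apply/cvgrPdist_le => eps eps0.
have [D pD DS] := gS _ eps0.
have fD := conf_finite (X) pD.
have full : \forall N \near \oo, full_on X D (pmap e (iota 0 N)).
  have : forall s : seq T, \forall N \near \oo, forall x, x \in s ->
      count_mem x (pmap e (iota 0 N)) = X x.
    elim=> [|x s IH]; first exact: nearW.
    near=> N => y; rewrite inE => /orP[/eqP ->|].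
      by near: N; exact: enumerates_full.
    by move: y; near: N.
  move=> /(_ (fset_set (D `&` [set x | (0 < X x)%N]))).
  apply: filterS => N H x Dx; have [X0|X0] := posnP (X x).
    by have := enumerates_count x N eX; rewrite X0 leqn0 => /eqP.
  by apply: H; rewrite in_fset_set// inE.
apply: filterS full => N fN.
rewrite distrC; have := DS _ (fun x => enumerates_count x N eX) fN.
by rewrite big_pmap seriesEnat/= /index_iota subn0.
Unshelve. all: by end_near.
Qed.

Lemma conf_has_sum_unique X g S S' :
  conf_has_sum X g S -> conf_has_sum X g S' -> S = S'.
Proof.
move=> [[e eX] /(_ _ eX) h1] [_ /(_ _ eX) h2].
exact: (cvg_unique (@norm_hausdorff _ _) h1 h2).
Qed.

Lemma conf_sumE X g S : conf_has_sum X g S -> conf_sum X g = S.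
Proof.
move=> gS; rewrite /conf_sum; case: xgetP => [S' -> /= h|/(_ S)//].
exact: conf_has_sum_unique h gS.
Qed.

(** A function that vanishes off a relatively compact set has a finite sum;
    thus the hypothesis on variances, stated with sums over the whole
    configuration, applies to finite sums. *)
Lemma net_sum_finite X g D : precompact D -> (forall x, ~ D x -> g x = 0) ->
  net_sum X g (\sum_(x <- points_in X D) g x).
Proof.
move=> pD g0 e e0; exists D => // l sl fl.
rewrite -(perm_big _ (perm_points_in pD fl))/= big_filter.
rewrite [X in _ - X]big_mkcond/= [X in X - _](eq_bigr (fun x => if `[<D x>] then g x else 0)).
  by rewrite subrr normr0 ltW.
by move=> x _; case: asboolP => // /g0.
Qed.

End net_convergence.

(** * Proper metric spaces *)

Section proper_metric_space.
Context {R : realType} {M : completeMetricType R}.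
Implicit Types (x y z : M) (r : R).

Lemma ballP z r x : ball z r x <-> mdist x z < r.
Proof. by rewrite ballEmdist/= metric_sym. Qed.

Lemma le_ball_dist z y r r' : r + mdist z y <= r' -> ball z r `<=` (ball y r' : set M).
Proof.
move=> rr' x /ballP xz; apply/ballP/(lt_le_trans _ rr').
by rewrite (le_lt_trans (metric_triangle x z y))// ltrD2r.
Qed.

Lemma nat_ball z x : exists n : nat, ball z n%:R x.
Proof.
exists (Num.truncn (mdist x z)).+1; apply/ballP.
by rewrite truncnS_gt.
Qed.

Lemma borel_ball z r : measurable (ball z r : set (borel_type M)).
Proof.
apply: sub_sigma_algebra => /=.
rewrite openE => x /= /ballP xz; rewrite /interior -nbhs_ballE.
exists (r - mdist x z) => /=; first by rewrite subr_gt0.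
apply: le_ball_dist.
by rewrite subrK.
Qed.

Lemma borel_annulus z a b :
  measurable (ball z b `\` ball z a : set (borel_type M)).
Proof. by apply: (@measurableD _ (borel_type M)); exact: borel_ball. Qed.

Lemma continuous_mdist z : continuous (fun x => mdist x z).
Proof.
move=> x; apply/cvgrPdist_lt => e e0; near=> y.
have : ball x e y by near: y; exact: nbhsx_ballx.
move=> /ballP yx; rewrite ltr_norml ltrBrDl ltrBlDl.
have := metric_triangle x y z; have := metric_triangle y x z.
by rewrite (metric_sym x y) => ? ?; apply/andP; split; lra.
Unshelve. all: by end_near.
Qed.

Lemma continuous_borel (g : M -> R) :
  continuous g -> measurable_fun setT (g : borel_type M -> R).
Proof.
move=> /continuousP cg; apply: (measurability _ (@measurable_realfun.RGenOInfty.measurableE R)).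
move=> _ [_ [a ->] <-]; rewrite setTI.
by apply: sub_sigma_algebra; apply: cg; exact: interval_open.
Qed.

Hypothesis M_proper : proper_space M.

Lemma precompact_ball z r : precompact (ball z r).
Proof.
apply: (@precompact_subset _ _ [set x : M | mdist x z <= r]).
  by move=> x /ballP/ltW.
apply: compact_precompact; first exact: metric_hausdorff.
have := @M_proper z r; congr compact; apply/seteqP; split => x /=; by rewrite metric_sym.
Qed.

Lemma precompact_in_ball z (D : set M) : precompact D ->
  exists k : nat, D `<=` ball z k%:R.
Proof.
rewrite precompactE compact_cover => /(_ nat setT (fun n => ball z n%:R)) [].
- move=> i _; rewrite openE => x /= /ballP xz; rewrite /interior -nbhs_ballE.
  exists (i%:R - mdist x z) => /=; first by rewrite subr_gt0.
  by apply: le_ball_dist; rewrite subrK.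
- by move=> x _; have [n zn] := nat_ball z x; exists n.
move=> F _ DF; exists (\max_(n <- F) n)%N => x /subset_closure/DF [n /= nF].
apply: le_ball; rewrite ler_nat.
by rewrite (big_rem n)//= leq_maxl.
Qed.

(** For each n and m, finitely many balls of radius 1/(m+1) cover the ball of
    radius n; the centres of all these balls are countable and dense. *)
Lemma dense_sequence : exists zs : nat -> M,
  forall x e, 0 < e -> exists n, mdist x (zs n) < e.
Proof.
have cov (n m : nat) : exists F : {fset M}, ball point n%:R `<=`
    \bigcup_(y in [set` F]) (ball y m.+1%:R^-1 : set M).
  have := precompact_ball point n%:R; rewrite precompactE compact_cover.
  move=> /(_ M setT (fun y => ball y m.+1%:R^-1)) [].
  - move=> y _; rewrite openE => x /= /ballP xz; rewrite /interior -nbhs_ballE.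
    exists (m.+1%:R^-1 - mdist x y) => /=; first by rewrite subr_gt0.
    by apply: le_ball_dist; rewrite subrK.
  - by move=> x _; exists x => //; exact: ballxx.
  by move=> F _ DF; exists F => x /subset_closure/DF.
have [F' FP] := choice (fun nm : nat * nat => cov nm.1 nm.2).
pose F n m := F' (n, m).
pose C := \bigcup_n \bigcup_m [set` F n m].
have : countable C.
  apply: bigcup_countable => [|n _]; first exact: countableP.
  apply: bigcup_countable => [|m _]; first exact: countableP.
  exact: finite_set_countable (finite_fset _).
move=> /countable_injP[f finj].
exists (fun n => xget point [set x | C x /\ f x = n]) => x e e0.
have [n xn] := nat_ball point x.
have [m me] : exists m : nat, m.+1%:R^-1 < e.
  exists (Num.truncn e^-1); rewrite invf_plt ?posrE//.
  by rewrite truncnS_gt.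
have [y yF yx] := FP (n, m) _ xn.
have Cy : C y by exists n => //; exists m.
exists (f y); case: xgetP => [y' -> [Cy' fyy']|/(_ y)[]//].
rewrite (finj _ _ _ _ fyy') ?inE//.
by move/ballP: yx => /lt_trans; exact.
Qed.

(** The pairs (x, i) with i smaller than the multiplicity of x form a countable
    set, since balls contain finitely many points.  An injective numbering of
    these pairs is an enumeration, the integers that number no pair being
    padding. *)
Lemma conf_enumerable (X : conf M) : exists e, enumerates X e.
Proof.
pose P := [set q : M * nat | (q.2 < X q.1)%N].
have cX : countable [set x | (0 < X x)%N].
  have -> : [set x | (0 < X x)%N] =
      \bigcup_n (ball point n%:R `&` [set x | (0 < X x)%N]).
    apply/seteqP; split => x /=; last by case=> n _ [].
    by move=> x0; have [n ?] := nat_ball point x; exists n.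
  apply: bigcup_countable => [|n _]; first exact: countableP.
  apply: finite_set_countable.
  exact: conf_finite (precompact_ball _ _).
have cP : countable P.
  have -> : P = \bigcup_(x in [set x | (0 < X x)%N]) ((pair x) @` `I_(X x)).
    apply/seteqP; split => [[x i]/= Px|_ [x _ [i /= iX <-]]//].
    by exists x; [exact: leq_trans Px|exists i].
  apply: bigcup_countable => // x _; apply: finite_set_countable.
  exact/finite_image/finite_II.
case/countable_injP: cP => f finj.
pose e n := xget None [set o | exists2 q, P q & f q = n /\ o = Some q.1].
exists e => x.
have -> : [set n | e n = Some x] = (fun i => f (x, i)) @` `I_(X x).
  apply/seteqP; split => [n|_ [i /= iX <-]] /=; rewrite /e; case: xgetP => //.
  - move=> o _ [[y i]/= Pq [fq ->]] [yx]; rewrite yx in Pq fq.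
    by exists i.
  - move=> o _ [q Pq [fq ->]].
    by rewrite (finj _ _ _ _ fq) ?inE.
  - by move=> /(_ (Some x))[]; exists (x, i).
apply: inj_card_eq => i j; rewrite !inE/= => iX jX ij.
have := finj (x, i) (x, j) _ _ ij.
by rewrite !inE/= => /(_ iX jX) [].
Qed.

End proper_metric_space.

(** * The Campbell formula *)

Lemma cvg_sum (K : numFieldType) (V : normedModType K) (I J : Type)
    (F : set_system J) (FF : Filter F) (l : seq I) (g : J -> I -> V) (a : I -> V) :
  (forall i, g j i @[j --> F] --> a i) ->
  \sum_(i <- l) g j i @[j --> F] --> \sum_(i <- l) a i.
Proof.
move=> ga; elim: l => [|i l IH].
  under eq_fun do rewrite big_nil; rewrite big_nil; exact: cvg_cst.
by under eq_fun do rewrite big_cons; rewrite big_cons; exact: cvgD.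
Qed.

Section sums_of_borel_functions.
Import HBNNSimple HBSimple.
Context {R : realType} {M : completeMetricType R}.
Implicit Types (X : conf M) (D B : set M).

Lemma esum_points X D (g : M -> R) : precompact D -> (forall x, 0 <= g x) ->
  (\esum_(x in D) ((X x)%:R%:E * (g x)%:E))%E =
  (\sum_(x <- points_in X D) g x)%:E.
Proof.
move=> pD g0; set F := D `&` [set x | (0 < X x)%N].
have fF : finite_set F by exact: conf_finite X _ pD.
transitivity (\esum_(x in F) ((X x)%:R%:E * (g x)%:E))%E.
  rewrite esum_mkcond [RHS]esum_mkcond; apply: eq_esum => x _.
  rewrite /F in_setI; case: (x \in D) => //=.
  by case: ifPn => //; rewrite notin_setE/= => /negP; rewrite -eqn0Ngt => /eqP ->; rewrite mul0e.
rewrite esum_fset//; last by move=> x _; rewrite lee_fin mulr_ge0.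
rewrite fsbig_finite//= (eq_bigr (fun x => (g x *+ X x)%:E)); last first.
  by move=> x _; rewrite -EFinM mulr_natl.
rewrite sumEFin; congr EFin; rewrite /points_in big_flatten/= big_map.
by apply: eq_bigr => x _; rewrite big_nseq iter_addr_0.
Qed.

Lemma conf_esum_points X D (g : M -> R) : precompact D ->
  (forall x, 0 <= g x) -> (forall x, ~ D x -> g x = 0) ->
  conf_esum X (EFin \o g) = (\sum_(x <- points_in X D) g x)%:E.
Proof.
move=> pD g0 gD; rewrite -esum_points// /conf_esum [RHS]esum_mkcond.
apply: eq_esum => x _; case: ifPn => //; rewrite notin_setE => /gD/= ->.
by rewrite mule0.
Qed.

Lemma npoints_points X D B : precompact D ->
  npoints X (B `&` D) = (\sum_(x <- points_in X D) \1_B x)%:E :> \bar R.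
Proof.
move=> pD; rewrite -esum_points// /npoints esum_mkcond [RHS]esum_mkcond.
apply: eq_esum => x _; rewrite in_setI indicE.
by case: (x \in B); case: (x \in D); rewrite ?mule1 ?mule0.
Qed.

Lemma npoints_nat X B : precompact B -> exists k, npoints X B = k%:R%:E :> \bar R.
Proof.
move=> pB; exists (size (points_in X B)); have := npoints_points X setT pB.
rewrite setTI => ->; congr EFin.
by rewrite indicT big_const_seq count_predT iter_addr_0.
Qed.

(** The sigma-algebra on configurations is generated by the events that B
    contains k points, and the number of points takes countably many values. *)
Lemma measurable_npoints B : (@open M).-sigma.-measurable B -> precompact B ->
  measurable_fun [set: conf_type M] ((fun X : conf M => npoints X B) : conf_type M -> \bar R).
Proof.
move=> mB pB _ Y mY; rewrite setTI.
have -> : (fun X : conf_type M => npoints (X : conf M) B : \bar R) @^-1` Y =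
    \bigcup_(k in [set k : nat | Y k%:R%:E])
      [set X : conf M | npoints X B = k%:R%:E :> \bar R].
  apply/seteqP; split => [X /= YX|X [k /= Yk Xk]]; last by rewrite /= Xk.
  by have [k Xk] := npoints_nat X pB; exists k => //=; rewrite -Xk.
apply: bigcup_measurable => k _; apply: sub_sigma_algebra.
by exists B, k.
Qed.

Lemma measurable_sum_indic D B : precompact D -> (@open M).-sigma.-measurable D ->
  (@open M).-sigma.-measurable B ->
  measurable_fun [set: conf_type M]
    (fun X => \sum_(x <- points_in X D) \1_B x : R).
Proof.
move=> pD mD mB; apply/measurable_EFinP.
have -> : EFin \o (fun X : conf_type M => \sum_(x <- points_in X D) \1_B x : R) =
    (fun X => npoints (X : conf M) (B `&` D) : \bar R).
  by apply/funext => X /=; rewrite npoints_points.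
apply: measurable_npoints; first exact: (@measurableI _ (borel_type M)).
by apply: precompact_subset pD => x [].
Qed.

Lemma sum_fimfun X D (phi : {nnsfun (borel_type M) >-> R}) :
  \sum_(x <- points_in X D) phi x =
  \sum_(y <- fset_set (range phi)) y * \sum_(x <- points_in X D) \1_(phi @^-1` [set y]) x.
Proof.
under eq_bigr do rewrite fimfunE fsbig_finite//=.
by rewrite exchange_big/=; apply: eq_bigr => y _; rewrite mulr_sumr.
Qed.

Section with_point_process.
Variables (Pi : probability (conf_type M) R) (mu : {measure set (borel_type M) -> \bar R}).
Hypothesis Pi_intensity : first_intensity Pi mu.
Variable D : set M.
Hypotheses (pD : precompact D) (mD : (@open M).-sigma.-measurable D).

Lemma measurable_sum_nnsfun (phi : {nnsfun (borel_type M) >-> R}) :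
  measurable_fun [set: conf_type M] (fun X => \sum_(x <- points_in X D) phi x : R).
Proof.
rewrite (_ : (fun X => _) = fun X => \sum_(y <- fset_set (range phi)) y * \sum_(x <- points_in X D) \1_(phi @^-1` [set y]) x); last first.
  by apply/funext => X; rewrite sum_fimfun.
apply: measurable_sum => y; apply: measurable_funM => //.
by apply: measurable_sum_indic.
Qed.

Lemma campbell_nnsfun (phi : {nnsfun (borel_type M) >-> R}) :
  (\int[Pi]_X (\sum_(x <- points_in X D) phi x)%:E = \int[mu]_(x in D) (phi x)%:E)%E.
Proof.
have pre0 y : y < 0 -> phi @^-1` [set y] = set0.
  move=> y0; apply/seteqP; split => // x /= phixy.
  by move: y0; rewrite -phixy ltNge => /negP; apply; exact: fun_ge0.
have mE y : measurable (phi @^-1` [set y]) by [].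
under eq_integral do rewrite sum_fimfun -sumEFin.
rewrite ge0_integral_sum//; last 2 first.
- move=> y; apply/measurable_EFinP; apply: measurable_funM => //.
  exact: measurable_sum_indic.
- move=> y X _; rewrite lee_fin; have [y0|y0] := ltP y 0.
    by rewrite pre0// big1 ?mulr0// => x _; rewrite indic0.
  by rewrite mulr_ge0// sumr_ge0.
under [in RHS]eq_integral do rewrite fimfunE fsbig_finite//= -sumEFin.
rewrite [RHS]ge0_integral_sum//; last 2 first.
- move=> y; apply/measurable_EFinP; apply: measurable_funM => //.
- by move=> y x _; have := nnfun_muleindic_ge0 phi y x; rewrite EFinM.
apply: eq_bigr => y _; have [y0|y0] := ltP y 0.
  rewrite pre0// !integral0_eq// => [x _|X _].
    by rewrite indic0 mulr0.
  by rewrite big1 ?mulr0// => x _; rewrite indic0.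
under eq_integral do rewrite EFinM.
rewrite ge0_integralZl_EFin//; last 2 first.
- by move=> X _; rewrite lee_fin sumr_ge0.
- by apply/measurable_EFinP; exact: measurable_sum_indic.
under [in RHS]eq_integral do rewrite EFinM.
rewrite [RHS]ge0_integralZl_EFin//; last exact/measurable_EFinP.
congr *%E; rewrite integral_indic// -Pi_intensity; last exact: measurableI.
by apply: eq_integral => X _; rewrite npoints_points.
Qed.

Section nonnegative.
Variable g : borel_type M -> R.
Hypotheses (mg : measurable_fun setT g) (g0 : forall x, 0 <= g x).

Let mEg : measurable_fun setT (EFin \o g). Proof. exact/measurable_EFinP. Qed.
Let phi := nnsfun_approx measurableT mEg.

Let phi_cvg x : phi n x @[n --> \oo] --> g x.
Proof.
have : (phi n x)%:E @[n --> \oo] --> (g x)%:E.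
  by apply: (cvg_nnsfun_approx measurableT mEg) => // y _; rewrite /= lee_fin.
by move/fine_cvgP => [].
Qed.

Let sum_phi_cvg X :
  \sum_(x <- points_in X D) phi n x @[n --> \oo] --> \sum_(x <- points_in X D) g x.
Proof. by apply: cvg_sum => x; exact: phi_cvg. Qed.

Lemma measurable_sum_ge0 :
  measurable_fun [set: conf_type M] (fun X => \sum_(x <- points_in X D) g x : R).
Proof.
pose h n (X : conf_type M) : R := \sum_(x <- points_in (X : conf M) D) phi n x.
apply: (@measurable_fun_cvg _ _ _ setT h).
- by move=> n; exact: measurable_sum_nnsfun.
- by move=> X _; exact: sum_phi_cvg.
Qed.

(** Both sides pass to increasing limits, and for simple functions the formula
    is the definition of the first intensity measure. *)
Lemma campbell_ge0 :
  (\int[Pi]_X (\sum_(x <- points_in X D) g x)%:E = \int[mu]_(x in D) (g x)%:E)%E.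
Proof.
have phi_le x : {homo (fun n => phi n x) : n m / (n <= m)%N >-> n <= m}.
  by move=> n m nm; apply/lefP; exact: nd_nnsfun_approx.
have h1 : (\int[Pi]_X (\sum_(x <- points_in X D) phi n x)%:E)%E @[n --> \oo] -->
    (\int[Pi]_X (\sum_(x <- points_in X D) g x)%:E)%E.
  under eq_integral.
    move=> X _.
    rewrite -(_ : limn (fun n => (\sum_(x <- points_in X D) phi n x)%:E) = (\sum_(x <- points_in X D) g x)%:E); last first.
      by apply/cvg_lim => //; apply: cvg_EFin; [exact: nearW|exact: sum_phi_cvg].
    over.
  apply: cvg_monotone_convergence => //.
  - by move=> n; apply/measurable_EFinP; exact: measurable_sum_nnsfun.
  - by move=> n X _; rewrite lee_fin sumr_ge0.
  - by move=> X _ n m nm; rewrite lee_fin ler_sum// => x _; exact: phi_le.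
have h2 : (\int[mu]_(x in D) (phi n x)%:E)%E @[n --> \oo] --> (\int[mu]_(x in D) (g x)%:E)%E.
  under eq_integral.
    move=> x _.
    rewrite -(_ : limn (fun n => (phi n x)%:E) = (g x)%:E); last first.
      by apply/cvg_lim => //; apply: cvg_EFin; [exact: nearW|exact: phi_cvg].
    over.
  apply: cvg_monotone_convergence => //.
  - by move=> n; apply/measurable_EFinP; apply: measurable_funTS.
  - by move=> n X _; rewrite lee_fin.
  - by move=> x _ n m nm; rewrite lee_fin phi_le.
move: h1; under eq_fun do rewrite campbell_nnsfun.
by move=> h1; exact: (cvg_unique _ h1 h2).
Qed.

End nonnegative.

End with_point_process.

End sums_of_borel_functions.

(** * Small variance for real sums *)

Section small_variance.
Import ComplexField.Normc.
Context {R : realType} {M : completeMetricType R}.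

Section signed_sums.
Variables (Pi : probability (conf_type M) R) (mu : {measure set (borel_type M) -> \bar R}).
Hypothesis Pi_intensity : first_intensity Pi mu.
Variable D : set M.
Hypotheses (pD : precompact D) (mD : (@open M).-sigma.-measurable D).

Let sum_posneg (g : M -> R) (X : conf M) : \sum_(x <- points_in X D) g x =
  \sum_(x <- points_in X D) g^\+ x - \sum_(x <- points_in X D) g^\- x.
Proof.
by rewrite -sumrB; apply: eq_bigr => x _; rewrite -[in LHS](funrposBneg g).
Qed.

Lemma measurable_sum_points (g : borel_type M -> R) : measurable_fun setT g ->
  measurable_fun [set: conf_type M] (fun X => \sum_(x <- points_in X D) g x : R).
Proof.
move=> mg; under eq_fun do rewrite sum_posneg.
apply: measurable_funB; apply: measurable_sum_ge0 => //.
- exact: measurable_funrpos.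
- exact: measurable_funrneg.
Qed.

Lemma campbell (g : borel_type M -> R) : measurable_fun setT g ->
  (\int[mu]_(x in D) `|g x|%:E < +oo)%E ->
  Pi.-integrable setT (fun X : conf_type M => (\sum_(x <- points_in X D) g x)%:E) /\
  (\int[Pi]_X (\sum_(x <- points_in X D) g x)%:E = \int[mu]_(x in D) (g x)%:E)%E.
Proof.
move=> mg ig.
have mp := measurable_funrpos mg; have mn := measurable_funrneg mg.
have ip : (\int[mu]_(x in D) (g^\+ x)%:E < +oo)%E.
  apply: le_lt_trans ig; apply: ge0_le_integral => //.
  - by move=> x _; rewrite lee_fin.
  - by apply/measurable_EFinP; exact: measurable_funTS.
  - by apply/measurable_EFinP; apply: measurable_funTS; exact: measurableT_comp.
  - move=> x _; rewrite lee_fin /funrpos ge_max ler_norm/=; exact: normr_ge0.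
have ineg : (\int[mu]_(x in D) (g^\- x)%:E < +oo)%E.
  apply: le_lt_trans ig; apply: ge0_le_integral => //.
  - by move=> x _; rewrite lee_fin.
  - by apply/measurable_EFinP; exact: measurable_funTS.
  - by apply/measurable_EFinP; apply: measurable_funTS; exact: measurableT_comp.
  - move=> x _; rewrite lee_fin /funrneg ge_max -normrN ler_norm/=; exact: normr_ge0.
have Pip : Pi.-integrable setT (fun X : conf_type M => (\sum_(x <- points_in X D) g^\+ x)%:E).
  apply/integrableP; split.
    by apply/measurable_EFinP; exact: measurable_sum_ge0.
  under eq_integral do rewrite gee0_abs ?lee_fin ?sumr_ge0//.
  by rewrite (campbell_ge0 Pi_intensity).
have Pin : Pi.-integrable setT (fun X : conf_type M => (\sum_(x <- points_in X D) g^\- x)%:E).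
  apply/integrableP; split.
    by apply/measurable_EFinP; exact: measurable_sum_ge0.
  under eq_integral do rewrite gee0_abs ?lee_fin ?sumr_ge0//.
  by rewrite (campbell_ge0 Pi_intensity).
split.
  under eq_fun do rewrite sum_posneg EFinB.
  exact: integrableB.
under eq_integral do rewrite sum_posneg EFinB.
rewrite integralB//= !(campbell_ge0 Pi_intensity)// [RHS]integralE.
by congr (_ - _)%E; apply: eq_integral => x _; rewrite ?funeposE ?funenegE ?EFin_max.
Qed.

End signed_sums.

(** The small variance assumption, for real functions restricted to a relatively
    compact set.  The function g 1_D seen in the complex numbers has a finite
    sum, whose expectation is given by the Campbell formula. *)
Lemma variance_sum_points (Pi : probability (conf_type M) R)
    (mu : {measure set (borel_type M) -> \bar R}) :
  proper_space M -> first_intensity Pi mu -> small_variance Pi ->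
  exists2 C : R, 0 < C &
  forall (D : set M) (g : borel_type M -> R), precompact D ->
  (@open M).-sigma.-measurable D -> measurable_fun setT g ->
  (\int[mu]_(x in D) `|g x|%:E < +oo)%E ->
  (\int[mu]_(x in D) (g x ^+ 2)%:E < +oo)%E ->
  (\int[Pi]_X ((\sum_(x <- points_in X D) g x -
     fine (\int[mu]_(x in D) (g x)%:E)) ^+ 2)%:E <=
   C%:E * \int[mu]_(x in D) (g x ^+ 2)%:E)%E.
Proof.
move=> Mp Pi_intensity [C C0 sv]; exists C => // D g pD mD mg ig1 ig2.
pose b x : R := g x * \1_D x.
have normcR (t : R) : normc (t%:C)%C = `|t|.
  by rewrite /normc/= expr0n addr0 sqrtr_sqr.
have mb : measurable_fun setT (b : borel_type M -> R).
  by apply: measurable_funM => //; exact: measurable_indic.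
have bD x : ~ D x -> b x = 0 by move=> nD; rewrite /b indicE memNset ?mulr0.
have sumb (k : R -> R) (X : conf M) : \sum_(x <- points_in X D) k (b x) =
    \sum_(x <- points_in X D) k (g x).
  apply: eq_big_seq => x /mem_points_in => /(_ pD) Dx.
  by rewrite /b indicE mem_set ?mulr1.
have csum (X : conf M) : conf_sum (V := R[i]^o) X (fun x => (b x)%:C%C) =
    (\sum_(x <- points_in X D) g x)%:C%C.
  rewrite -(sumb id) rmorph_sum/=; apply: conf_sumE.
  apply: net_sum_has_sum; first exact: conf_enumerable.
  by apply: net_sum_finite => // x nD; rewrite bD.
have cE : cexpectation Pi (fun X => conf_sum (V := R[i]^o) (X : conf M) (fun x => (b x)%:C%C)) =
    (fine (\int[mu]_(x in D) (g x)%:E)%E)%:C%C.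
  rewrite /cexpectation; under eq_Rintegral do rewrite csum/=.
  under [X in (_ +i* X)%C]eq_Rintegral do rewrite csum/=.
  congr (_ +i* _)%C.
    by rewrite /Rintegral (campbell Pi_intensity pD mD mg ig1).2.
  by rewrite /Rintegral integral0_eq.
have esq : (\int[Pi]_X conf_esum (X : conf M) (fun x => (normc (b x)%:C%C ^+ 2)%:E) =
    \int[mu]_(x in D) (g x ^+ 2)%:E)%E.
  rewrite -(campbell_ge0 Pi_intensity pD mD); last 2 first.
  - exact: measurable_funX.
  - by move=> x; rewrite sqr_ge0.
  apply: eq_integral => X _.
  rewrite (@conf_esum_points _ _ X D (fun x => normc (b x)%:C%C ^+ 2))//.
  - congr EFin; rewrite -(sumb (fun t => t ^+ 2)).
    by apply: eq_bigr => x _; rewrite normcR real_normK ?num_real.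
  - by move=> x; rewrite normcR exprn_ge0.
  - by move=> x nD; rewrite bD// normcR normr0 expr0n.
have cB (u v : R) : (u%:C - v%:C = (u - v)%:C)%C by rewrite rmorphB.
have sumE (X : conf M) : normc (conf_sum (V := R[i]^o) X (fun x => (b x)%:C%C) -
    cexpectation Pi (fun X => conf_sum (V := R[i]^o) (X : conf M) (fun x => (b x)%:C%C))) ^+ 2 =
    (\sum_(x <- points_in X D) g x - fine (\int[mu]_(x in D) (g x)%:E)%E) ^+ 2.
  by rewrite csum cE cB normcR real_normK ?num_real.
rewrite -esq; apply: (le_trans _ (sv (fun x => (b x)%:C%C) mb (measurable_cst _) _)).
  rewrite le_eqVlt; apply/orP; left; apply/eqP.
  by apply: eq_integral => X _; congr EFin; rewrite -sumE.
have mg2 : measurable_fun setT (fun x : borel_type M => `|g x| + g x ^+ 2).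
  apply: measurable_funD; first exact: measurableT_comp.
  exact: measurable_funX.
rewrite (_ : (\int[_]_X _ = \int[mu]_(x in D) (`|g x| + g x ^+ 2)%:E)%E).
  under eq_integral do rewrite EFinD.
  rewrite ge0_integralD//=.
  - by rewrite lte_add_pinfty.
  - by apply/measurable_EFinP/measurable_funTS; exact: measurableT_comp.
  - by move=> x _; rewrite lee_fin sqr_ge0.
  - by apply/measurable_EFinP/measurable_funTS; exact: measurable_funX.
rewrite -(campbell_ge0 Pi_intensity pD mD)//; last first.
  by move=> x; rewrite addr_ge0// sqr_ge0.
apply: eq_integral => X _.
rewrite (@conf_esum_points _ _ X D (fun x => normc (b x)%:C%C + normc (b x)%:C%C ^+ 2))//.
- congr EFin; rewrite -(sumb (fun t => `|t| + t ^+ 2)).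
  by apply: eq_bigr => x _; rewrite normcR real_normK ?num_real.
- by move=> x; rewrite normcR addr_ge0.
- by move=> x nD; rewrite bD// normcR normr0 expr0n addr0.
Qed.

End small_variance.

(** * Variance of vector-valued sums, coordinate by coordinate *)

Lemma continuous_norm_sqr (R : realType) (T : topologicalType)
    (H : normedModType R) (f : T -> H) :
  continuous f -> continuous (fun x => `|f x| ^+ 2).
Proof.
move=> cf x; rewrite /continuous_at expr2; under eq_fun do rewrite expr2.
by apply: cvgM; apply: cvg_norm; exact: cf.
Qed.

Section continuous_integrable.
Context {R : realType} {M : completeMetricType R}.
Variable mu : {measure set (borel_type M) -> \bar R}.
Hypothesis mu_fin : forall K : set M, compact K -> (mu K < +oo)%E.
Variable D : set M.
Hypotheses (pD : precompact D) (mD : (@open M).-sigma.-measurable D).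

Lemma precompact_measure : (mu D < +oo)%E.
Proof.
apply: (@le_lt_trans _ _ (mu (closure D))); last first.
  by apply: mu_fin; rewrite -precompactE.
apply: le_measure; rewrite ?inE//; last exact: subset_closure.
rewrite -[closure D]setCK; apply: (@measurableC _ (borel_type M)).
by apply: sub_sigma_algebra; rewrite /= openC; exact: closed_closure.
Qed.

Lemma continuous_bounded_on (g : M -> R) : continuous g ->
  exists2 B : R, 0 <= B & forall x, D x -> `|g x| <= B.
Proof.
move=> cg; have := pD; rewrite precompactE => cD.
have : compact (g @` closure D).
  by apply: continuous_compact => //; exact: continuous_subspaceT.
move=> /compact_bounded[B [_ HB]].
exists (`|B| + 1) => [|x Dx]; first by rewrite addr_ge0.
apply: HB; first by rewrite (le_lt_trans (ler_norm B))// ltrDl.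
by exists x => //; exact: subset_closure.
Qed.

Lemma continuous_integrable (g : M -> R) : continuous g ->
  mu.-integrable D (EFin \o g).
Proof.
move=> cg; have [B B0 gB] := continuous_bounded_on cg.
have mg : measurable_fun (D : set (borel_type M)) (EFin \o (g : borel_type M -> R)).
  by apply/measurable_EFinP/measurable_funTS; exact: continuous_borel.
apply/integrableP; split => //.
apply: (@le_lt_trans _ _ (\int[mu]_(x in D) B%:E)%E).
  apply: ge0_le_integral => //.
  - exact: measurableT_comp.
by rewrite integral_cst// lte_mul_pinfty// precompact_measure.
Qed.

End continuous_integrable.

Section coordinates.
Context {R : realType} {M : completeMetricType R} {H : normedModType R}.

(** A sequence of linear coordinates that satisfies Parseval on a subspace V
    containing the values of f.  The notion covers both uses of the probabilistic
    argument: a function with values in a Hilbert space, and the constant 1 with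
    values in the reals. *)
Record coordinates (f : M -> H) (c : nat -> H -> R) (V : set H) : Prop := {
  coord_lin : forall i a u v, c i (a *: u + v) = a * c i u + c i v ;
  coord_cont : forall i, continuous (c i \o f) ;
  span0 : V 0 ;
  span_lin : forall a u v, V u -> V v -> V (a *: u + v) ;
  span_f : forall x, V (f x) ;
  parseval : forall v, V v ->
    (\sum_(0 <= i <oo) (c i v ^+ 2)%:E = (`|v| ^+ 2)%:E)%E }.

Variables (f : M -> H) (c : nat -> H -> R) (V : set H).
Hypothesis fc : coordinates f c V.

Lemma coord0 i : c i 0 = 0.
Proof.
have := coord_lin fc i 1 0 0; rewrite scale1r addr0 mul1r => /esym/eqP.
by rewrite -subr_eq0 addrK => /eqP.
Qed.

Lemma coordB i u v : c i (u - v) = c i u - c i v.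
Proof. by rewrite addrC -scaleN1r (coord_lin fc) mulN1r addrC. Qed.

Lemma coordZ i a u : c i (a *: u) = a * c i u.
Proof. by rewrite -[a *: u]addr0 (coord_lin fc) coord0 addr0. Qed.

Lemma coord_sum i (w : M -> R) (l : seq M) :
  c i (\sum_(x <- l) w x *: f x) = \sum_(x <- l) w x * c i (f x).
Proof.
elim: l => [|x l IH]; first by rewrite !big_nil coord0.
by rewrite !big_cons (coord_lin fc) IH.
Qed.

Lemma span_sum (w : M -> R) (l : seq M) : V (\sum_(x <- l) w x *: f x).
Proof.
elim: l => [|x l IH]; first by rewrite big_nil; exact: span0 fc.
by rewrite big_cons; apply: (span_lin fc) => //; exact: span_f fc _.
Qed.

Lemma spanB u v : V u -> V v -> V (u - v).
Proof. by move=> Vu Vv; rewrite addrC -scaleN1r; exact: (span_lin fc). Qed.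

Lemma spanZ a u : V u -> V (a *: u).
Proof. by move=> Vu; rewrite -[a *: u]addr0; apply: (span_lin fc) => //; exact: span0 fc. Qed.

Variables (Pi : probability (conf_type M) R) (mu : {measure set (borel_type M) -> \bar R}).
Hypothesis mu_fin : forall K : set M, compact K -> (mu K < +oo)%E.
Variables (D : set M) (w : M -> R) (m : H).
Hypotheses (pD : precompact D) (mD : (@open M).-sigma.-measurable D).
Hypotheses (cw : continuous w) (Vm : V m).

Let coordE i X : c i (\sum_(x <- points_in X D) w x *: f x - m) =
   \sum_(x <- points_in X D) w x * c i (f x) - c i m.
Proof. by rewrite coordB coord_sum. Qed.

Let cwf i : continuous (fun x => w x * c i (f x)).
Proof. by move=> x; apply: cvgM; [exact: cw|exact: (@coord_cont _ _ _ fc i x)]. Qed.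

Let measurable_coord i : measurable_fun [set: conf_type M] (fun X =>
  (c i (\sum_(x <- points_in (X : conf M) D) w x *: f x - m) ^+ 2)%:E).
Proof.
apply/measurable_EFinP; apply: measurable_funX.
under eq_fun do rewrite coordE.
apply: measurable_funB => //; apply: measurable_sum_points => //.
exact: continuous_borel.
Qed.

Let normE (X : conf M) : ((`|\sum_(x <- points_in X D) w x *: f x - m| ^+ 2)%:E =
  \sum_(0 <= i <oo) (c i (\sum_(x <- points_in X D) w x *: f x - m) ^+ 2)%:E)%E.
Proof. by rewrite (parseval fc)//; apply: spanB => //; exact: span_sum. Qed.

Lemma measurable_norm_sum_points : measurable_fun [set: conf_type M] (fun X =>
  (`|\sum_(x <- points_in (X : conf M) D) w x *: f x - m| ^+ 2)%:E).
Proof.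
under eq_fun do rewrite normE.
by apply: ge0_emeasurable_sum => // k X _ _; rewrite lee_fin sqr_ge0.
Qed.

(** By Parseval both sides are sums over the coordinates, where the scalar
    bound applies term by term. *)
Lemma variance_vector_sum (C : R) : 0 <= C ->
  (forall g : borel_type M -> R, measurable_fun setT g ->
    (\int[mu]_(x in D) `|g x|%:E < +oo)%E ->
    (\int[mu]_(x in D) (g x ^+ 2)%:E < +oo)%E ->
    (\int[Pi]_X ((\sum_(x <- points_in X D) g x -
       fine (\int[mu]_(x in D) (g x)%:E)) ^+ 2)%:E <=
     C%:E * \int[mu]_(x in D) (g x ^+ 2)%:E)%E) ->
  (forall i, c i m = fine (\int[mu]_(x in D) (w x * c i (f x))%:E)%E) ->
  (\int[Pi]_X (`|\sum_(x <- points_in X D) w x *: f x - m| ^+ 2)%:E <=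
   C%:E * \int[mu]_(x in D) (w x ^+ 2 * `|f x| ^+ 2)%:E)%E.
Proof.
move=> C0 var cm.
under eq_integral do rewrite normE.
rewrite integral_nneseries//; last by move=> i X _; rewrite lee_fin sqr_ge0.
have -> : (\int[mu]_(x in D) (w x ^+ 2 * `|f x| ^+ 2)%:E =
    \sum_(0 <= i <oo) \int[mu]_(x in D) ((w x * c i (f x)) ^+ 2)%:E)%E.
  rewrite -integral_nneseries//; last 2 first.
  - move=> i; apply/measurable_EFinP/measurable_funTS/measurable_funX.
    exact: continuous_borel.
  - by move=> i x _; rewrite lee_fin sqr_ge0.
  apply: eq_integral => x _.
  rewrite EFinM -(parseval fc (span_f fc x)) -nneseriesZl//; last by move=> i _; rewrite lee_fin sqr_ge0.
  by apply: eq_eseriesr => i _; rewrite exprMn.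
rewrite -nneseriesZl; last by move=> i _; apply: integral_ge0 => x _; rewrite lee_fin sqr_ge0.
apply: lee_nneseries => [i _ _|i _].
  by apply: integral_ge0 => X _; rewrite lee_fin sqr_ge0.
under eq_integral do rewrite coordE cm.
have c2 : continuous (fun x => (w x * c i (f x)) ^+ 2).
  by move=> x; rewrite /continuous_at expr2; under eq_fun do rewrite expr2; apply: cvgM; exact: cwf.
apply: var.
- exact: continuous_borel.
- by have /integrableP[_] := continuous_integrable mu_fin pD mD (@cwf i).
- have /integrableP[_] := continuous_integrable mu_fin pD mD c2.
  by under eq_integral do rewrite gee0_abs ?lee_fin ?sqr_ge0//.
Qed.

End coordinates.

(** * Radial weights and the mean value property *)

Lemma eq0_of_le_divn (R : realType) (x A : R) :
  (forall m : nat, `|x| <= A / m.+1%:R) -> x = 0.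
Proof.
move=> xA; apply/eqP; rewrite -normr_le0 leNgt; apply/negP => x0.
have := xA (Num.truncn (A / `|x|)); rewrite leNgt => /negP; apply.
by rewrite ltr_pdivrMr// -ltr_pdivrMl// mulrC truncnS_gt.
Qed.

(** Over a subdivision into m+1 equal steps the increments of Psi add up to at
    most 1/(m+1) times the total increment of beta, up to a constant. *)
Lemma eq_of_small_increments (R : realType) (Psi beta : R -> R) (K N : R) :
  0 <= N ->
  (forall r r', 0 <= r -> r <= r' ->
    `|Psi r' - Psi r| <= K * (r' - r) * (beta r' - beta r)) ->
  Psi N = Psi 0.
Proof.
move=> N0 inc; apply/eqP; rewrite -subr_eq0; apply/eqP.
apply: (@eq0_of_le_divn _ _ (K * N * (beta N - beta 0))) => m.
pose r (j : nat) : R := j%:R * (N / m.+1%:R).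
have rN : r m.+1 = N by rewrite /r mulrC divfK.
have r0 : r 0%N = 0 by rewrite /r mul0r.
rewrite -[in leLHS]rN -[in leLHS]r0 -(telescope_sumr (fun j => Psi (r j)))//.
apply: (le_trans (ler_norm_sum _ _ _)).
have -> : K * N * (beta N - beta 0) / m.+1%:R =
   \sum_(0 <= j < m.+1) (K * (N / m.+1%:R) * (beta (r j.+1) - beta (r j))).
  rewrite -mulr_sumr (telescope_sumr (fun j => beta (r j)))// rN r0.
  by rewrite mulrAC mulrA.
apply: ler_sum => j _.
have rS : r j.+1 - r j = N / m.+1%:R by rewrite /r -mulrBl -natrB// subSnn mul1r.
rewrite -rS; apply: inc; first by rewrite /r mulr_ge0// divr_ge0.
by rewrite -subr_ge0 rS divr_ge0.
Qed.

Section radial.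
Context {R : realType} {M : completeMetricType R}.
Implicit Types (x y z : M).
Variable mu : {measure set (borel_type M) -> \bar R}.
Hypothesis M_proper : proper_space M.
Hypothesis mu_fin : forall K : set M, compact K -> (mu K < +oo)%E.

Definition weight (s : R) (z x : M) : R := expR (- (s * mdist x z)).

Lemma weight_ge0 s z x : 0 <= weight s z x. Proof. exact: expR_ge0. Qed.

Lemma continuous_weight s z : continuous (weight s z).
Proof.
have cl : continuous (fun x => - (s * mdist x z)).
  by move=> x; apply: cvgN; apply: cvgM; [exact: cvg_cst|exact: continuous_mdist].
by move=> x; exact: (continuous_comp (cl x) (@continuous_expR _ _)).
Qed.

Lemma ball_integrable (h : M -> R) z r : continuous h ->
  mu.-integrable (ball z r) (EFin \o h).
Proof.
move=> ch; apply: continuous_integrable => //.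
- exact: precompact_ball M_proper _ _.
- exact: borel_ball.
Qed.

Lemma annulus_integrable (h : M -> R) z r r' : continuous h ->
  mu.-integrable (ball z r' `\` ball z r) (EFin \o h).
Proof.
move=> ch; apply: continuous_integrable => //; last exact: borel_annulus.
by apply: (precompact_subset _ (precompact_ball M_proper z r')) => x [].
Qed.

Lemma Rintegral_annulus (h : M -> R) z r r' : continuous h -> r <= r' ->
  \int[mu]_(x in ball z r' `\` ball z r) h x =
  \int[mu]_(x in ball z r') h x - \int[mu]_(x in ball z r) h x.
Proof.
move=> ch rr'; have sub : ball z r `<=` (ball z r' : set M) by exact: le_ball.
rewrite -{2}(setDUK sub) Rintegral_setU; last 1 first.
- by apply/disj_setPS => x [? []].
- by rewrite addrAC subrr add0r.
- exact: borel_ball.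
- exact: borel_annulus.
- by rewrite setDUK//; exact: ball_integrable.
Qed.

(** Let b = g - g z.  Its integral over every ball centred at z vanishes, hence
    so does its integral over every annulus.  On the annulus between r and r'
    the weight differs from its value at radius r by at most s (r' - r), so the
    integral of the weight times b is at most s (r' - r) times the integral of
    the absolute value of b: [eq_of_small_increments] shows that the integral
    over a ball does not depend on the radius, and it is 0 for the radius 0. *)
Lemma radial_mean_ball (g : M -> R) (z : M) (s N : R) : 0 <= s -> 0 <= N ->
  continuous g ->
  (forall r, \int[mu]_(x in ball z r) g x = g z * fine (mu (ball z r))) ->
  \int[mu]_(x in ball z N) (weight s z x * g x) =
  g z * \int[mu]_(x in ball z N) weight s z x.
Proof.
move=> s0 N0 cg mg; pose b x := g x - g z.
have cb : continuous b by move=> x; apply: cvgB; [exact: cg|exact: cvg_cst].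
have cnb : continuous (fun x => `|b x|) by move=> x; apply: cvg_norm; exact: cb.
have cw := @continuous_weight s z.
have cwb : continuous (fun x => weight s z x * b x).
  by move=> x; apply: cvgM; [exact: cw|exact: cb].
have cwg : continuous (fun x => weight s z x * g x).
  by move=> x; apply: cvgM; [exact: cw|exact: cg].
have b0 r : \int[mu]_(x in ball z r) b x = 0.
  rewrite RintegralB//; [|exact: borel_ball|exact: ball_integrable|].
    by rewrite mg Rintegral_cst ?subrr//; exact: borel_ball.
  by apply: (ball_integrable (h := cst (g z))) => x; exact: cvg_cst.
have ball0 (h : M -> R) : \int[mu]_(x in ball z 0) h x = 0.
  rewrite (_ : ball z 0 = set0) ?Rintegral_set0//.
  apply/seteqP; split => x //= /ballP; rewrite ltNge => /negP; apply.
  exact: mdist_ge0.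
suff : \int[mu]_(x in ball z N) (weight s z x * b x) = 0.
  under eq_Rintegral do rewrite mulrBr.
  rewrite RintegralB//; last 3 first.
  - exact: borel_ball.
  - exact: ball_integrable.
  - by apply: (ball_integrable (h := fun x => weight s z x * g z)) => x; apply: cvgM; [exact: cw|exact: cvg_cst].
  move/eqP; rewrite subr_eq0 => /eqP ->.
  rewrite RintegralZr//; first by rewrite mulrC.
  - exact: borel_ball.
  - exact: ball_integrable.
pose Psi r := \int[mu]_(x in ball z r) (weight s z x * b x).
pose beta r := \int[mu]_(x in ball z r) `|b x|.
rewrite -/(Psi N) (@eq_of_small_increments _ Psi beta s)//; first exact: ball0.
move=> r r' r0 rr'; rewrite /Psi /beta.
rewrite -!Rintegral_annulus//.
have m := borel_annulus z r r'.
have -> : \int[mu]_(x in ball z r' `\` ball z r) (weight s z x * b x) =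
   \int[mu]_(x in ball z r' `\` ball z r) ((weight s z x - expR (- (s * r))) * b x).
  under [RHS]eq_Rintegral do rewrite mulrBl.
  rewrite RintegralB//; last 2 first.
  - exact: annulus_integrable.
  - by apply: (annulus_integrable (h := fun x => _ * b x)) => x; apply: cvgM; [exact: cvg_cst|exact: cb].
  rewrite [X in _ - X]RintegralZl//; last exact: annulus_integrable.
  by rewrite [X in _ * X]Rintegral_annulus// !b0 subrr mulr0 subr0.
have ci : continuous (fun x => (weight s z x - expR (- (s * r))) * b x).
  by move=> x; apply: cvgM; [apply: cvgB; [exact: cw|exact: cvg_cst]|exact: cb].
apply: (le_trans (le_normr_Rintegral m _)); first exact: annulus_integrable.
rewrite -RintegralZl//; last exact: annulus_integrable.
apply: le_Rintegral => //.
- by apply: (annulus_integrable (h := fun x => `|_ * b x|)) => x; apply: cvg_norm; exact: ci.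
- by apply: (annulus_integrable (h := fun x => _ * `|b x|)) => x; apply: cvgM; [exact: cvg_cst|exact: cnb].
move=> x [/ballP xr' xr]; rewrite normrM ler_wpM2r//.
have {}xr : r <= mdist x z by rewrite leNgt; apply/negP => ?; apply: xr; exact/ballP.
have le1 : weight s z x <= expR (- (s * r)) by rewrite ler_expR lerN2 ler_wpM2l.
rewrite distrC ger0_norm ?subr_ge0//.
have -> : weight s z x = expR (- (s * r)) * expR (- (s * (mdist x z - r))).
  by rewrite -expRD /weight; congr expR; ring.
rewrite -[X in X - _]mulr1 -mulrBr.
have e1 : expR (- (s * r)) <= 1 by rewrite -expR0 ler_expR oppr_le0 mulr_ge0.
apply: (@le_trans _ _ (1 - expR (- (s * (mdist x z - r))))).
  rewrite ler_piMl// subr_ge0 -expR0 ler_expR oppr_le0 mulr_ge0// subr_ge0//.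
have := expR_ge1Dx (- (s * (mdist x z - r))).
have : s * (mdist x z - r) <= s * (r' - r) by rewrite ler_wpM2l// lerB// ltW.
by move=> ? ?; lra.
Qed.

Lemma radial_mean_annulus (g : M -> R) (z : M) (s r r' : R) :
  0 <= s -> 0 <= r -> r <= r' -> continuous g ->
  (forall r, \int[mu]_(x in ball z r) g x = g z * fine (mu (ball z r))) ->
  \int[mu]_(x in ball z r' `\` ball z r) (weight s z x * g x) =
  g z * \int[mu]_(x in ball z r' `\` ball z r) weight s z x.
Proof.
move=> s0 r0 rr' cg mg; have cw := @continuous_weight s z.
rewrite !Rintegral_annulus//; last first.
  by move=> x; apply: cvgM; [exact: cw|exact: cg].
by rewrite !radial_mean_ball// ?mulrBr// (le_trans r0).
Qed.

End radial.

(** * Orthonormal coordinates in a Hilbert space *)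

Lemma functional_continuous (R : realType) (M : completeMetricType R)
    (H : normedModType R) (phi : H -> R) (f : M -> H) :
  (forall a u v, phi (a *: u + v) = a * phi u + phi v) ->
  (forall u, `|phi u| <= `|u|) -> continuous f -> continuous (phi \o f).
Proof.
move=> phiP phi_le cf x; apply/cvgrPdist_le => e e0.
have /cvgrPdist_le/(_ _ e0) := cf x; apply: filterS => y; apply: le_trans.
apply: le_trans (phi_le _).
by rewrite [f x - f y]addrC -[- f y]scaleN1r phiP mulN1r addrC.
Qed.

Section inner_product.
Context {R : realType} {H : completeNormedModType R}.
Variable dot : {dot H for idfun}.
Hypothesis H_hilbert : hilbert_norm dot.
Implicit Types (u v w e : H).

Lemma dotC u v : dot u v = dot v u.
Proof. by have := hermitian_subproof (s := dot) u v; rewrite expr0 mul1r. Qed.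

Lemma dotPl e a u v : dot (a *: u + v) e = a * dot u e + dot v e.
Proof. by rewrite linearDl linearZl_LR. Qed.

Lemma dot0l e : dot 0 e = 0. Proof. by rewrite linear0l. Qed.

Lemma dot0r e : dot e 0 = 0. Proof. by rewrite dotC dot0l. Qed.

Lemma norm_sub_scale a u e :
  `|u - a *: e| ^+ 2 = `|u| ^+ 2 - 2 * a * dot u e + a ^+ 2 * `|e| ^+ 2.
Proof.
rewrite -!H_hilbert -scaleNr addrC dotPl ![dot _ (_ + _)]dotC !dotPl (dotC e u).
ring.
Qed.

(** Cauchy-Schwarz. *)
Lemma dot_le u v : `|dot u v| <= `|u| * `|v|.
Proof.
rewrite -(ler_pXn2r (n := 2)) ?nnegrE ?mulr_ge0// exprMn real_normK ?num_real//.
have [->|v0] := eqVneq v 0.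
  by rewrite dot0r normr0 expr0n mulr0.
have v2 : 0 < `|v| ^+ 2 by rewrite exprn_gt0// normr_gt0.
have := sqr_ge0 `|u - (dot u v / `|v| ^+ 2) *: v|.
rewrite norm_sub_scale -[X in _ -> is_true X]subr_ge0.
have -> : `|u| ^+ 2 - 2 * (dot u v / `|v| ^+ 2) * dot u v +
   (dot u v / `|v| ^+ 2) ^+ 2 * `|v| ^+ 2 =
   (`|u| ^+ 2 * `|v| ^+ 2 - dot u v ^+ 2) / `|v| ^+ 2.
  by field; rewrite normr_eq0.
by rewrite pmulr_lge0 ?invr_gt0.
Qed.

(** As the inverse of 0 is 0, the null vector is normalized to itself: in the
    Gram-Schmidt procedure a redundant vector then removes nothing, and no case
    distinction is needed. *)
Definition normalize w := `|w|^-1 *: w.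

Lemma norm_normalize_le w : `|normalize w| <= 1.
Proof.
rewrite normrZ normfV normr_id; have [->|w0] := eqVneq w 0.
  by rewrite normr0 mulr0.
by rewrite mulVf ?normr_eq0.
Qed.

Lemma dot_normalize_sqr w u :
  dot u (normalize w) ^+ 2 * `|normalize w| ^+ 2 = dot u (normalize w) ^+ 2.
Proof.
rewrite normrZ normfV normr_id; have [->|w0] := eqVneq w 0.
  by rewrite /normalize scaler0 dot0r expr0n mul0r.
by rewrite mulVf ?normr_eq0// expr1n mulr1.
Qed.

Section gram_schmidt.
Variable v : nat -> H.

(** What remains of u after removal of its components along the vectors
    obtained by orthonormalizing v 0, ..., v (n-1).  The components are removed
    one at a time; each removal lowers the squared norm by the square of the
    coordinate, which yields Parseval by telescoping, without ever stating that
    the directions are orthogonal. *)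
Fixpoint residual n u : H := if n is m.+1 then
  residual m u - dot (residual m u) (normalize (residual m (v m))) *:
    normalize (residual m (v m)) else u.

Definition coordinate n u := dot (residual n u) (normalize (residual n (v n))).

Lemma residualP n a u w :
  residual n (a *: u + w) = a *: residual n u + residual n w.
Proof.
by elim: n => //= n ->; rewrite dotPl scalerDl scalerBr -scalerA opprD addrACA.
Qed.

Lemma coordinateP n a u w :
  coordinate n (a *: u + w) = a * coordinate n u + coordinate n w.
Proof. by rewrite /coordinate residualP dotPl. Qed.

Lemma norm_residualS n u :
  `|residual n.+1 u| ^+ 2 = `|residual n u| ^+ 2 - coordinate n u ^+ 2.
Proof.
rewrite /= norm_sub_scale dot_normalize_sqr /coordinate.
ring.
Qed.

Lemma norm_residual n u :
  `|residual n u| ^+ 2 = `|u| ^+ 2 - \sum_(0 <= i < n) coordinate i u ^+ 2.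
Proof.
elim: n => [|n IH]; first by rewrite big_geq// subr0.
by rewrite norm_residualS IH big_nat_recr//= opprD addrA.
Qed.

Lemma norm_residual_le n u : `|residual n u| <= `|u|.
Proof.
rewrite -(ler_pXn2r (n := 2)) ?nnegrE// norm_residual.
by rewrite gerBl sumr_ge0// => i _; rewrite sqr_ge0.
Qed.

Lemma coordinate_le n u : `|coordinate n u| <= `|u|.
Proof.
apply: (le_trans (dot_le _ _)); rewrite -[leRHS]mulr1.
by rewrite ler_pM// ?norm_residual_le ?norm_normalize_le.
Qed.

(** Step n removes v n entirely, and a null residual remains null. *)
Lemma residual0 n m : (n < m)%N -> residual m (v n) = 0.
Proof.
have r0 w e : w = 0 -> w - dot w e *: e = 0.
  by move=> ->; rewrite dot0l scale0r subr0.
elim: m => // m IH; rewrite ltnS leq_eqVlt => /predU1P[->/=|nm]; last first.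
  by rewrite /= r0// IH.
set w := residual m (v m); have [->|w0] := eqVneq w 0; first by rewrite r0.
have -> : dot w (normalize w) = `|w|.
  by rewrite dotC -[normalize w]addr0 dotPl H_hilbert dot0l addr0 expr2 mulKf ?normr_eq0.
by rewrite /normalize scalerA divff ?normr_eq0// scale1r subrr.
Qed.

(** The partial sums of squared coordinates are the squared norm minus the
    squared norm of the residual. *)
Lemma parseval_residual u : residual n u @[n --> \oo] --> (0 : H) ->
  (\sum_(0 <= i <oo) (coordinate i u ^+ 2)%:E = (`|u| ^+ 2)%:E)%E.
Proof.
move=> ru; apply/cvg_lim => //.
under eq_fun do rewrite sumEFin; apply: cvg_EFin; first exact: nearW.
rewrite (_ : _ \o _ = fun n => `|u| ^+ 2 - `|residual n u| ^+ 2); last first.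
  by apply/funext => n /=; rewrite norm_residual subKr.
rewrite -[X in _ --> X]subr0; apply: cvgB; first exact: cvg_cst.
have -> : (0 : R) = `|0 : H| * `|0 : H| by rewrite normr0 mulr0.
by under eq_fun do rewrite expr2; apply: cvgM; apply: cvg_norm.
Qed.

End gram_schmidt.

(** V is the set of vectors whose residuals tend to 0.  It contains f x: if z_n
    is close to x then f z_n is close to f x, and the residual of f z_n is
    eventually 0 while that of the difference is not larger than the
    difference. *)
Lemma hilbert_coordinates (M : completeMetricType R) (zs : nat -> M) (f : M -> H) :
  (forall x (e : R), 0 < e -> exists n, mdist x (zs n) < e) -> continuous f ->
  coordinates f (coordinate (f \o zs))
    [set u | residual (f \o zs) n u @[n --> \oo] --> (0 : H)].
Proof.
move=> zsd cf; split.
- exact: coordinateP.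
- move=> i; apply: functional_continuous => //.
  + exact: coordinateP.
  + exact: coordinate_le.
- apply: cvg_near_cst; apply: nearW => n /=.
  by have := residualP (f \o zs) n (-1) 0 0; rewrite !scaleN1r !addNr.
- move=> a u w /= ru rw; under eq_fun do rewrite residualP.
  by have := cvgD (cvgZ (cvg_cst a) ru) rw; rewrite scaler0 addr0; exact.
- move=> x /=; apply/cvgrPdist_le => eps e0.
  have /cvgrPdist_le/(_ _ e0) := cf x; rewrite -nbhs_ballE => -[d /= d0 xd].
  have [n nd] := zsd x d d0; exists n.+1 => // m /= nm.
  rewrite sub0r normrN.
  have -> : residual (f \o zs) m (f x) = residual (f \o zs) m (f x - f (zs n)).
    by rewrite addrC -scaleN1r residualP (residual0 (f \o zs) nm) scaler0 add0r.
  apply: (le_trans (norm_residual_le _ _ _)).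
  by apply: xd; rewrite ballEmdist.
- exact: parseval_residual.
Qed.

End inner_product.

(** * Simple functions and linear functionals *)

Section simple_functions.
Context {d : measure_display} {T : measurableType d} {R : realType}.
Context {H : normedModType R}.
Implicit Types (s : T -> H) (u v : H).

Lemma simple_sum s (k : T -> H -> R) x : simple_fun s ->
  k x (s x) = \sum_(v <- fset_set (range s)) k x v * \1_(s @^-1` [set v]) x.
Proof.
move=> [fs _]; rewrite (bigD1_seq (s x)) ?fset_uniq//=; last first.
  by rewrite in_fset_set// inE; exists x.
rewrite indicE mem_set// mulr1 big1 ?addr0// => v /eqP vs.
by rewrite indicE memNset ?mulr0//= => /esym.
Qed.

Lemma measurable_simple s (k : T -> H -> R) : simple_fun s ->
  (forall v, measurable_fun setT (k^~ v)) ->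
  measurable_fun setT (fun x => k x (s x)).
Proof.
move=> ss mk; under eq_fun do rewrite (simple_sum k _ ss).
apply: measurable_sum => v; apply: measurable_funM => //.
by apply: measurable_indic; exact: ss.2.
Qed.

Lemma simple_const v : simple_fun (fun _ : T => v).
Proof.
split=> [|w].
  apply: (@sub_finite_set _ _ [set v]); last exact: finite_set1.
  by move=> _ [x _ <-].
have [->|vw] := pselect (v = w).
  by rewrite (_ : _ @^-1` _ = setT)//; apply/seteqP; split.
by rewrite (_ : _ @^-1` _ = set0)//; apply/seteqP; split.
Qed.

Lemma simple_if (A : set T) v s : measurable A -> simple_fun s ->
  simple_fun (fun x => if x \in A then v else s x).
Proof.
move=> mA [fs ms]; split=> [|w].
  apply: (@sub_finite_set _ _ ([set v] `|` range s)); last first.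
    by rewrite finite_setU; split.
  by move=> _ [x _ <-]; case: ifP => _; [left|right; exists x].
have -> : (fun x => if x \in A then v else s x) @^-1` [set w] =
    (A `&` (fun _ => v) @^-1` [set w]) `|` (~` A `&` s @^-1` [set w]).
  apply/seteqP; split=> x /=.
    by case: ifPn => [/set_mem|/negP]; [left|rewrite inE; right].
  move=> [[Ax vw]|[nAx sw]]; first by rewrite mem_set.
  by rewrite memNset.
apply: measurableU; first by apply: measurableI => //; exact: (simple_const v).2.
by apply: measurableI => //; exact: measurableC.
Qed.

Variables (mu : {measure set T -> \bar R}) (D : set T).
Hypotheses (mD : measurable D) (muD : (mu D < +oo)%E).

Lemma bounded_integrable (g : T -> R) (B : R) : measurable_fun setT g ->
  (forall x, D x -> `|g x| <= B) -> mu.-integrable D (EFin \o g).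
Proof.
move=> mg gB; have mg' : measurable_fun D (EFin \o g).
  by apply/measurable_EFinP/measurable_funTS.
apply/integrableP; split => //.
apply: (@le_lt_trans _ _ (\int[mu]_(x in D) `|B|%:E)%E).
  apply: ge0_le_integral => //; first exact: measurableT_comp.
  by move=> x Dx; rewrite /= lee_fin (le_trans (gB x Dx))// ler_norm.
by rewrite integral_cst// lte_mul_pinfty.
Qed.

Variable phi : H -> R.
Hypothesis phiP : forall a u v, phi (a *: u + v) = a * phi u + phi v.
Hypothesis phi_le : forall u, `|phi u| <= `|u|.

Let phi0 : phi 0 = 0.
Proof. by apply/eqP; rewrite -normr_le0 -(normr0 H). Qed.

Lemma functionalB u v : phi (u - v) = phi u - phi v.
Proof. by rewrite addrC -scaleN1r phiP mulN1r addrC. Qed.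

Lemma functionalZ a u : phi (a *: u) = a * phi u.
Proof. by rewrite -[a *: u]addr0 phiP phi0 addr0. Qed.

Lemma functional_sum (l : seq H) (a : H -> R) :
  phi (\sum_(v <- l) a v *: v) = \sum_(v <- l) a v * phi v.
Proof.
by elim: l => [|v l IH]; rewrite ?big_nil ?phi0// !big_cons phiP IH.
Qed.

Let indic_integrable (A : set T) : measurable A ->
  mu.-integrable D (EFin \o (\1_A : T -> R)).
Proof.
move=> mA; apply: (bounded_integrable (B := 1)); first exact: measurable_indic.
by move=> x _; rewrite indicE; case: (_ \in _); rewrite ?normr1 ?normr0.
Qed.

(** The hypotheses on phi say that it is linear and of norm at most 1; they are
    stated for a plain function because coordinates are obtained as such. *)
Lemma functional_simple_integral s : simple_fun s ->
  phi (simple_integral mu D s) = \int[mu]_(x in D) phi (s x).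
Proof.
move=> ss; have [fs ms] := ss.
rewrite /simple_integral fsbig_finite//= functional_sum /Rintegral.
under eq_integral do rewrite (simple_sum (fun _ => phi) _ ss) -sumEFin.
rewrite integral_sum//; last first.
  move=> v; under eq_fun do rewrite EFinM.
  apply: integrableZl => //; exact: (indic_integrable (ms v)).
rewrite [X in fine X](_ : _ = \sum_(v <- fset_set (range s))
    (fine (mu (D `&` s @^-1` [set v])) * phi v)%:E)%E; first by rewrite sumEFin.
apply: eq_bigr => v _; under eq_integral do rewrite EFinM.
rewrite integralZl//; last exact: (indic_integrable (ms v)).
rewrite integral_indic// setIC muleC EFinM fineK// ge0_fin_numE//.
by apply: le_lt_trans muD; apply: le_measure; rewrite ?inE//; exact: measurableI.
Qed.

Lemma simple_integral_near s (f : T -> H) : simple_fun s ->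
  (forall v, measurable_fun setT (fun x => `|f x - v|)) ->
  measurable_fun setT (phi \o f) ->
  mu.-integrable D (EFin \o (phi \o f)) ->
  (\int[mu]_(x in D) (`|f x - s x|)%:E < +oo)%E ->
  `|phi (simple_integral mu D s) - \int[mu]_(x in D) phi (f x)| <=
    \int[mu]_(x in D) `|f x - s x|.
Proof.
move=> ss mfv mf iphi ifs; rewrite functional_simple_integral//.
have mfs := measurable_simple (k := fun x v => `|f x - v|) ss mfv.
have ms : measurable_fun setT (fun x => phi (s x)).
  by apply: (measurable_simple (k := fun _ => phi)).
have ifs' : mu.-integrable D (EFin \o (fun x => `|f x - s x|)).
  apply/integrableP; split; first by apply/measurable_EFinP/measurable_funTS.
  by under eq_integral do rewrite /= normr_id.
have ints : mu.-integrable D (EFin \o (fun x => phi (s x))).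
  apply: (bounded_integrable (B := \sum_(v <- fset_set (range s)) `|phi v|)) => // x _.
  rewrite (simple_sum (fun _ v => `|phi v|) _ ss).
  by apply: ler_sum => v _; rewrite ler_piMr// indicE; case: (_ \in _).
rewrite -RintegralB//.
have isf : mu.-integrable D (EFin \o (fun x => phi (s x) - phi (f x))).
  exact: (integrableB mD ints iphi).
apply: (le_trans (le_normr_Rintegral mD isf)).
apply: le_Rintegral => //.
  by have := integrable_abse isf; apply: eq_integrable.
by move=> x _; rewrite -functionalB distrC phi_le.
Qed.

End simple_functions.

(** * Bochner integrals of continuous functions *)

Section bochner_integral.
Context {R : realType} {M : completeMetricType R} {H : completeNormedModType R}.
Variable dot : {dot H for idfun}.
Hypothesis H_hilbert : hilbert_norm dot.
Variable mu : {measure set (borel_type M) -> \bar R}.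
Hypothesis mu_fin : forall K : set M, compact K -> (mu K < +oo)%E.
Variable f : M -> H.
Hypothesis cf : continuous f.

Let mf (v : H) : measurable_fun setT ((fun x => `|f x - v|) : borel_type M -> R).
Proof.
apply: continuous_borel => x; apply: cvg_norm; apply: cvgB; first exact: cf.
exact: cvg_cst.
Qed.

(** A relatively compact set is covered by finitely many sets on which f varies
    by less than e; assign to a point the value of f at the centre of the first
    of these sets that contains it. *)
Lemma uniform_simple_approximation (D : set M) (e : R) : precompact D -> 0 < e ->
  exists2 s : borel_type M -> H, simple_fun s &
    forall x, D x -> `|f x - s x| <= e.
Proof.
rewrite precompactE compact_cover => cD e0.
pose U y := [set x | `|f x - f y| < e].
have oU y : open (U y).
  rewrite (_ : U y = (fun x => `|f x - f y|) @^-1` [set t | t < e])//.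
  apply: open_comp; last exact: open_lt.
  by move=> x _; apply: cvg_norm; apply: cvgB; [exact: cf|exact: cvg_cst].
have [|x _|F _ FD] := cD M setT U; first by move=> y _; exact: oU.
  by exists x => //; rewrite /U/= subrr normr0.
have : forall l : seq M, exists2 s : borel_type M -> H, simple_fun s &
    forall x y, y \in l -> U y x -> `|f x - s x| <= e.
  elim=> [|y l [s ss sl]].
    by exists (fun=> 0) => //; exact: simple_const.
  exists (fun x => if x \in U y then f y else s x).
    by apply: simple_if => //; exact: sub_sigma_algebra.
  move=> x y'; case: ifPn => [/set_mem/ltW//|xU].
  rewrite inE => /orP[/eqP ->|]; last exact: sl.
  by move=> /mem_set xU'; rewrite xU' in xU.
move=> /(_ F)[s ss sF]; exists s => // x /subset_closure/FD[y /= yF].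
exact: sF.
Qed.

Variable D : set M.
Hypotheses (pD : precompact D) (mD : measurable (D : set (borel_type M))).

Let muD : (mu D < +oo)%E. Proof. exact: precompact_measure. Qed.

Lemma functional_bochner_integral (phi : H -> R) (I : H) :
  (forall a u v, phi (a *: u + v) = a * phi u + phi v) ->
  (forall u, `|phi u| <= `|u|) ->
  is_bochner_integral mu D (f : borel_type M -> H) I ->
  phi I = \int[mu]_(x in D) phi (f x).
Proof.
move=> phiP phi_le [s [ss _ fs JI]].
have cphif := functional_continuous phiP phi_le cf.
have h1 : phi (simple_integral mu D (s n)) @[n --> \oo] --> phi I.
  apply/cvgrPdist_le => e e0; move/cvgrPdist_le : JI => /(_ _ e0).
  by apply: filterS => n; apply: le_trans; rewrite -(functionalB phiP) phi_le.
have h2 : phi (simple_integral mu D (s n)) @[n --> \oo] -->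
    \int[mu]_(x in D) phi (f x).
  move/fine_cvgP : fs => [ffin /cvgrPdist_le fs].
  apply/cvgrPdist_le => e /fs; apply: filterS2 ffin => n fin.
  rewrite sub0r normrN distrC => h.
  apply: le_trans (le_trans (ler_norm _) h).
  apply: (simple_integral_near mD muD phiP phi_le (ss n).1 mf) => //.
  - exact: continuous_borel.
  - exact: continuous_integrable.
  - by rewrite ltey_eq fin.
exact: (cvg_unique _ h1 h2).
Qed.

(** Approximate f uniformly on D by simple functions.  Let J be their integrals;
    the difference u of two of them is estimated by applying the functional that
    norms u, whose values on the J are close to the integral of the real function
    obtained from f.  So the J form a Cauchy sequence. *)
Lemma bochner_integral_exists :
  exists I : H, is_bochner_integral mu D (f : borel_type M -> H) I.
Proof.
have ex n : exists s : borel_type M -> H, simple_fun s /\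
    forall x : M, D x -> `|f x - s x| <= n.+1%:R^-1.
  by have [|s ? ?] := @uniform_simple_approximation D n.+1%:R^-1 pD; [rewrite invr_gt0|exists s].
have [s sP] := choice ex.
have mfs n := measurable_simple (k := fun (x : borel_type M) v => `|f x - v|) (sP n).1 mf.
pose J n := simple_integral mu D (s n).
have le_int n : (\int[mu]_(x in D) `|f x - s n x|%:E <=
    n.+1%:R^-1%:E * mu D)%E.
  rewrite -integral_cst//; apply: ge0_le_integral => //.
  - by apply/measurable_EFinP/measurable_funTS; exact: mfs.
  - by move=> x Dx; rewrite lee_fin; exact: (sP n).2.
have fin_int n : (\int[mu]_(x in D) `|f x - s n x|%:E < +oo)%E.
  by apply: (le_lt_trans (le_int n)); rewrite lte_mul_pinfty.
pose B := fine (mu D).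
have muDE : mu D = B%:E by rewrite fineK// ge0_fin_numE.
have JJ n m : `|J n - J m| <= B / n.+1%:R + B / m.+1%:R.
  set u := J n - J m; pose phi w := dot w (normalize u).
  have phiP a v w : phi (a *: v + w) = a * phi v + phi w by exact: dotPl.
  have phi_le v : `|phi v| <= `|v|.
    apply: (le_trans (dot_le H_hilbert _ _)); rewrite -[leRHS]mulr1.
    by rewrite ler_wpM2l// norm_normalize_le.
  have -> : `|u| = phi u.
    have [->|u0] := eqVneq u 0; first by rewrite normr0 /phi dot0l.
    rewrite /phi dotC -[normalize u]addr0 dotPl H_hilbert dot0l addr0 expr2.
    by rewrite mulKf ?normr_eq0.
  have near k : `|phi (J k) - \int[mu]_(x in D) phi (f x)| <= B / k.+1%:R.
    apply: le_trans (simple_integral_near mD muD phiP phi_le (sP k).1 mf _ _ _) _ => //.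
    - by apply: continuous_borel; exact: functional_continuous.
    - by apply: continuous_integrable => //; exact: functional_continuous.
    - rewrite -lee_fin fineK ?ge0_fin_numE ?integral_ge0//.
      by apply: (le_trans (le_int k)); rewrite muDE -EFinM mulrC.
  rewrite (functionalB phiP).
  have := near n; have := near m.
  rewrite !ler_norml => /andP[a1 a2] /andP[b1 b2].
  by move: a1 a2 b1 b2; set p := B / n.+1%:R; set q := B / m.+1%:R; lra.
have [I JI] : exists I : H, J n @[n --> \oo] --> I.
  apply/cvg_ex; apply/cauchy_cvgP; apply: cauchy_exP => e e0.
  pose N := Num.truncn (2 * B / e).
  have BN k : (N <= k)%N -> B / k.+1%:R < e / 2.
    move=> Nk; rewrite ltr_pdivrMr// mulrC -ltr_pdivrMr ?divr_gt0//.
    rewrite invf_div mulrA [B * 2]mulrC (lt_le_trans (truncnS_gt _))//.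
    by rewrite ler_nat.
  exists (J N); exists N => // n /= Nn; rewrite -ball_normE/=.
  apply: (le_lt_trans (JJ _ _)).
  by rewrite [e]splitr ltrD// BN.
have nearS (e : R) : 0 < e -> \forall n \near \oo, n.+1%:R^-1 <= e.
  move=> e0; have := near_infty_natSinv_lt (PosNum e0).
  by apply: filterS => n /ltW.
exists I, s; split => //.
- move=> n; split; first exact: (sP n).1.
  have cnf : continuous (fun x => `|f x|) by move=> x; apply: cvg_norm; exact: cf.
  have [b b0 fb] := continuous_bounded_on pD cnf.
  have : mu.-integrable D (EFin \o (fun x => `|s n x|)).
    apply: (@bounded_integrable _ (borel_type M) _ mu D mD muD _ (b + n.+1%:R^-1)).
      by apply: (measurable_simple (k := fun _ v => `|v|)) => //; exact: (sP n).1.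
    move=> x Dx; rewrite normr_id -[s n x](subrKC (f x)).
    apply: (le_trans (ler_normD _ _)); apply: lerD.
      by have := fb x Dx; rewrite normr_id.
    by rewrite distrC; exact: (sP n).2.
  exact: integrable_lty.
- apply: aeW => x Dx; apply/cvgrPdist_le => e e0.
  near=> n; apply: (le_trans ((sP n).2 x Dx)).
  near: n; exact: nearS.
- apply/fine_cvgP; split.
    by apply: nearW => n; rewrite ge0_fin_numE// integral_ge0.
  apply/cvgrPdist_le => e e0.
  have B0 : 0 <= B by exact: fine_ge0.
  have e1 : 0 < e / (B + 1) by rewrite divr_gt0// ltr_wpDl.
  near=> n.
  rewrite sub0r normrN /= ger0_norm ?fine_ge0 ?integral_ge0//.
  rewrite -lee_fin fineK ?ge0_fin_numE ?integral_ge0//.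
  apply: (le_trans (le_int n)); rewrite muDE -EFinM lee_fin.
  apply: (@le_trans _ _ (e / (B + 1) * B)).
    rewrite ler_wpM2r//.
    by near: n; exact: (nearS _ e1).
  rewrite mulrAC ler_pdivrMr; last by rewrite ltr_wpDl.
  by rewrite ler_wpM2l ?lerDl ?ltW.
Unshelve. all: by end_near.
Qed.

Lemma functional_bochner (phi : H -> R) :
  (forall a u v, phi (a *: u + v) = a * phi u + phi v) ->
  (forall u, `|phi u| <= `|u|) ->
  phi (bochner mu D (f : borel_type M -> H)) = \int[mu]_(x in D) phi (f x).
Proof.
move=> phiP phi_le; rewrite /bochner; case: xgetP => [I _ fI|noI].
  exact: functional_bochner_integral.
by have [I fI] := bochner_integral_exists; case: (noI I).
Qed.

End bochner_integral.

(** The mean value property passes to the images of f under linear functionals.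
    When the ball is negligible both sides vanish. *)
Lemma functional_mean_value (R : realType) (M : completeMetricType R)
    (H : completeNormedModType R) (dot : {dot H for idfun})
    (mu : {measure set (borel_type M) -> \bar R}) (o : M) (h : R) (f : M -> H)
    (phi : H -> R) (z : M) (r : R) :
  proper_space M -> hilbert_norm dot ->
  (forall K : set M, compact K -> (mu K < +oo)%E) ->
  continuous f -> MVP mu o h f ->
  (forall a u v, phi (a *: u + v) = a * phi u + phi v) ->
  (forall u, `|phi u| <= `|u|) ->
  \int[mu]_(x in ball z r) phi (f x) = phi (f z) * fine (mu (ball z r)).
Proof.
move=> Mp Hh mu_fin cf fM phiP phi_le.
have mB := borel_ball z r; have pB := precompact_ball Mp z r.
have := measure_ge0 mu (ball z r); rewrite le_eqVlt => /predU1P[mu0|mu0].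
  rewrite -mu0 mulr0 /Rintegral (@null_set_integral _ (borel_type M))//.
  apply/measurable_EFinP; apply: measurable_funS (continuous_borel _) => //.
  exact: functional_continuous phiP phi_le cf.
have mu_neq0 : fine (mu (ball z r)) != 0.
  apply: lt0r_neq0; apply: fine_gt0; apply/andP; split => //.
  exact: (precompact_measure mu_fin pB mB).
have r0 : 0 < r.
  rewrite ltNge; apply/negP => r0; move: mu0.
  rewrite (_ : ball z r = set0) ?measure0 ?ltxx//.
  apply/seteqP; split=> x //= /ballP; rewrite ltNge => /negP; apply.
  exact: le_trans r0 (mdist_ge0 _ _).
rewrite {1}(mvp_mean fM r0 mu0) (functionalZ phiP phi_le).
rewrite (functional_bochner Hh mu_fin cf pB mB phiP phi_le).
by rewrite mulrAC mulVf// mul1r.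
Qed.

(** * Volume growth of annuli *)

Section annuli.
Context {R : realType} {M : completeMetricType R}.
Implicit Types z : M.

Lemma annulusE z (k : nat) : annulus z k = ball z k.+1%:R `\` ball z k%:R.
Proof.
apply/seteqP; split => x /=.
  by move=> /andP[kx xk]; split; [exact/ballP|move=> /ballP; rewrite ltNge kx].
move=> [/ballP xk1 xk]; apply/andP; split => //; rewrite leNgt; apply/negP => ?.
by apply: xk; exact/ballP.
Qed.

Lemma borel_annulus_nat z k : measurable (annulus z k : set (borel_type M)).
Proof. by rewrite annulusE; exact: borel_annulus. Qed.

Lemma bigcup_annulus z : \bigcup_k annulus z k = setT.
Proof.
apply/seteqP; split => // x _; exists (Num.truncn (mdist x z)) => //.
by apply/andP; split; [rewrite truncn_le mdist_ge0|exact: truncnS_gt].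
Qed.

Lemma trivIset_annulus z : trivIset setT (annulus z).
Proof.
apply/trivIsetP => i j _ _ ij; apply/seteqP; split => // x [/=].
move=> /andP[ix xi] /andP[jx xj].
have := le_lt_trans ix xj; have := le_lt_trans jx xi; rewrite !ltr_nat !ltnS => ji ij'.
by move/eqP: ij; apply; apply/eqP; rewrite eqn_leq ij' ji.
Qed.

Lemma integral_annuli (mu : {measure set (borel_type M) -> \bar R}) z (g : borel_type M -> \bar R) :
  measurable_fun setT g -> (forall x, (0 <= g x)%E) ->
  (\int[mu]_x g x = \sum_(0 <= k <oo) \int[mu]_(x in annulus z k) g x)%E.
Proof.
move=> mg g0; rewrite -[in LHS](bigcup_annulus z) ge0_integral_bigcup//.
- by move=> k; exact: borel_annulus_nat.
- exact: measurable_funTS.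
- exact: trivIset_annulus.
Qed.

End annuli.

Section mass_growth.
Context {R : realType} {M : completeMetricType R}.
Variable mu : {measure set (borel_type M) -> \bar R}.
Hypothesis M_proper : proper_space M.
Hypothesis mu_fin : forall K : set M, compact K -> (mu K < +oo)%E.
Variables (h beta : R).
Hypotheses (h_gt0 : 0 < h) (beta_ge0 : 0 <= beta).
Hypothesis mu_growth : exponential_growth mu h beta.
Implicit Types z : M.

Definition mass s z : \bar R := (\int[mu]_x (weight s z x)%:E)%E.

Let vol z r : R := fine (mu (ball z r)).

Let muE z r : mu (ball z r) = (vol z r)%:E.
Proof.
rewrite fineK// ge0_fin_numE//; apply: precompact_measure => //.
  exact: precompact_ball M_proper _ _.
exact: borel_ball.
Qed.

Lemma vol_asymptotics z : exists c : R, 0 < c /\ forall e : R, 0 < e ->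
  exists r0 : R, forall r, r0 <= r ->
    c * (1 - e) * (r `^ beta * expR (r * h)) <= vol z r /\
    vol z r <= c * (1 + e) * (r `^ beta * expR (r * h)).
Proof.
have [c c0 cl] := mu_growth z; exists c; split => // e e0.
move/cvgrPdist_le : cl => /(_ _ e0) [r1 [_ r1P]].
exists (Num.max 1 (r1 + 1)) => r; rewrite ge_max => /andP[r1' rr].
have := r1P r; rewrite (lt_le_trans _ rr) ?ltrDl// => /(_ isT).
have p0 : 0 < c * r `^ beta * expR (r * h).
  by rewrite !mulr_gt0// ?expR_gt0// powR_gt0// (lt_le_trans ltr01).
rewrite distrC ler_distl => /andP[]; rewrite ler_pdivlMr// ler_pdivrMr//.
rewrite -/(vol z r) => a b; split; apply: le_trans.
- by apply: le_trans a; rewrite [leLHS](_ : _ = (1 - e) * (c * r `^ beta * expR (r * h)))//; ring.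
- exact: lexx.
- exact: b.
- by rewrite [leRHS](_ : _ = (1 + e) * (c * r `^ beta * expR (r * h)))//; ring.
Qed.

Lemma vol_mono z r r' : r <= r' -> vol z r <= vol z r'.
Proof.
move=> rr'; rewrite -lee_fin -!muE; apply: le_measure; rewrite ?inE.
- exact: borel_ball.
- exact: borel_ball.
- exact: le_ball.
Qed.

Lemma vol_annulus z k : mu (annulus z k) = (vol z k.+1%:R - vol z k%:R)%:E.
Proof.
have m1 := borel_ball z k%:R; have m2 := borel_ball z k.+1%:R.
have fin : (mu (ball z k.+1%:R) < +oo)%E by rewrite muE ltry.
rewrite annulusE EFinB -!muE (measureD m2 m1 fin) setIidr//.
by apply: le_ball; rewrite ler_nat.
Qed.

(** For large k this is the growth of balls; the finitely many other values of k
    only affect the constant. *)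
Lemma vol_upper z : exists2 B : R, 0 < B & forall k : nat,
  vol z k.+1%:R <= B * (k.+1%:R `^ beta * expR (k%:R * h)).
Proof.
have [c [c0 /(_ _ ltr01) [r0 r0P]]] := vol_asymptotics z.
have v0 : 0 <= vol z r0 by exact: fine_ge0.
(* The first summand serves the k below r0, the second the others. *)
exists (vol z r0 + c * 2 * expR h).
  by rewrite ltr_wpDl// !mulr_gt0 ?expR_gt0.
move=> k; have w1 : 1 <= k.+1%:R `^ beta * expR (k%:R * h).
  rewrite -[X in X <= _]mulr1 ler_pM//; last first.
    by rewrite -expR0 ler_expR mulr_ge0// ltW.
  have : 1 `^ beta <= k.+1%:R `^ beta :> R by rewrite ge0_ler_powR ?nnegrE// ler1n.
  by rewrite powR1.
have w0 := le_trans ler01 w1.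
have [kr|kr] := leP r0 k.+1%:R.
  have [_ /le_trans->//] := r0P _ kr.
  have -> : c * (1 + 1) * (k.+1%:R `^ beta * expR (k.+1%:R * h)) =
      c * 2 * expR h * (k.+1%:R `^ beta * expR (k%:R * h)).
    by rewrite -natr1 mulrDl mul1r expRD; ring.
  by rewrite mulrDl lerDr mulr_ge0.
apply: (le_trans (vol_mono z (ltW kr))).
rewrite mulrDl -[leLHS]addr0 lerD// ?ler_peMr//.
by rewrite !mulr_ge0// ?expR_ge0// ltW.
Qed.

(** The volume of a ball is multiplied by about exp h when the radius increases
    by 1, and exp h > 1: a fixed proportion of the larger ball lies in the
    outermost annulus.  The e in the proof is a relative error for which this
    remains true. *)
Lemma vol_lower z : exists2 a : R, 0 < a & exists k0 : nat, forall k : nat,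
  (k0 <= k)%N -> a * (k%:R `^ beta * expR (k%:R * h)) <= vol z k.+1%:R - vol z k%:R.
Proof.
have [c [c0 volP]] := vol_asymptotics z.
have eh1 : 1 < expR h by rewrite expR_gt1.
pose e := (expR h - 1) / (2 * (expR h + 1)).
have e0 : 0 < e by rewrite divr_gt0 ?subr_gt0// mulr_gt0// addr_gt0 ?expR_gt0.
have [r0 r0P] := volP e e0.
exists (c * ((expR h - 1) / 2)); first by rewrite mulr_gt0// divr_gt0// subr_gt0.
exists (Num.truncn r0).+1 => k rk.
have r0k : r0 <= k%:R by apply: ltW; rewrite (lt_le_trans (truncnS_gt _))// ler_nat.
have r0k1 : r0 <= k.+1%:R by rewrite (le_trans r0k)// ler_nat.
have [lo _] := r0P _ r0k1; have [_ up] := r0P _ r0k.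
apply: le_trans (lerB lo up).
have e1 : e < 1.
  by rewrite ltr_pdivrMr ?mul1r ?mulr_gt0// ?addr_gt0 ?expR_gt0//; lra.
have kk : k%:R `^ beta <= k.+1%:R `^ beta.
  by rewrite ge0_ler_powR ?nnegrE// ler_nat.
have eE : expR (k.+1%:R * h) = expR h * expR (k%:R * h).
  by rewrite -natr1 mulrDl mul1r expRD mulrC.
apply: (@le_trans _ _ (c * (1 - e) * (k%:R `^ beta * (expR h * expR (k%:R * h))) -
    c * (1 + e) * (k%:R `^ beta * expR (k%:R * h)))); last first.
  rewrite eE lerB// ler_wpM2l//; first by rewrite mulr_ge0 ?subr_ge0// ltW.
  by rewrite ler_wpM2r// mulr_ge0 ?expR_ge0.
rewrite le_eqVlt; apply/orP; left; apply/eqP.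
rewrite /e; field.
by rewrite gt_eqF// addr_gt0// expR_gt0.
Qed.

End mass_growth.

(** * The mass of an exponential weight near the critical exponent *)

Section mass_bounds.
Context {R : realType} {M : completeMetricType R}.
Variable mu : {measure set (borel_type M) -> \bar R}.
Hypothesis M_proper : proper_space M.
Hypothesis mu_fin : forall K : set M, compact K -> (mu K < +oo)%E.
Variables (h beta : R).
Hypotheses (h_gt0 : 0 < h) (beta_ge0 : 0 <= beta).
Hypothesis mu_growth : exponential_growth mu h beta.
Implicit Types z : M.

(** With x = e t / (2 (beta + 1)), it suffices that x^beta <= exp (beta x). *)
Lemma powR_le_expR (e t : R) : 0 < e -> 0 <= t ->
  t `^ beta <= (2 * (beta + 1)) `^ beta / e `^ beta * expR (e * t / 2).
Proof.
move=> e0 t0; have b0 : 0 < 2 * (beta + 1) by rewrite mulr_gt0// ltr_wpDl.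
pose x := t * e / (2 * (beta + 1)).
have x0 : 0 <= x by apply: divr_ge0; [apply: mulr_ge0 => //|]; exact: ltW.
have eN : e != 0 by rewrite gt_eqF.
have bN : beta + 1 != 0 by rewrite gt_eqF// ltr_wpDl.
have tE : t = 2 * (beta + 1) * (e^-1 * x).
  by rewrite /x; field; rewrite ?eN ?bN.
rewrite [in leLHS]tE.
have ei0 : 0 <= e^-1 by rewrite invr_ge0 ltW.
rewrite (powRM _ (ltW b0) (mulr_ge0 ei0 x0)) (powRM _ ei0 x0).
rewrite -mulrA ler_wpM2l ?powR_ge0//.
have -> : e^-1 `^ beta = (e `^ beta)^-1.
  by rewrite -powR_inv1 ?(ltW e0)// -powRrM mulN1r powRN.
rewrite ler_wpM2l ?invr_ge0 ?powR_ge0//.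
apply: (@le_trans _ _ (expR x `^ beta)).
  rewrite ge0_ler_powR ?nnegrE ?expR_ge0//.
  by apply: le_trans (expR_ge1Dx x); rewrite lerDr.
rewrite -expRM ler_expR.
have -> : e * t / 2 = x * (beta + 1) by rewrite /x; field; rewrite ?eN ?bN.
by rewrite ler_wpM2l// lerDl.
Qed.

Lemma powR1D (e : R) : 0 < e -> e `^ (1 + beta) = e * e `^ beta.
Proof.
move=> e0; rewrite powRD; last by rewrite (gt_eqF e0) implybT.
by rewrite powRr1// ltW.
Qed.

Lemma measurable_weight s z : measurable_fun setT (weight s z : borel_type M -> R).
Proof. by apply: continuous_borel; exact: continuous_weight. Qed.

Lemma mass_annuli s z : (mass mu s z =
  \sum_(0 <= k <oo) \int[mu]_(x in annulus z k) (weight s z x)%:E)%E.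
Proof.
rewrite /mass (integral_annuli _ z)//.
- by apply/measurable_EFinP; exact: measurable_weight.
- by move=> x; rewrite lee_fin weight_ge0.
Qed.

Lemma annulus_weight_le s z k : 0 <= s ->
  (\int[mu]_(x in annulus z k) (weight s z x)%:E <=
   (expR (- (s * k%:R)))%:E * mu (annulus z k))%E.
Proof.
move=> s0; have m := borel_annulus_nat z k.
rewrite -integral_cst//; apply: ge0_le_integral => //.
- by move=> x _; rewrite lee_fin weight_ge0.
- by apply/measurable_EFinP/measurable_funTS; exact: measurable_weight.
- move=> x /andP[kx _]; rewrite lee_fin ler_expR lerN2 ler_wpM2l//.
Qed.

Lemma annulus_weight_ge s z k : 0 <= s ->
  ((expR (- (s * k.+1%:R)))%:E * mu (annulus z k) <=
   \int[mu]_(x in annulus z k) (weight s z x)%:E)%E.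
Proof.
move=> s0; have m := borel_annulus_nat z k.
rewrite -integral_cst//; apply: ge0_le_integral => //.
- by move=> x _; rewrite lee_fin expR_ge0.
- by apply/measurable_EFinP/measurable_funTS; exact: measurable_weight.
- move=> x /andP[_ xk]; rewrite lee_fin ler_expR lerN2 ler_wpM2l//.
  exact: ltW.
Qed.

Lemma nneseries_geometric (a q : R) : 0 <= a -> 0 <= q < 1 ->
  (\sum_(0 <= k <oo) (a * q ^+ k)%:E = (a / (1 - q))%:E)%E.
Proof.
move=> a0 /andP[q0 q1]; apply/cvg_lim => //.
under eq_fun do rewrite sumEFin; apply: cvg_EFin; first exact: nearW.
by have := @cvg_geometric_series R a q; rewrite ger0_norm// => /(_ q1).
Qed.

(** The sum over k of k^beta exp (- e k) is of order e^(- 1 - beta): half of the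
    exponential absorbs k^beta at the cost of e^(- beta), and the other half
    gives a geometric series of sum of order 1/e. *)
Lemma mass_upper z : exists2 C : R, 0 < C & forall e : R, 0 < e ->
  (mass mu (h + e) z <= (C * expR e / e `^ (1 + beta))%:E)%E.
Proof.
have [B B0 vB] := vol_upper M_proper mu_fin h_gt0 beta_ge0 mu_growth z.
pose Db := (2 * (beta + 1)) `^ beta.
have Db0 : 0 < Db by rewrite powR_gt0// mulr_gt0// ltr_wpDl.
exists (2 * B * Db); first by rewrite !mulr_gt0.
move=> e e0; have he0 : 0 <= h + e by rewrite addr_ge0// ltW.
have eb0 : 0 < e `^ beta by rewrite powR_gt0.
pose a := B * Db / e `^ beta * expR (e / 2).
pose q := expR (- (e / 2)).
have a0 : 0 <= a by rewrite !mulr_ge0 ?invr_ge0 ?expR_ge0// ltW.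
have q0 : 0 <= q by exact: expR_ge0.
have q1 : q < 1 by rewrite -expR0 ltr_expR oppr_lt0 divr_gt0.
rewrite mass_annuli.
apply: (@le_trans _ _ (\sum_(0 <= k <oo) (a * q ^+ k)%:E)%E).
  apply: lee_nneseries => [k _ _|k _].
    by apply: integral_ge0 => x _; rewrite lee_fin weight_ge0.
  apply: (le_trans (annulus_weight_le _ _ he0)).
  rewrite vol_annulus// -EFinM lee_fin.
  apply: (@le_trans _ _ (expR (- ((h + e) * k%:R)) * (B * (k.+1%:R `^ beta * expR (k%:R * h))))).
    rewrite ler_wpM2l ?expR_ge0//; apply: le_trans (vB k).
    by rewrite gerBl fine_ge0.
  have := powR_le_expR e0 (ler0n R k.+1); rewrite -/Db => pk.
  have -> : expR (- ((h + e) * k%:R)) * (B * (k.+1%:R `^ beta * expR (k%:R * h))) =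
      B * expR (- (e * k%:R)) * k.+1%:R `^ beta.
    have -> : expR (- ((h + e) * k%:R)) = expR (- (e * k%:R)) / expR (k%:R * h).
      by rewrite -expRN -expRD; congr expR; ring.
    by field; rewrite gt_eqF// expR_gt0.
  apply: (@le_trans _ _ (B * expR (- (e * k%:R)) * (Db / e `^ beta * expR (e * k.+1%:R / 2)))).
    by rewrite ler_wpM2l// mulr_ge0 ?expR_ge0// ltW.
  rewrite le_eqVlt; apply/orP; left; apply/eqP.
  have -> : q ^+ k = expR (- (e * k%:R)) * expR (e * k%:R / 2).
    by rewrite /q -expRM_natl -expRD; congr expR; rewrite -mulr_natl; field.
  have -> : expR (e * k.+1%:R / 2) = expR (e * k%:R / 2) * expR (e / 2).
    by rewrite -expRD; congr expR; rewrite -natr1; field.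
  by rewrite /a; ring.
rewrite nneseries_geometric ?q0// lee_fin.
have q1' : e / 2 * q <= 1 - q.
  rewrite lerBrDl -[leRHS](_ : expR (e / 2) * q = 1); last first.
    by rewrite /q -expRD subrr expR0.
  by rewrite -{1}[q]mul1r -mulrDl ler_wpM2r// expR_ge1Dx.
rewrite ler_pdivrMr ?subr_gt0//.
rewrite powR1D//.
apply: (@le_trans _ _ (2 * B * Db * expR e / (e * e `^ beta) * (e / 2 * q))); last first.
  rewrite ler_wpM2l// divr_ge0 ?mulr_ge0 ?expR_ge0// ltW//.
rewrite le_eqVlt; apply/orP; left; apply/eqP.
have -> : expR e = expR (e / 2) * expR (e / 2) by rewrite -expRD; congr expR; field.
rewrite /a /q expRN; field.
by rewrite ?gt_eqF ?expR_gt0.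
Qed.

Lemma mass_fin s z : h < s -> mass mu s z \is a fin_num.
Proof.
move=> hs; rewrite ge0_fin_numE; last first.
  by apply: integral_ge0 => x _; rewrite lee_fin weight_ge0.
have [C C0 CP] := mass_upper z; have := CP (s - h); rewrite subr_gt0 => /(_ hs).
by rewrite addrC subrK => /le_lt_trans; apply; rewrite ltry.
Qed.

(** Let m be about 1/e.  Each of the m annuli at distances between m and 2m
    contributes at least a constant times m^beta, since exp (- e k) is bounded
    below there. *)
Lemma mass_lower z (E : R) : 0 < E -> exists2 c : R, 0 < c & forall e : R, 0 < e -> e <= E ->
  ((c / e `^ (1 + beta))%:E <= mass mu (h + e) z)%E.
Proof.
move=> E0; have [a a0 [k0 vk]] := vol_lower h_gt0 beta_ge0 mu_growth z.
(* Q bounds e m. *)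
pose Q := 1 + E * k0.+1%:R.
exists (a * expR (- (h + 2 * Q))); first by rewrite mulr_gt0 ?expR_gt0.
move=> e e0 eE; have he0 : 0 <= h + e by rewrite addr_ge0// ltW.
(* The added k0 + 1 makes the lower bound on volumes available from m on. *)
pose m := (Num.truncn e^-1 + k0.+1)%N.
have em : e^-1 <= m%:R.
  apply: ltW; apply: (lt_le_trans (truncnS_gt _)).
  by rewrite ler_nat /m addnS ltnS leq_addr.
have mQ : e * m%:R <= Q.
  rewrite /m natrD mulrDr lerD//; last by rewrite ler_wpM2r.
  by rewrite -ler_pdivlMl// mulr1 truncn_le invr_ge0 ltW.
have m0 : 0 < m%:R :> R by rewrite (lt_le_trans _ em)// invr_gt0.
rewrite mass_annuli.
have ge0 k : (0 <= \int[mu]_(x in annulus z k) (weight (h + e) z x)%:E)%E.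
  by apply: integral_ge0 => x _; rewrite lee_fin weight_ge0.
apply: le_trans (nneseries_lim_ge (m + m) (fun k _ _ => ge0 k)).
rewrite (big_cat_nat (n := m))//= ?leq_addr//.
apply: (@le_trans _ _ (\sum_(m <= k < m + m) \int[mu]_(x in annulus z k) (weight (h + e) z x)%:E)%E); last first.
  by rewrite leeDr// sume_ge0.
pose t := a * expR (- (h + 2 * Q)) * m%:R `^ beta.
apply: (@le_trans _ _ (\sum_(m <= k < m + m) t%:E)%E); last first.
  rewrite [leLHS]big_nat [leRHS]big_nat; apply: lee_sum => k /andP[mk km].
  apply: le_trans (annulus_weight_ge _ _ he0).
  rewrite vol_annulus// -EFinM lee_fin.
  have k0k : (k0 <= k)%N by apply: leq_trans mk; rewrite /m addnS ltnW// ltnS leq_addl.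
  apply: (@le_trans _ _ (expR (- ((h + e) * k.+1%:R)) * (a * (k%:R `^ beta * expR (k%:R * h))))); last first.
    by rewrite ler_wpM2l ?expR_ge0// vk.
  have -> : expR (- ((h + e) * k.+1%:R)) * (a * (k%:R `^ beta * expR (k%:R * h))) =
      a * expR (- (h + e * k.+1%:R)) * k%:R `^ beta.
    have -> : expR (- (h + e * k.+1%:R)) = expR (- ((h + e) * k.+1%:R)) * expR (k%:R * h).
      by rewrite -expRD; congr expR; rewrite -natr1; ring.
    by ring.
  rewrite /t ler_pM//.
  - by rewrite mulr_ge0 ?expR_ge0// ltW.
  - rewrite ler_wpM2l ?(ltW a0)// ler_expR lerN2 lerD2l.
    apply: (@le_trans _ _ (e * (m + m)%:R)); first by rewrite ler_wpM2l ?(ltW e0)// ler_nat.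
    by rewrite natrD mulrDr; lra.
  - by rewrite ge0_ler_powR ?nnegrE// ler_nat.
rewrite sumEFin lee_fin big_const_nat addKn iter_addr_0 -[t *+ m]mulr_natr.
rewrite /t -[leRHS]mulrA ler_wpM2l//; first by rewrite mulr_ge0 ?expR_ge0// ltW.
rewrite powR1D// invfM mulrC ler_pM ?invr_ge0 ?powR_ge0 ?(ltW e0)//.
rewrite -powRN -[- beta]mulN1r powRrM powR_inv1 ?(ltW e0)//.
by rewrite ge0_ler_powR ?nnegrE ?invr_ge0 ?(ltW e0).
Qed.

Lemma mass_gt0 s z : h < s -> (0 < mass mu s z)%E.
Proof.
move=> hs; have s0 : 0 < s - h by rewrite subr_gt0.
have [c c0 cP] := mass_lower z s0; have := cP _ s0 (lexx _).
rewrite subrKC; apply: lt_le_trans.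
by rewrite lte_fin divr_gt0// powR_gt0.
Qed.

End mass_bounds.

Section mass_regularity.
Context {R : realType} {M : completeMetricType R}.
Variable mu : {measure set (borel_type M) -> \bar R}.
Hypothesis M_proper : proper_space M.
Hypothesis mu_fin : forall K : set M, compact K -> (mu K < +oo)%E.
Variables (h beta : R).
Hypotheses (h_gt0 : 0 < h) (beta_ge0 : 0 <= beta).
Hypothesis mu_growth : exponential_growth mu h beta.
Implicit Types z : M.

(** The mean value inequality: the difference is at most (e - e') d times
    exp (- e d / 2), and the factor e d / 4 is absorbed by exp (e d / 4). *)
Lemma expR_difference_le (e e' d : R) : 0 < e -> e / 2 <= e' -> e' <= e -> 0 <= d ->
  expR (- (e' * d)) <= expR (- (e * d)) + 4 * ((e - e') / e) * expR (- (e / 4 * d)).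
Proof.
move=> e0 e2 e'e d0; rewrite -lerBlDl.
have t0 : 0 <= (e - e') * d by rewrite mulr_ge0// subr_ge0.
have -> : expR (- (e' * d)) - expR (- (e * d)) =
    expR (- (e' * d)) * (1 - expR (- ((e - e') * d))).
  by rewrite mulrBr mulr1 -expRD; congr (_ - expR _); ring.
have le1 : expR (- (e' * d)) <= expR (- (e / 2 * d)).
  by rewrite ler_expR lerN2 ler_wpM2r.
have le2 : 1 - expR (- ((e - e') * d)) <= (e - e') * d.
  by have := expR_ge1Dx (- ((e - e') * d)); lra.
have le3 : 0 <= 1 - expR (- ((e - e') * d)).
  by rewrite subr_ge0 -[leRHS]expR0 ler_expR oppr_le0.
apply: (le_trans (ler_pM (expR_ge0 _) le3 le1 le2)).
have -> : expR (- (e / 4 * d)) = expR (- (e / 2 * d)) * expR (e / 4 * d).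
  by rewrite -expRD; congr expR; field.
have -> : (e - e') * d = 4 * ((e - e') / e) * (e / 4 * d).
  by field; rewrite gt_eqF.
rewrite mulrCA ler_wpM2l//.
  by rewrite mulr_ge0// divr_ge0 ?subr_ge0// ltW.
rewrite ler_wpM2l ?expR_ge0//.
by apply: le_trans (expR_ge1Dx _); rewrite lerDr.
Qed.

(** Integrate [expR_difference_le]; the error term is a mass at e/4, which by
    [mass_upper] and [mass_lower] is comparable to the mass at e. *)
Lemma mass_ratio z (E : R) : 0 < E -> exists2 K : R, 0 <= K & forall e e' : R,
  0 < e -> e <= E -> e / 2 <= e' -> e' <= e ->
  fine (mass mu (h + e') z) <= (1 + K * ((e - e') / e)) * fine (mass mu (h + e) z).
Proof.
move=> E0.
have [C C0 CP] := mass_upper M_proper mu_fin h_gt0 beta_ge0 mu_growth z.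
have [c c0 cP] := mass_lower M_proper mu_fin h_gt0 beta_ge0 mu_growth z E0.
have fin s : h < s -> mass mu s z \is a fin_num.
  exact: (mass_fin M_proper mu_fin h_gt0 beta_ge0 mu_growth).
exists (4 * (C * expR E * 4 `^ (1 + beta) / c)).
  by rewrite !mulr_ge0 ?expR_ge0 ?powR_ge0 ?invr_ge0// ltW.
move=> e e' e0 eE e2 e'e.
have e40 : 0 < e / 4 by rewrite divr_gt0.
have e'0 : 0 < e' by apply: lt_le_trans e2; rewrite divr_gt0.
have r0 : 0 <= (e - e') / e by rewrite divr_ge0 ?subr_ge0// ltW.
have fin1 := fin (h + e') ltac:(by rewrite ltrDl).
have fin2 := fin (h + e) ltac:(by rewrite ltrDl).
have fin3 := fin (h + e / 4) ltac:(by rewrite ltrDl).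
have step1 : (mass mu (h + e') z <= mass mu (h + e) z +
    (4 * ((e - e') / e))%:E * mass mu (h + e / 4) z)%E.
  rewrite /mass -ge0_integralZl_EFin//; last 3 first.
  - by move=> x _; rewrite lee_fin weight_ge0.
  - by apply/measurable_EFinP; exact: measurable_weight.
  - by rewrite mulr_ge0.
  rewrite -ge0_integralD//; last 4 first.
  - by move=> x _; rewrite lee_fin weight_ge0.
  - by apply/measurable_EFinP; exact: measurable_weight.
  - move=> x _; rewrite -EFinM lee_fin mulr_ge0 ?weight_ge0//.
    by rewrite mulr_ge0.
  - apply/measurable_EFinP; apply: measurable_funM => //; exact: measurable_weight.
  apply: ge0_le_integral => //.
  - by move=> x _; rewrite lee_fin weight_ge0.
  - by apply/measurable_EFinP; exact: measurable_weight.
  - apply: emeasurable_funD; first by apply/measurable_EFinP; exact: measurable_weight.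
    by apply/measurable_EFinP; apply: measurable_funM => //; exact: measurable_weight.
  - move=> x _; rewrite -EFinM -EFinD lee_fin /weight.
    have wE (t : R) : expR (- ((h + t) * mdist x z)) =
        expR (- (h * mdist x z)) * expR (- (t * mdist x z)).
      by rewrite -expRD; congr expR; ring.
    rewrite !wE mulrCA -mulrDr ler_wpM2l ?expR_ge0//.
    by apply: expR_difference_le => //; exact: mdist_ge0.
have step2 : fine (mass mu (h + e / 4) z) <=
    C * expR E * 4 `^ (1 + beta) / c * fine (mass mu (h + e) z).
  have := CP _ e40; have := cP _ e0 eE.
  rewrite -[mass mu (h + e) z]fineK// -[mass mu (h + e / 4) z]fineK// !lee_fin.
  rewrite !(powRM _ (ltW e0)) ?invr_ge0// => l u; apply: (le_trans u).
  have -> : 4^-1 `^ (1 + beta) = (4 `^ (1 + beta))^-1 :> R.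
    by rewrite -powR_inv1// -powRrM mulN1r powRN.
  have p0 : 0 < e `^ (1 + beta) by rewrite powR_gt0.
  have p40 : 0 < 4 `^ (1 + beta) :> R by rewrite powR_gt0.
  apply: (@le_trans _ _ (C * expR E * 4 `^ (1 + beta) / e `^ (1 + beta))).
    rewrite invfM invrK mulrA mulrAC ler_pM2r ?invr_gt0//.
    by rewrite ler_pM2r// ler_pM2l// ler_expR; lra.
  rewrite -[leRHS]mulrA ler_wpM2l ?mulr_ge0 ?expR_ge0 ?powR_ge0 ?(ltW C0)//.
  by rewrite -ler_pdivrMl ?invr_gt0// invrK.
move: step1; rewrite -[mass mu (h + e') z]fineK// -[mass mu (h + e) z]fineK//.
rewrite -[mass mu (h + e / 4) z]fineK// -EFinM -EFinD lee_fin/= => step1.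
apply: (le_trans step1); rewrite [leRHS]mulrDl mul1r lerD2l.
apply: (le_trans (ler_wpM2l _ step2)); first by rewrite mulr_ge0.
by rewrite le_eqVlt; apply/orP; left; apply/eqP; ring.
Qed.

Lemma integral_ball_annuli (g : borel_type M -> \bar R) z k :
  measurable_fun setT g -> (forall x, (0 <= g x)%E) ->
  (\int[mu]_(x in ball z k%:R) g x =
   \sum_(0 <= j < k) \int[mu]_(x in annulus z j) g x)%E.
Proof.
move=> mg g0; elim: k => [|k IH].
  rewrite big_geq// (_ : ball z 0 = set0) ?integral_set0//.
  apply/seteqP; split => x //= /ballP; rewrite ltNge => /negP; apply.
  exact: mdist_ge0.
rewrite big_nat_recr//= -IH annulusE.
have sub : ball z k%:R `<=` (ball z k.+1%:R : set M).
  by apply: le_ball; rewrite ler_nat.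
rewrite -[in LHS](setDUK sub) ge0_integral_setU//.
- exact: borel_ball.
- exact: borel_annulus.
- exact: measurable_funTS.
- by apply/disj_setPS => x [? []].
Qed.

Lemma ball_mass_cvg s z : h < s ->
  \int[mu]_(x in ball z k%:R) weight s z x @[k --> \oo] --> fine (mass mu s z).
Proof.
move=> hs; have fin := mass_fin M_proper mu_fin h_gt0 beta_ge0 mu_growth z hs.
have : (\int[mu]_(x in ball z k%:R) (weight s z x)%:E)%E @[k --> \oo] -->
    (fine (mass mu s z))%:E.
  rewrite fineK// mass_annuli.
  have E k : (\int[mu]_(x in ball z k%:R) (weight s z x)%:E =
      \sum_(0 <= j < k) \int[mu]_(x in annulus z j) (weight s z x)%:E)%E.
    apply: integral_ball_annuli; last by move=> x; rewrite lee_fin weight_ge0.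
    by apply/measurable_EFinP; exact: measurable_weight.
  under eq_fun do rewrite E.
  apply: is_cvg_nneseries => k _ _.
  by apply: integral_ge0 => x _; rewrite lee_fin weight_ge0.
by move=> /fine_cvgP[].
Qed.

End mass_regularity.

(** * Normal cones and unconditional convergence *)

(** What the compatibility of the order with the norm says of the positive cone;
    in this form it applies to the half-line of nonnegative reals as well. *)
Record normal_cone (R : realType) (H : normedModType R) (P : set H) (C : R) : Prop := {
  cone0 : P 0 ;
  coneD : forall u v, P u -> P v -> P (u + v) ;
  coneZ : forall a u, 0 <= a -> P u -> P (a *: u) ;
  cone_const_gt0 : 0 < C ;
  cone_norm : forall u v, P u -> P v -> `|u| <= C * `|u + v| }.

Section unconditional_sums.
Context {R : realType} {M : completeMetricType R} {H : completeNormedModType R}.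
Hypothesis M_proper : proper_space M.
Variable o : M.
Implicit Types (X : conf M) (g : M -> H) (l : seq M) (z : M).

Let pB z r : precompact (ball z r). Proof. exact: precompact_ball. Qed.

(** The Cauchy criterion for unconditional convergence.  Only this property, not
    a sum, is transported when the weight changes. *)
Definition tail_small X g := forall e : R, 0 < e -> exists k : nat,
  forall l, subconf X l -> (forall x, x \in l -> ~ ball o k%:R x) ->
  `|\sum_(x <- l) g x| <= e.

Lemma tail_small_near X g (e : R) : tail_small X g -> 0 < e -> exists k : nat,
  forall l, subconf X l -> full_on X (ball o k%:R) l ->
  `|\sum_(x <- l) g x - \sum_(x <- points_in X (ball o k%:R)) g x| <= e.
Proof.
move=> tg e0; have [k kP] := tg _ e0; exists k => l sl fl.
rewrite -(perm_big _ (perm_points_in (pB o k%:R) fl))/= big_filter.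
rewrite (bigID (fun x => `[< ball o k%:R x >]))/= [X in X - _]addrC addrK.
rewrite -big_filter; apply: kP.
  by move=> x; apply: leq_trans (sl x); rewrite count_filter sub_count// => y /andP[].
by move=> x; rewrite mem_filter => /andP[/asboolP].
Qed.

Lemma tail_small_net_sum X g : tail_small X g -> exists S, net_sum X g S.
Proof.
move=> tg; pose a n := \sum_(x <- points_in X (ball o n%:R)) g x.
have near (e : R) : 0 < e -> exists k : nat, forall n, (k <= n)%N -> `|a n - a k| <= e.
  move=> e0; have [k kP] := tail_small_near tg e0; exists k => n kn.
  apply: kP; first exact: subconf_points_in.
  by apply: full_on_points_in => //; apply: le_ball; rewrite ler_nat.
have [S aS] : exists S : H, a n @[n --> \oo] --> S.
  apply/cvg_ex; apply/cauchy_cvgP; apply: cauchy_exP => e e0.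
  have [k kP] := near (e / 2) ltac:(by rewrite divr_gt0).
  exists (a k); exists k => // n /= kn; rewrite -ball_normE/= distrC.
  by rewrite (le_lt_trans (kP n kn))// ltr_pdivrMr// ltr_pMr// ltr1n.
exists S => e e0.
have e20 : 0 < e / 2 by rewrite divr_gt0.
have [k kP] := tail_small_near tg e20.
exists (ball o k%:R) => // l sl fl.
have aSk : `|a k - S| <= e / 2.
  have cS : `|a k - a n| @[n --> \oo] --> `|a k - S|.
    by apply: cvg_norm; apply: cvgB => //; exact: cvg_cst.
  apply: (ler_cvg_to cS (cvg_cst (e / 2))).
  exists k => // n /= kn; rewrite distrC; apply: kP.
    exact: subconf_points_in.
  by apply: full_on_points_in => //; apply: le_ball; rewrite ler_nat.
rewrite -(subrKA (a k)) (le_trans (ler_normD _ _))// [e]splitr lerD//.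
exact: kP.
Qed.

Lemma net_sum_ball_cvg X g S z : net_sum X g S ->
  \sum_(x <- points_in X (ball z n%:R)) g x @[n --> \oo] --> S.
Proof.
move=> gS; apply/cvgrPdist_le => e e0; have [D pD DP] := gS _ e0.
have [k Dk] := precompact_in_ball z pD.
exists k => // n /= kn; rewrite distrC; apply: DP; first exact: subconf_points_in.
apply: full_on_points_in => // x /Dk; apply: le_ball.
by rewrite ler_nat.
Qed.

Lemma net_sum_conf_sum X g S : net_sum X g S -> conf_sum X g = S.
Proof.
by move=> gS; apply: conf_sumE; apply: net_sum_has_sum => //; exact: conf_enumerable.
Qed.

Section positive.
Variables (P : set H) (C : R) (f : M -> H).
Hypotheses (cone : normal_cone P C) (Pf : forall x, P (f x)).
Implicit Types w : M -> R.

Lemma cone_sum w l : (forall x, 0 <= w x) -> P (\sum_(x <- l) w x *: f x).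
Proof.
move=> w0; elim: l => [|x l IH]; first by rewrite big_nil; exact: cone0 cone.
by rewrite big_cons; apply: (coneD cone) => //; exact: (coneZ cone).
Qed.

Lemma cone_sum_le w w' l : (forall x, 0 <= w x) -> (forall x, w x <= w' x) ->
  `|\sum_(x <- l) w x *: f x| <= C * `|\sum_(x <- l) w' x *: f x|.
Proof.
move=> w0 ww'.
have -> : \sum_(x <- l) w' x *: f x = \sum_(x <- l) w x *: f x +
    \sum_(x <- l) (w' x - w x) *: f x.
  by rewrite -big_split/=; apply: eq_bigr => x _; rewrite -scalerDl subrKC.
by apply: (cone_norm cone); apply: cone_sum => // x; rewrite subr_ge0.
Qed.

(** In a normal cone a dominated series converges unconditionally if the
    dominating one does. *)
Lemma tail_small_le w w' (B : R) X : 0 < B -> (forall x, 0 <= w x) ->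
  (forall x, w x <= B * w' x) ->
  tail_small X (fun x => w' x *: f x) -> tail_small X (fun x => w x *: f x).
Proof.
move=> B0 w0 ww' tw' e e0.
have C0 := cone_const_gt0 cone.
have [k kP] := tw' (e / (C * B)) ltac:(by rewrite divr_gt0// mulr_gt0).
exists k => l sl lk; apply: (le_trans (cone_sum_le _ w0 ww')).
under eq_bigr do rewrite -scalerA.
rewrite -scaler_sumr normrZ (gtr0_norm B0) mulrA -ler_pdivlMl ?mulr_gt0//.
by rewrite mulrC kP.
Qed.

Lemma perm_submultiset l L : (forall x, (count_mem x l <= count_mem x L)%N) ->
  exists l', perm_eq L (l ++ l').
Proof.
move=> /count_subseqP[s sL ls]; have [l' Ll'] := perm_to_subseq sL.
exists l'; apply: (perm_trans Ll'); rewrite perm_cat2r perm_sym//.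
Qed.

Lemma in_some_ball l : exists n : nat, forall x, x \in l -> ball o n%:R x.
Proof.
elim: l => [|x l [n nP]]; first by exists 0%N.
have [m mP] := nat_ball o x; exists (maxn m n) => y.
rewrite inE => /orP[/eqP ->|/nP]; first by apply: le_ball mP; rewrite ler_nat leq_maxl.
by apply: le_ball; rewrite ler_nat leq_maxr.
Qed.

Lemma sum_points_annulus X g z r r' : r <= r' ->
  \sum_(x <- points_in X (ball z r' `\` ball z r)) g x =
  \sum_(x <- points_in X (ball z r')) g x - \sum_(x <- points_in X (ball z r)) g x.
Proof.
move=> rr'; apply/eqP; rewrite eq_sym subr_eq -big_cat; apply/eqP/perm_big.
have sub : ball z r `<=` (ball z r' : set M) by exact: le_ball.
have pA : precompact (ball z r' `\` ball z r).
  by apply: precompact_subset (pB z r') => x [].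
apply/allP => x _ /=; rewrite count_cat !count_points_in//; apply/eqP.
have [xr|xr] := pselect (ball z r x).
  by rewrite (asboolT xr) (asboolT (sub _ xr)) asboolF// => -[].
rewrite (asboolF xr) addn0; have [xr'|xr'] := pselect (ball z r' x).
  by rewrite !asboolT.
by rewrite !asboolF// => -[].
Qed.

(** Any finite set of points outside the ball of radius k is part of an annulus
    between radii k and n.  The sum over the annulus is a difference of two terms
    of a Cauchy sequence, and by normality it bounds the sum over the part. *)
Lemma ball_cvg_tail_small w X : (forall x, 0 <= w x) ->
  cvgn (fun n => \sum_(x <- points_in X (ball o n%:R)) w x *: f x) ->
  tail_small X (fun x => w x *: f x).
Proof.
move=> w0; set a := (X in cvgn X) => /cvg_cauchy/cauchy_ballP ca e e0.
have C0 := cone_const_gt0 cone.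
have [|[U1 U2] /= [[k1 _ k1P] [k2 _ k2P]] UP] := ca (e / C); first by rewrite divr_gt0.
pose k := maxn k1 k2.
have near n : (k <= n)%N -> `|a n - a k| <= e / C.
  move=> kn; have := UP (a k, a n).
  rewrite -ball_normE/= distrC => H'; apply: ltW; apply: H'; split.
    by apply: k1P; rewrite /= leq_maxl.
  by apply: k2P; rewrite /= (leq_trans _ kn)// leq_maxr.
exists k => l sl lk.
have [n0 n0P] := in_some_ball l; pose n := maxn n0 k.
have kn : (k <= n)%N by rewrite leq_maxr.
have pA : precompact (ball o n%:R `\` ball o k%:R).
  by apply: precompact_subset (pB o n%:R) => x [].
(* l' completes l to the full content of the annulus. *)
have [x|l' lP] := @perm_submultiset l (points_in X (ball o n%:R `\` ball o k%:R)).
  rewrite count_points_in//; case: asboolP => xA; first exact: sl.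
  rewrite leqn0 -leqn0 -ltnS -[X in (_ < X)%N]/1%N ltnNge -has_count has_pred1.
  apply/negP => xl; apply: xA; split; last exact: lk.
  by apply: le_ball (n0P _ xl); rewrite ler_nat leq_maxl.
have := cone_norm cone (cone_sum l w0) (cone_sum l' w0).
rewrite -big_cat -(perm_big _ lP)/= sum_points_annulus ?ler_nat//.
move/le_trans; apply; rewrite -ler_pdivlMl// mulrC.
exact: near.
Qed.

(** S - S1 and S2 - S are both limits of elements of the cone, and their sum is
    S2 - S1. *)
Lemma sandwich_norm X w1 w w2 S1 S S2 : (forall x, w1 x <= w x) -> (forall x, w x <= w2 x) ->
  net_sum X (fun x => w1 x *: f x) S1 -> net_sum X (fun x => w x *: f x) S ->
  net_sum X (fun x => w2 x *: f x) S2 -> `|S - S1| <= C * `|S2 - S1|.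
Proof.
move=> w1w ww2 n1 n n2.
have c1 := net_sum_ball_cvg o n1; have c := net_sum_ball_cvg o n.
have c2 := net_sum_ball_cvg o n2.
pose a (v : M -> R) n := \sum_(x <- points_in X (ball o n%:R)) v x *: f x.
have h1 : `|a w n - a w1 n| @[n --> \oo] --> `|S - S1|.
  by apply: cvg_norm; exact: cvgB.
have h2 : C * `|a w2 n - a w1 n| @[n --> \oo] --> C * `|S2 - S1|.
  by apply: cvgM; [exact: cvg_cst|apply: cvg_norm; exact: cvgB].
apply: (ler_cvg_to h1 h2); apply: nearW => k /=.
rewrite /a -!sumrB; under eq_bigr do rewrite -scalerBl.
under [in leRHS]eq_bigr do rewrite -scalerBl.
apply: cone_sum_le => x; first by rewrite subr_ge0.
by rewrite lerB.
Qed.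

End positive.
End unconditional_sums.

Lemma net_sumZ (R : realType) (M : completeMetricType R) (H : normedModType R)
    (X : conf M) (g : M -> H) (S : H) (a : R) : 0 < a ->
  net_sum X g S -> net_sum X (fun x => a *: g x) (a *: S).
Proof.
move=> a0 gS e e0; have ea0 : 0 < e / a by rewrite divr_gt0.
have [D pD DP] := gS _ ea0; exists D => // l sl fl.
by rewrite -scaler_sumr -scalerBr normrZ gtr0_norm// mulrC -ler_pdivlMr// DP.
Qed.

(** F is the sum for a weight that lies between a times the weight of F1 and b
    times that of F2; p, q and g are the integrals of the three weights, u and v
    the values of f at two nearby centres.  If F1 and F2 are close to p u and q u,
    and a, b and q/p are close to 1, then F is close to g v; all the errors are of
    order eta relative to g. *)
Lemma sandwich_estimate (R : realType) (H : normedModType R) (F F1 F2 u v : H)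
    (C K eta a b p q g : R) :
  0 < C -> 0 < eta <= 1 -> 1 <= b <= 1 + eta -> a = b^-1 ->
  0 < p -> q <= (1 + eta) * p -> a * p <= g <= b * q ->
  `|F1 - p *: u| <= eta * p -> `|F2 - q *: u| <= eta * q ->
  `|F - a *: F1| <= C * `|b *: F2 - a *: F1| ->
  `|u - v| <= eta -> `|u| <= K ->
  `|F - g *: v| <= eta * (2 * (C * (5 + 4 * K) + 1 + 4 * K) + 1) * g.
Proof.
move=> C0 /andP[eta0 eta1] /andP[b1 beta1] aE p0 qp /andP[apg gbq] h1 h2 hF uv uK.
have b0 : 0 < b by rewrite (lt_le_trans ltr01).
have K0 : 0 <= K by apply: le_trans uK.
have a0 : 0 < a by rewrite aE invr_gt0.
have a1 : a <= 1 by rewrite aE invf_le1.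
have ab : a * b = 1 by rewrite aE mulVf// gt_eqF.
have aeta : 1 - eta <= a.
  rewrite -[a]mul1r -ler_pdivrMr// aE invrK.
  apply: (@le_trans _ _ ((1 - eta) * (1 + eta))).
    by rewrite ler_wpM2l// subr_ge0.
  by nra.
have a2 : 1 / 2 <= a by rewrite aE div1r lef_pV2 ?posrE//; lra.
have g0 : 0 < g by apply: lt_le_trans apg; rewrite mulr_gt0.
have q0 : 0 < q by rewrite -(pmulr_rgt0 _ b0) (lt_le_trans g0).
have bq : b * q <= (1 + 3 * eta) * p.
  apply: (@le_trans _ _ ((1 + eta) * ((1 + eta) * p))).
    by rewrite ler_pM// ltW.
  by rewrite mulrA ler_wpM2r ?(ltW p0)//; nra.
have ap : (1 - eta) * p <= a * p by rewrite ler_wpM2r// ltW.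
have gap : b * q - a * p <= 4 * eta * p.
  apply: (le_trans (lerB bq ap)); rewrite -mulrBl ler_wpM2r ?(ltW p0)//; lra.
have pg : p <= 2 * g.
  have : 1 / 2 * p <= a * p by rewrite ler_wpM2r// ltW.
  by move=> ?; lra.
have e1 : `|a *: (F1 - p *: u)| <= eta * p.
  rewrite normrZ gtr0_norm//; apply: le_trans h1.
  by rewrite ler_piMl.
have e2 : `|b *: (F2 - q *: u)| <= 4 * eta * p.
  rewrite normrZ gtr0_norm//; apply: (@le_trans _ _ (eta * (b * q))).
    by rewrite mulrCA ler_wpM2l// ltW.
  rewrite [4 * eta]mulrC -mulrA ler_wpM2l ?(ltW eta0)//.
  by apply: (le_trans bq); rewrite ler_wpM2r ?(ltW p0)//; lra.
have e3 : `|(b * q - a * p) *: u| <= 4 * eta * p * K.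
  rewrite normrZ ger0_norm ?subr_ge0 ?(le_trans apg)//.
  by rewrite ler_pM// subr_ge0 (le_trans apg).
have e4 : `|(g - a * p) *: u| <= 4 * eta * p * K.
  rewrite normrZ ger0_norm ?subr_ge0//.
  rewrite ler_pM ?subr_ge0//.
  by apply: le_trans gap; rewrite lerD2r.
have e5 : `|F - a *: F1| <= C * (4 * eta * p + 4 * eta * p * K + eta * p).
  apply: (le_trans hF); rewrite ler_wpM2l ?(ltW C0)//.
  have -> : b *: F2 - a *: F1 = b *: (F2 - q *: u) + (b * q - a * p) *: u - a *: (F1 - p *: u).
    by rewrite !scalerBr scalerBl !scalerA opprB !subrKA.
  apply: (le_trans (ler_normB _ _)); rewrite lerD//.
  by apply: (le_trans (ler_normD _ _)); rewrite lerD.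
have -> : F - g *: v = (F - a *: F1) + a *: (F1 - p *: u) - (g - a * p) *: u + g *: (u - v).
  by rewrite !scalerBr scalerBl !scalerA opprB !subrKA.
apply: (@le_trans _ _ (C * (4 * eta * p + 4 * eta * p * K + eta * p) + eta * p +
   4 * eta * p * K + g * eta)).
  apply: (le_trans (ler_normD _ _)); rewrite lerD//; last first.
    by rewrite normrZ gtr0_norm// ler_wpM2l// ltW.
  apply: (le_trans (ler_normB _ _)); rewrite lerD//.
  by apply: (le_trans (ler_normD _ _)); rewrite lerD.
have W0 : 0 <= C * (5 + 4 * K) + 1 + 4 * K.
  by rewrite !addr_ge0 ?mulr_ge0 ?addr_ge0 ?mulr_ge0// ltW.
have : eta * (C * (5 + 4 * K) + 1 + 4 * K) * p <= eta * (C * (5 + 4 * K) + 1 + 4 * K) * (2 * g).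
  by rewrite ler_wpM2l// mulr_ge0// ltW.
by lra.
Qed.

(** * Almost sure convergence *)

Section series_lemmas.
Context {R : realType}.

Lemma summable_bounded (u : nat -> R) : (forall n, 0 <= u n) ->
  (\sum_(0 <= n <oo) (u n)%:E < +oo)%E -> cvgn (series u).
Proof.
move=> u0 su; set S := (X in (X < _)%E) in su.
apply: nondecreasing_is_cvgn.
  by apply/nondecreasing_seqP => n; rewrite seriesEnat/= big_nat_recr//= lerDl.
have S0 : (0 <= S)%E by apply: nneseries_ge0 => n _ _; rewrite lee_fin.
exists (fine S) => _ [n _ <-]; rewrite -lee_fin fineK ?ge0_fin_numE//.
rewrite seriesEnat/= -sumEFin; apply: nneseries_lim_ge => k _ _.
by rewrite lee_fin.
Qed.

(** The terms of a convergent series are bounded, so |T k| is at most a constant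
    times exp (- d k / 2). *)
Lemma summable_exponential_norm (V : completeNormedModType R) (T : nat -> V) (d : R) :
  0 < d ->
  (\sum_(0 <= k <oo) (expR (d * k%:R) * `|T k| ^+ 2)%:E < +oo)%E ->
  cvgn (series T).
Proof.
move=> d0 sT.
have u0 k : 0 <= expR (d * k%:R) * `|T k| ^+ 2 by rewrite mulr_ge0 ?expR_ge0.
have u_cvg0 := cvg_series_cvg_0 (summable_bounded u0 sT).
have [B [_ HB]] := cvg_seq_bounded (cvgP _ u_cvg0).
pose B1 := `|B| + 1.
have B10 : 0 <= B1 by rewrite addr_ge0.
have TB k : `|T k| <= Num.sqrt B1 * expR (- (d / 2)) ^+ k.
  rewrite -(ler_pXn2r (n := 2)) ?nnegrE ?mulr_ge0 ?exprn_ge0 ?expR_ge0 ?sqrtr_ge0//.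
  rewrite exprMn sqr_sqrtr// -exprM -expRM_natl.
  have -> : (k * 2)%:R * - (d / 2) = - (d * k%:R) by rewrite natrM; field.
  rewrite expRN ler_pdivlMr ?expR_gt0// mulrC.
  have BB1 : B < B1.
    by rewrite (le_lt_trans (ler_norm B))// ltrDl.
  by have := HB B1 BB1 k I; rewrite /= ger0_norm.
apply: normed_cvg; apply: (series_le_cvg _ _ TB) => //=.
apply: (@is_cvg_geometric_series R (Num.sqrt B1) (expR (- (d / 2)))).
by rewrite ger0_norm ?expR_ge0// -expR0 ltr_expR oppr_lt0 divr_gt0.
Qed.

Lemma limn_einf_le (u : nat -> \bar R) (K : \bar R) :
  (forall n, (u n <= K)%E) -> (limn_einf u <= K)%E.
Proof.
move=> uK; rewrite limn_einf_lim; apply: lime_le; first exact: is_cvg_einfs.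
apply: nearW => n; apply: le_trans (uK n).
by apply: ereal_inf_lbound; exists n => //=.
Qed.

Lemma ae_finite_of_integral d (T : measurableType d) (mu : {measure set T -> \bar R})
    (g : T -> \bar R) :
  measurable_fun setT g -> (forall x, (0 <= g x)%E) -> (\int[mu]_x g x < +oo)%E ->
  {ae mu, forall x, (g x < +oo)%E}.
Proof.
move=> mg g0 ig.
have intg : mu.-integrable setT g.
  apply/integrableP; split => //.
  by under eq_integral do rewrite gee0_abs//.
have := integrable_ae measurableT intg; apply: filterS => x /(_ I).
by rewrite ge0_fin_numE.
Qed.

End series_lemmas.

Section almost_sure.
Context {R : realType} {M : completeMetricType R} {H : completeNormedModType R}.
Variables (Pi : probability (conf_type M) R) (mu : {measure set (borel_type M) -> \bar R}).
Hypothesis M_proper : proper_space M.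
Hypothesis mu_fin : forall K : set M, compact K -> (mu K < +oo)%E.
Variables (h beta : R).
Hypotheses (h_gt0 : 0 < h) (beta_ge0 : 0 <= beta).
Hypothesis mu_growth : exponential_growth mu h beta.
Variable Cv : R.
Hypothesis Cv_gt0 : 0 < Cv.
Hypothesis variance_bound : forall (D : set M) (g : borel_type M -> R), precompact D ->
  measurable (D : set (borel_type M)) -> measurable_fun setT g ->
  (\int[mu]_(x in D) `|g x|%:E < +oo)%E ->
  (\int[mu]_(x in D) (g x ^+ 2)%:E < +oo)%E ->
  (\int[Pi]_X ((\sum_(x <- points_in X D) g x -
     fine (\int[mu]_(x in D) (g x)%:E)) ^+ 2)%:E <=
   Cv%:E * \int[mu]_(x in D) (g x ^+ 2)%:E)%E.
Variables (o : M) (f : M -> H) (c : nat -> H -> R) (V : set H).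
Hypotheses (cf : continuous f) (fc : coordinates f c V).
Hypothesis mean : forall i z r,
  \int[mu]_(x in ball z r) c i (f x) = c i (f z) * fine (mu (ball z r)).
Variable eps : nat -> R.
Hypotheses (eps_gt0 : forall n, 0 < eps n) (eps_decr : forall n, eps n.+1 < eps n).
Hypothesis eps_cvg0 : eps @ \oo --> (0 : R).

(** The integral that bounds variances; the integrals in the sharpness condition
    are its values at 2 (h + eps n). *)
Definition energy (t : R) : \bar R :=
  (\int[mu]_x (weight t o x * `|f x| ^+ 2)%:E)%E.

Hypothesis energy_summable :
  (\sum_(0 <= n <oo) ((eps n `^ (2 + 2 * beta))%:E * energy (2 * (h + eps n))) < +oo)%E.

Implicit Types (z : M).

Let cnf : continuous (fun x => `|f x| ^+ 2).
Proof. exact: continuous_norm_sqr. Qed.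

Let measurable_energy s z : measurable_fun setT
  ((fun x => (weight s z x * `|f x| ^+ 2)%:E) : borel_type M -> \bar R).
Proof.
apply/measurable_EFinP; apply: continuous_borel => x.
by apply: cvgM; [exact: continuous_weight|exact: cnf].
Qed.

Let energy_fun_ge0 s z (x : M) : (0 <= (weight s z x * `|f x| ^+ 2)%:E)%E.
Proof. by rewrite lee_fin mulr_ge0 ?weight_ge0 ?exprn_ge0. Qed.

Lemma weight_sqr s z x : weight s z x ^+ 2 = weight (2 * s) z x.
Proof. by rewrite expr2 /weight -expRD; congr expR; ring. Qed.

Lemma energy_ge0 t : (0 <= energy t)%E.
Proof. by apply: integral_ge0 => x _; exact: energy_fun_ge0. Qed.

(** Each term of the convergent sum is finite, and the energy decreases in t. *)
Lemma energy_fin t : 2 * h < t -> (energy t < +oo)%E.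
Proof.
move=> ht.
have [n nt] : exists n, 2 * (h + eps n) <= t.
  have t0 : 0 < t / 2 - h by rewrite subr_gt0 ltr_pdivlMr// mulrC.
  move/cvgrPdist_le : eps_cvg0 => /(_ _ t0) [n _ nP]; exists n.
  have := nP n (leqnn n); rewrite sub0r normrN gtr0_norm// => nt.
  by move: nt; lra.
have p0 : 0 < eps n `^ (2 + 2 * beta) by rewrite powR_gt0.
apply: (@le_lt_trans _ _ (energy (2 * (h + eps n)))).
  apply: ge0_le_integral => // x _.
  rewrite lee_fin ler_wpM2r ?exprn_ge0// ler_expR lerN2 ler_wpM2r//.
  exact: mdist_ge0.
have lt : ((eps n `^ (2 + 2 * beta))%:E * energy (2 * (h + eps n)) < +oo)%E.
  apply: le_lt_trans energy_summable.
  have := @nneseries_lim_ge R (fun n => ((eps n `^ (2 + 2 * beta))%:E * energy (2 * (h + eps n)))%E) xpredT 0 n.+1.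
  rewrite big_nat_recr//= => H1; apply: le_trans (H1 _).
    rewrite leeDr// sume_ge0// => k _.
    by rewrite mule_ge0 ?energy_ge0// lee_fin powR_ge0.
  by move=> k _ _; rewrite mule_ge0 ?energy_ge0// lee_fin powR_ge0.
rewrite ltey; apply/eqP => Eoo; move: lt.
by rewrite Eoo gt0_muley ?lte_fin// ltxx.
Qed.

Section annulus.
Variables (s : R) (z : M) (r r' : R).
Hypotheses (s0 : 0 <= s) (r0 : 0 <= r) (rr' : r <= r').
Let D := ball z r' `\` ball z r.
Let m := (\int[mu]_(x in D) weight s z x) *: f z.

Let pD : precompact D.
Proof. by apply: precompact_subset (precompact_ball M_proper z r') => x []. Qed.

Let Vm : V m. Proof. exact: (spanZ fc _ (span_f fc z)). Qed.

(** For the centre z the mean of the sum is known exactly, by the mean value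
    property. *)
Lemma annulus_variance :
  (\int[Pi]_X (`|\sum_(x <- points_in X D) weight s z x *: f x - m| ^+ 2)%:E <=
   Cv%:E * \int[mu]_(x in D) (weight (2 * s) z x * `|f x| ^+ 2)%:E)%E.
Proof.
under [in leRHS]eq_integral do rewrite -weight_sqr.
apply: (variance_vector_sum fc mu_fin) => //.
- exact: borel_annulus.
- exact: continuous_weight.
- exact: ltW.
- by move=> g; apply: variance_bound => //; exact: borel_annulus.
- move=> i; rewrite /m (coordZ fc) mulrC.
  rewrite -(radial_mean_annulus M_proper mu_fin s0 r0 rr' (g := fun x => c i (f x)))//.
  exact: (coord_cont fc (i := i)).
Qed.

Lemma measurable_annulus_error : measurable_fun [set: conf_type M] (fun X =>
  (`|\sum_(x <- points_in (X : conf M) D) weight s z x *: f x - m| ^+ 2)%:E).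
Proof.
apply: (measurable_norm_sum_points fc) => //.
- exact: borel_annulus.
- exact: continuous_weight.
Qed.

End annulus.

(** T k is the centred sum over the k-th annulus.  The expectation of the sum of
    exp ((s - h) k) |T k|^2 is at most a multiple of the energy at 2s - (s - h) =
    s + h, which exceeds 2h.  So almost surely the T k are summable in norm, and
    the means that were subtracted add up to the mass of balls, which
    converges. *)
Lemma ae_ball_sums_cvg s : h < s -> {ae Pi, forall X : conf M,
  cvgn (fun n => \sum_(x <- points_in X (ball o n%:R)) weight s o x *: f x)}.
Proof.
move=> hs; have s0 : 0 < s by exact: lt_trans hs.
pose A k := ball o k.+1%:R `\` (ball o k%:R : set M).
pose m k := (\int[mu]_(x in A k) weight s o x) *: f o.
pose T (X : conf M) k := \sum_(x <- points_in X (A k)) weight s o x *: f x - m k.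
pose U k (X : conf_type M) := (expR ((s - h) * k%:R) * `|T X k| ^+ 2)%:E.
have kk (k : nat) : k%:R <= k.+1%:R :> R by rewrite ler_nat.
have mT k : measurable_fun [set: conf_type M]
    (fun X => (`|T (X : conf M) k| ^+ 2)%:E).
  exact: measurable_annulus_error.
have mU k : measurable_fun [set: conf_type M] (U k).
  rewrite (_ : U k = fun X => (expR ((s - h) * k%:R))%:E * (`|T X k| ^+ 2)%:E)%E.
    exact: measurable_funeM.
  by apply/funext => X; rewrite /U EFinM.
have U0 k X : (0 <= U k X)%E.
  by rewrite lee_fin mulr_ge0 ?expR_ge0 ?exprn_ge0.
have intU k : (\int[Pi]_X U k X <= Cv%:E *
    \int[mu]_(x in annulus o k) (weight (s + h) o x * `|f x| ^+ 2)%:E)%E.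
  under eq_integral do rewrite /U EFinM.
  rewrite ge0_integralZl_EFin ?expR_ge0//.
  apply: (@le_trans _ _ ((expR ((s - h) * k%:R))%:E * (Cv%:E *
      \int[mu]_(x in A k) (weight (2 * s) o x * `|f x| ^+ 2)%:E))%E).
    rewrite lee_wpmul2l ?lee_fin ?expR_ge0//.
    exact: (annulus_variance o (ltW s0) (ler0n R k) (kk k)).
  rewrite muleCA lee_wpmul2l ?lee_fin ?(ltW Cv_gt0)//.
  have mA := borel_annulus_nat o k; rewrite /A -annulusE -ge0_integralZl_EFin ?expR_ge0//.
  - apply: ge0_le_integral => //.
    + by move=> x _; rewrite mule_ge0// lee_fin expR_ge0.
    + by apply: measurable_funeM; exact: measurable_funTS.
    + exact: measurable_funTS.
    + move=> x /andP[kx _]; rewrite -EFinM lee_fin mulrA ler_wpM2r ?exprn_ge0//.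
      rewrite /weight -expRD ler_expR.
      have : (s - h) * k%:R <= (s - h) * mdist x o.
        by rewrite ler_wpM2l// subr_ge0 ltW.
      by move=> ?; lra.
  - exact: measurable_funTS.
have : {ae Pi, forall X, (\sum_(0 <= k <oo) U k X < +oo)%E}.
  apply: ae_finite_of_integral.
  - by apply: ge0_emeasurable_sum.
  - by move=> X; apply: nneseries_ge0.
  rewrite integral_nneseries//.
  apply: (@le_lt_trans _ _ (Cv%:E * energy (s + h))%E); last first.
    by rewrite lte_mul_pinfty ?lee_fin ?(ltW Cv_gt0)// energy_fin//; lra.
  rewrite /energy (integral_annuli _ o)// -nneseriesZl; last first.
    by move=> k _; apply: integral_ge0.
  by apply: lee_nneseries => [k _ _|k _]; [exact: integral_ge0|exact: intU].
apply: filterS => X /= HX.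
have cT : cvgn (series (T X)) by apply: summable_exponential_norm HX; rewrite subr_gt0.
pose a n := \sum_(x <- points_in X (ball o n%:R)) weight s o x *: f x.
pose b n := \int[mu]_(x in ball o n%:R) weight s o x.
have subB (p q r t : H) : p - q - (r - t) = p - r - (q - t).
  by rewrite !opprB addrACA [RHS]addrACA; congr (_ + _); rewrite addrC.
have aE : a = fun n => series (T X) n + (b n - b 0%N) *: f o + a 0%N.
  apply/funext => n; rewrite seriesEnat/=.
  have -> : \sum_(0 <= k < n) T X k =
      \sum_(0 <= k < n) ((a k.+1 - b k.+1 *: f o) - (a k - b k *: f o)).
    apply: eq_bigr => k _; rewrite /T /m /A sum_points_annulus//.
    rewrite Rintegral_annulus//; last exact: continuous_weight.
    by rewrite -/(a k.+1) -/(a k) -/(b k.+1) -/(b k) scalerBl subB.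
  rewrite (telescope_sumr (fun k => a k - b k *: f o))// scalerBl.
  by rewrite -subB !subrK.
rewrite -/a aE; apply: is_cvgD; last exact: is_cvg_cst.
apply: is_cvgD => //; apply: is_cvgZr_tmp; apply: is_cvgB; last exact: is_cvg_cst.
have := ball_mass_cvg M_proper mu_fin h_gt0 beta_ge0 mu_growth (z := o) hs.
exact: cvgP.
Qed.

Lemma weight_shift s y z (x : M) : 0 <= s ->
  weight s z x <= expR (s * mdist y z) * weight s y x.
Proof.
move=> s0; rewrite /weight -expRD ler_expR.
have : s * mdist x y <= s * (mdist x z + mdist z y).
  by rewrite ler_wpM2l// metric_triangle.
by rewrite (metric_sym z y) => ?; lra.
Qed.

Lemma eps_noninc n m : (n <= m)%N -> eps m <= eps n.
Proof.
move=> nm; have : nonincreasing_seq eps by apply/nonincreasing_seqP => k; exact: ltW.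
exact.
Qed.

Lemma eps_small (e : R) : 0 < e -> exists N : nat, forall n, (N <= n)%N -> eps n < e.
Proof.
move/cvgrPdist_lt : eps_cvg0 => ec /ec [N _ NP]; exists N => n /NP.
by rewrite sub0r normrN gtr0_norm.
Qed.

(** The exceptional set is the union of those of the countably many exponents
    h + eps n with centre o; every other weight is dominated by a multiple of one
    of these. *)
Lemma ae_tail_small (P : set H) (C : R) : normal_cone P C -> (forall x, P (f x)) ->
  {ae Pi, forall X : conf_type M, forall s z, h < s ->
    tail_small o (X : conf M) (fun x => weight s z x *: f x)}.
Proof.
move=> cone Pf.
have : {ae Pi, forall X : conf_type M, forall n,
    cvgn (fun k => \sum_(x <- points_in (X : conf M) (ball o k%:R)) weight (h + eps n) o x *: f x)}.
  by apply: ae_foralln => n; apply: ae_ball_sums_cvg; rewrite ltrDl.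
apply: filterS => X XP s z hs.
have sh : 0 < s - h by rewrite subr_gt0.
have [n nP] := eps_small sh; have {nP} ns := nP n (leqnn n).
have s0 : 0 <= s by rewrite ltW// (lt_trans h_gt0).
have tn := ball_cvg_tail_small M_proper cone Pf (@weight_ge0 _ _ (h + eps n) o) (XP n).
apply: (tail_small_le cone Pf _ _ _ tn).
- exact: (expR_gt0 (s * mdist o z)).
- exact: weight_ge0.
- move=> x; apply: (le_trans (weight_shift o z x s0)).
  rewrite ler_wpM2l ?expR_ge0// ler_expR lerN2 ler_wpM2r ?mdist_ge0//.
  by move: ns; lra.
Qed.

Section scales.
Variable z : M.
Let s n := h + eps n.
Let G n := fine (mass mu (s n) z).
Let Err n k (X : conf_type M) : \bar R := (`|\sum_(x <- points_in (X : conf M) (ball z k%:R))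
   weight (s n) z x *: f x - (\int[mu]_(x in ball z k%:R) weight (s n) z x) *: f z| ^+ 2)%:E.
Let Q n (X : conf_type M) : \bar R := limn_einf (fun k => Err n k X).

Let hs n : h < s n. Proof. by rewrite ltrDl. Qed.

Let s0 n : 0 <= s n. Proof. by rewrite ltW// (lt_trans h_gt0). Qed.

Let ballD0 k : ball z k%:R `\` ball z 0 = ball z k%:R :> set M.
Proof.
rewrite (_ : ball z 0 = set0) ?setD0//.
apply/seteqP; split => x //= /ballP; rewrite ltNge => /negP; apply.
exact: mdist_ge0.
Qed.

Let mErr n k : measurable_fun setT (Err n k).
Proof.
have := @measurable_annulus_error (s n) z 0 k%:R.
by rewrite ballD0.
Qed.

Let Err_ge0 n k X : (0 <= Err n k X)%E.
Proof. by rewrite lee_fin exprn_ge0. Qed.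

Let mQ n : measurable_fun setT (Q n).
Proof.
rewrite (_ : Q n = fun X => limn (einfs (fun k => Err n k X))); last first.
  by apply/funext => X; rewrite /Q limn_einf_lim.
apply: (emeasurable_fun_cvg (fun k X => einfs (fun k => Err n k X) k)).
- by move=> k; exact: measurable_fun_einfs.
- by move=> X _; exact: is_cvg_einfs.
Qed.

Let Q_ge0 n X : (0 <= Q n X)%E.
Proof.
rewrite /Q limn_einf_lim; apply: lime_ge; first exact: is_cvg_einfs.
by apply: nearW => k; apply: le_ereal_inf_tmp => _ [j _ <-].
Qed.

Let intQ n : (\int[Pi]_X Q n X <=
  (Cv * expR (2 * s 0%N * mdist o z))%:E * energy (2 * s n))%E.
Proof.
apply: (le_trans (fatou Pi measurableT (mErr n) _)) => //.
apply: limn_einf_le => k.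
have := annulus_variance z (s0 n) (lexx 0) (ler0n R k); rewrite ballD0.
move/le_trans; apply; rewrite EFinM -muleA lee_wpmul2l ?lee_fin ?(ltW Cv_gt0)//.
rewrite /energy -ge0_integralZl_EFin ?expR_ge0//.
apply: (@le_trans _ _ (\int[mu]_x (weight (2 * s n) z x * `|f x| ^+ 2)%:E)%E).
  by apply: ge0_subset_integral => //; exact: borel_ball.
apply: ge0_le_integral => //; first exact: measurable_funeM.
move=> x _; rewrite -EFinM lee_fin [leRHS]mulrA ler_wpM2r ?exprn_ge0//.
apply: le_trans (weight_shift o z x _) _; first by rewrite mulr_ge0.
rewrite ler_wpM2r ?weight_ge0// ler_expR ler_wpM2r ?mdist_ge0//.
by rewrite ler_pM2l// lerD2l eps_noninc.
Qed.

(** By Fatou, the variance bound passes from balls to the whole configuration;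
    the lower limit Q n is used because it is measurable and defined for every
    configuration.  As G n is at least c eps_n^(- 1 - beta), the expectations of
    Q n / (G n)^2 are dominated by the terms of the sharpness condition.  Almost
    surely their sum converges, and its terms tend to 0. *)
Lemma ae_scale_sums : {ae Pi, forall X : conf M, forall F : nat -> H,
  (forall n, net_sum X (fun x => weight (h + eps n) z x *: f x) (F n)) ->
  `|F n - fine (mass mu (h + eps n) z) *: f z| / fine (mass mu (h + eps n) z)
     @[n --> \oo] --> (0 : R)}.
Proof.
have [c0 c00 c0P] := mass_lower M_proper mu_fin h_gt0 beta_ge0 mu_growth z (eps_gt0 0%N).
have finG n : mass mu (s n) z \is a fin_num.
  exact: (mass_fin M_proper mu_fin h_gt0 beta_ge0 mu_growth z (hs n)).
have Ge n : c0 / eps n `^ (1 + beta) <= G n.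
  rewrite -lee_fin /G (fineK (finG n)).
  exact: (c0P (eps n) (eps_gt0 n) (eps_noninc (leq0n n))).
have p0 n : 0 < eps n `^ (1 + beta) by rewrite powR_gt0.
have G0 n : 0 < G n by apply: lt_le_trans (Ge n); rewrite divr_gt0.
have Gle n : (G n ^+ 2)^-1 <= (c0 ^+ 2)^-1 * eps n `^ (2 + 2 * beta).
  have -> : eps n `^ (2 + 2 * beta) = (eps n `^ (1 + beta)) ^+ 2.
    rewrite -powR_mulrn ?powR_ge0// -powRrM; congr powR; ring.
  rewrite -[_ * _]invrK lef_pV2 ?posrE ?invr_gt0 ?mulr_gt0 ?invr_gt0 ?exprn_gt0//.
  rewrite invfM invrK -expr_div_n ler_pXn2r ?nnegrE ?(ltW (G0 n))//.
  by rewrite divr_ge0 ?powR_ge0// ltW.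
pose K := Cv * expR (2 * s 0%N * mdist o z).
have K0 : 0 <= K by rewrite mulr_ge0 ?expR_ge0// ltW.
have : {ae Pi, forall X, (\sum_(0 <= n <oo) ((G n ^+ 2)^-1%:E * Q n X) < +oo)%E}.
  have iG n : 0 <= (G n ^+ 2)^-1 by rewrite invr_ge0 exprn_ge0// ltW.
  have GQ0 n X : (0 <= (G n ^+ 2)^-1%:E * Q n X)%E by rewrite mule_ge0 ?lee_fin ?iG ?Q_ge0.
  have mGQ n : measurable_fun setT (fun X => ((G n ^+ 2)^-1%:E * Q n X)%E).
    by apply: measurable_funeM; exact: mQ.
  apply: ae_finite_of_integral.
  - by apply: ge0_emeasurable_sum => // n X _ _; exact: GQ0.
  - by move=> X; apply: nneseries_ge0.
  rewrite integral_nneseries//.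
  apply: (@le_lt_trans _ _ (\sum_(0 <= n <oo) (((c0 ^+ 2)^-1 * K)%:E *
      ((eps n `^ (2 + 2 * beta))%:E * energy (2 * (h + eps n)))))%E).
    apply: lee_nneseries => [n _ _|n _]; first exact: integral_ge0.
    rewrite ge0_integralZl_EFin//.
    apply: (le_trans (lee_wpmul2l _ (intQ n))); first by rewrite lee_fin.
    rewrite -/K [X in (_ <= X)%E]muleA -EFinM [X in (X <= _)%E]muleA -EFinM.
    rewrite lee_wpmul2r ?energy_ge0// lee_fin.
    rewrite [leRHS](_ : _ = (c0 ^+ 2)^-1 * eps n `^ (2 + 2 * beta) * K); last by ring.
    by rewrite ler_wpM2r.
  rewrite nneseriesZl; last first.
    by move=> n _; rewrite mule_ge0 ?energy_ge0// lee_fin powR_ge0.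
  by rewrite lte_mul_pinfty// lee_fin mulr_ge0// invr_ge0 exprn_ge0// ltW.
apply: filterS => X /= HX F nF.
have QE n : Q n X = (`|F n - G n *: f z| ^+ 2)%:E.
  have cE : Err n k X @[k --> \oo] --> (`|F n - G n *: f z| ^+ 2)%:E.
    pose a k := `|\sum_(x <- points_in (X : conf M) (ball z k%:R)) weight (s n) z x *: f x -
        (\int[mu]_(x in ball z k%:R) weight (s n) z x) *: f z|.
    have c1 : a k @[k --> \oo] --> `|F n - G n *: f z|.
      apply: cvg_norm; apply: cvgB; first exact: (net_sum_ball_cvg M_proper z (nF n)).
      apply: cvgZ; last exact: cvg_cst.
      exact: (ball_mass_cvg M_proper mu_fin h_gt0 beta_ge0 mu_growth (hs n)).
    have c2 : a k ^+ 2 @[k --> \oo] --> `|F n - G n *: f z| ^+ 2.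
      by rewrite expr2; under eq_fun do rewrite expr2; exact: cvgM.
    by apply: cvg_EFin; [exact: nearW|exact: c2].
  by rewrite /Q is_cvg_limn_einfE ?(cvg_lim _ cE)//; exact: cvgP cE.
have sq_cvg : (`|F n - G n *: f z| / G n) ^+ 2 @[n --> \oo] --> (0 : R).
  apply: cvg_series_cvg_0; apply: summable_bounded; first by move=> n; exact: sqr_ge0.
  apply: le_lt_trans HX; apply: lee_nneseries => [n _ _|n _].
    by rewrite lee_fin sqr_ge0.
  by rewrite QE -EFinM lee_fin expr_div_n mulrC.
apply/cvgrPdist_le => e e0; have e20 : 0 < e ^+ 2 by rewrite exprn_gt0.
move/cvgrPdist_le : sq_cvg => /(_ _ e20); apply: filterS => n.
rewrite !sub0r !normrN ger0_norm ?sqr_ge0// ger0_norm ?divr_ge0 ?(ltW (G0 n))//.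
by rewrite ler_pXn2r ?nnegrE ?divr_ge0 ?(ltW e0) ?(ltW (G0 n)).
Qed.

End scales.

(** The factor b accounts for the change of centre, the monotonicity in s for
    the change of exponent. *)
Lemma weight_sandwich (s s1 s2 b : R) y z (x : M) :
  0 <= s -> s1 <= s -> s <= s2 -> expR (s * mdist y z) <= b ->
  b^-1 * weight s2 y x <= weight s z x /\ weight s z x <= b * weight s1 y x.
Proof.
move=> s0 s1s ss2 db; have b0 : 0 < b by apply: lt_le_trans db; exact: expR_gt0.
split.
  rewrite ler_pdivrMl//; apply: (@le_trans _ _ (weight s y x)).
    by rewrite ler_expR lerN2 ler_wpM2r ?mdist_ge0.
  apply: (le_trans (weight_shift z y x s0)).
  by rewrite (metric_sym z y) ler_wpM2r ?weight_ge0.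
apply: (le_trans (weight_shift y z x s0)).
rewrite ler_pM ?expR_ge0 ?weight_ge0//.
by rewrite ler_expR lerN2 ler_wpM2r ?mdist_ge0.
Qed.

Lemma mass_sandwich (s s1 s2 b : R) y z :
  h < s1 -> s1 <= s -> s <= s2 -> expR (s * mdist y z) <= b ->
  b^-1 * fine (mass mu s2 y) <= fine (mass mu s z) <= b * fine (mass mu s1 y).
Proof.
move=> hs1 s1s ss2 db; have b0 : 0 < b by apply: lt_le_trans db; exact: expR_gt0.
have s0 : 0 <= s by rewrite ltW// (lt_le_trans (lt_trans h_gt0 hs1)).
have hs : h < s by exact: lt_le_trans s1s.
have hs2 : h < s2 by exact: lt_le_trans ss2.
have fin t w : h < t -> mass mu t w \is a fin_num.
  by move=> ht; exact: (mass_fin M_proper mu_fin h_gt0 beta_ge0 mu_growth w ht).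
have sw x := weight_sandwich x s0 s1s ss2 db.
have mw t w : measurable_fun setT (fun x : borel_type M => (weight t w x)%:E).
  by apply/measurable_EFinP; exact: measurable_weight.
have w0 t w (x : M) : (0 <= (weight t w x)%:E)%E by rewrite lee_fin weight_ge0.
rewrite -!lee_fin !EFinM !fineK ?fin// /mass.
rewrite -!ge0_integralZl_EFin ?invr_ge0 ?(ltW b0)//.
apply/andP; split; apply: ge0_le_integral => //.
- by move=> x _; rewrite -EFinM lee_fin mulr_ge0 ?weight_ge0 ?invr_ge0 ?(ltW b0).
- exact: measurable_funeM.
- by move=> x _; rewrite -EFinM lee_fin; exact: (sw x).1.
- exact: measurable_funeM.
- by move=> x _; rewrite -EFinM lee_fin; exact: (sw x).2.
Qed.

Hypothesis eps_ratio : eps n.+1 / eps n @[n --> \oo] --> (1 : R).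

Lemma mass_ratio_eps y (eta : R) : 0 < eta -> exists N : nat, forall n, (N <= n)%N ->
  fine (mass mu (h + eps n.+1) y) <= (1 + eta) * fine (mass mu (h + eps n) y).
Proof.
move=> eta0.
have [K K0 KP] := mass_ratio M_proper mu_fin h_gt0 beta_ge0 mu_growth y (eps_gt0 0%N).
(* The bound 1/2 ensures that eps n / 2 <= eps n.+1, the other one that the
     error K d is at most eta. *)
pose d := Num.min (1 / 2) (eta / (K + 1)).
have d0 : 0 < d by rewrite lt_min !divr_gt0// ltr_wpDl.
move/cvgrPdist_le : eps_ratio => /(_ _ d0) [N _ NP]; exists N => n /NP /=.
have en := eps_gt0 n.
have rE : (eps n - eps n.+1) / eps n = 1 - eps n.+1 / eps n.
  by field; rewrite gt_eqF.
rewrite ger0_norm; last first.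
  by rewrite -rE divr_ge0 ?subr_ge0 ?ltW.
rewrite le_min => /andP[r1 r2].
apply: le_trans (KP (eps n) (eps n.+1) en (eps_noninc (leq0n n)) _ (ltW (eps_decr n))) _.
  move: r1; rewrite lerBlDl -lerBlDr => r1.
  have : (1 - 1 / 2) * eps n <= eps n.+1 by rewrite -ler_pdivlMr.
  by move=> ?; lra.
have m0 : 0 <= fine (mass mu (h + eps n) y).
  by apply: fine_ge0; apply: integral_ge0 => x _; rewrite lee_fin weight_ge0.
rewrite ler_wpM2r// lerD2l rE; apply: (@le_trans _ _ (K * (eta / (K + 1)))).
  by rewrite ler_wpM2l.
rewrite mulrCA ler_piMr ?(ltW eta0)// ler_pdivrMr ?ltr_wpDl// mul1r.
by rewrite lerDl.
Qed.

Lemma eps_bracket (t : R) N : 0 < t -> t < eps N ->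
  exists2 n, (N <= n)%N & eps n.+1 <= t <= eps n.
Proof.
move=> t0 tN; have exm : exists m, eps m <= t.
  by have [m mP] := eps_small t0; exists m; rewrite ltW// mP.
case: (ex_minnP exm) => -[|m] mt mmin.
  have := le_lt_trans mt tN; rewrite ltNge => /negP[]; exact: eps_noninc.
exists m.
  rewrite leqNgt; apply/negP => mN.
  by have := le_trans (eps_noninc mN) mt; rewrite leNgt tN.
rewrite mt/= leNgt; apply/negP => tm.
by have := mmin m (ltW tm); rewrite ltnn.
Qed.

(** Fix e, and the neighbour y of z in the dense sequence so close that f and the
    weights change little from y to z.  For s close to h, choose n with s between
    h + eps n.+1 and h + eps n; the sums at these two exponents with centre y are
    known by [ae_scale_sums], and [sandwich_estimate] concludes.  The null set
    only depends on the countably many exponents and centres. *)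
Theorem ae_weighted_sums (P : set H) (C : R) : normal_cone P C -> (forall x, P (f x)) ->
  {ae Pi, forall X : conf_type M,
    (forall s z, h < s ->
      exists S : H, conf_has_sum (X : conf M) (fun x => weight s z x *: f x) S) /\
    (forall z, (fine (mass mu s z))^-1 *:
       conf_sum (X : conf M) (fun x => weight s z x *: f x) @[s --> h^'+] --> f z)}.
Proof.
move=> cone Pf; have [zs zsd] := dense_sequence M_proper.
have C0 := cone_const_gt0 cone.
have : {ae Pi, forall X : conf_type M, forall i, forall F : nat -> H,
    (forall n, net_sum (X : conf M) (fun x => weight (h + eps n) (zs i) x *: f x) (F n)) ->
    `|F n - fine (mass mu (h + eps n) (zs i)) *: f (zs i)| /
      fine (mass mu (h + eps n) (zs i)) @[n --> \oo] --> (0 : R)}.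
  by apply: ae_foralln => i; exact: ae_scale_sums.
move: (ae_tail_small cone Pf); apply: filterS2 => X tX sX.
pose F s z := conf_sum X (fun x => weight s z x *: f x).
have FP s z : h < s -> net_sum X (fun x => weight s z x *: f x) (F s z).
  move=> hs; have [S nS] := tail_small_net_sum M_proper (tX s z hs).
  by rewrite /F (net_sum_conf_sum M_proper nS).
split.
  move=> s z hs; exists (F s z); apply: net_sum_has_sum (FP s z hs).
  exact: conf_enumerable.
move=> z; rewrite -/(F _ z); apply/cvgrPdist_le => e e0.
pose K := `|f z| + 1.
have K0 : 0 <= K by rewrite addr_ge0.
pose L := 2 * (C * (5 + 4 * K) + 1 + 4 * K) + 1.
have L0 : 0 < L.
  by rewrite ltr_wpDl// mulr_ge0// !addr_ge0 ?mulr_ge0 ?addr_ge0 ?mulr_ge0// ltW.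
pose eta := Num.min 1 (e / L).
have eta0 : 0 < eta by rewrite lt_min ltr01 divr_gt0.
have eta1 : eta <= 1 by rewrite ge_min lexx.
have etaL : eta * L <= e by rewrite -ler_pdivlMr// ge_min lexx orbT.
have [d d0 dP] : exists2 d : R, 0 < d &
    forall y, mdist z y < d -> `|f z - f y| <= eta.
  have /cvgrPdist_le/(_ _ eta0) := @cf z; rewrite -nbhs_ballE => -[d /= d0 dP].
  by exists d => // y yd; apply: dP; rewrite ballEmdist.
pose s0 := h + eps 0%N.
have s00 : 0 < s0 by rewrite addr_gt0.
(* The second bound makes the factor exp (s d(y, z)) at most 1 + eta, for all
   s up to s0. *)
pose dm := Num.min d (ln (1 + eta) / s0).
have ln0 : 0 < ln (1 + eta) by rewrite ln_gt0// ltrDl.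
have dm0 : 0 < dm by rewrite lt_min d0 divr_gt0.
have [i zy] := zsd z dm dm0; set y := zs i in zy.
have fzy : `|f z - f y| <= eta by apply: dP; apply: lt_le_trans zy _; rewrite ge_min lexx.
have [N2 N2P] := mass_ratio_eps y eta0.
have hh n : h < h + eps n by rewrite ltrDl.
have := sX i (fun n => F (h + eps n) y) (fun n => FP _ _ (hh n)).
move=> /cvgrPdist_le/(_ _ eta0)[N1 _ N1P].
have G0 s w : h < s -> 0 < fine (mass mu s w).
  move=> hs; rewrite fine_gt0// (mass_gt0 M_proper mu_fin h_gt0 beta_ge0 mu_growth)//=.
  by rewrite -ge0_fin_numE ?(mass_fin M_proper mu_fin h_gt0 beta_ge0 mu_growth)// integral_ge0// => x _; rewrite lee_fin weight_ge0.
have near1 n : (N1 <= n)%N ->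
    `|F (h + eps n) y - fine (mass mu (h + eps n) y) *: f y| <=
    eta * fine (mass mu (h + eps n) y).
  move=> /N1P; rewrite /= sub0r normrN ger0_norm ?divr_ge0 ?(ltW (G0 _ _ (hh n)))//.
  by rewrite ler_pdivrMr ?G0.
pose N := maxn N1 N2.
near=> s.
have hs : h < s by [].
have sN : s - h < eps N.
  rewrite ltrBlDl; near: s; exact: nbhs_right_lt.
have [n Nn /andP[ns sn]] := @eps_bracket (s - h) N ltac:(by rewrite subr_gt0) sN.
have {}ns : h + eps n.+1 <= s by move: ns; lra.
have {}sn : s <= h + eps n by move: sn; lra.
have N1n : (N1 <= n)%N by rewrite (leq_trans _ Nn)// leq_maxl.
have N2n : (N2 <= n)%N by rewrite (leq_trans _ Nn)// leq_maxr.
pose b := expR (s * mdist y z).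
have s_ge0 : 0 <= s by rewrite ltW// (lt_trans h_gt0).
have b1 : 1 <= b by rewrite -expR0 ler_expR mulr_ge0 ?mdist_ge0.
have b2 : b <= 1 + eta.
  rewrite -[leRHS]lnK ?posrE ?addr_gt0// ler_expR.
  apply: (@le_trans _ _ (s0 * (ln (1 + eta) / s0))); last by rewrite mulrC divfK// gt_eqF.
  rewrite ler_pM ?mdist_ge0//.
    by apply: (le_trans sn); rewrite lerD2l eps_noninc.
  by rewrite metric_sym ltW// (lt_le_trans zy)// ge_min lexx orbT.
have b0 : 0 < b by exact: expR_gt0.
have gP := mass_sandwich (hh n.+1) ns sn (lexx b).
have FF : `|F s z - b^-1 *: F (h + eps n) y| <=
    C * `|b *: F (h + eps n.+1) y - b^-1 *: F (h + eps n) y|.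
  have nF1 := net_sumZ (a := b^-1) ltac:(by rewrite invr_gt0) (FP _ y (hh n)).
  have nF2 := net_sumZ b0 (FP _ y (hh n.+1)).
  apply: (sandwich_norm M_proper o cone Pf (w1 := fun x => b^-1 * weight (h + eps n) y x)
    (w := weight s z) (w2 := fun x => b * weight (h + eps n.+1) y x)).
  - by move=> x; exact: (weight_sandwich x s_ge0 ns sn (lexx b)).1.
  - by move=> x; exact: (weight_sandwich x s_ge0 ns sn (lexx b)).2.
  - by under eq_fun do rewrite -scalerA; exact: nF1.
  - exact: FP.
  - by under eq_fun do rewrite -scalerA; exact: nF2.
have uK : `|f y| <= K.
  rewrite -[f y](subrK (f z)) addrC (le_trans (ler_normD _ _))// lerD2l distrC.
  exact: le_trans fzy _.
have gs := G0 s z hs.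
have uv : `|f y - f z| <= eta by rewrite distrC.
have eta01 : 0 < eta <= 1 by rewrite eta0.
have b12 : 1 <= b <= 1 + eta by rewrite b1.
have N1n1 : (N1 <= n.+1)%N by exact: leqW.
have est := sandwich_estimate C0 eta01 b12 erefl (G0 _ y (hh n)) (N2P _ N2n) gP
  (near1 _ N1n) (near1 _ N1n1) FF uv uK.
rewrite distrC -[f z]scale1r -(mulVf (lt0r_neq0 gs)) -scalerA -scalerBr normrZ.
rewrite gtr0_norm ?invr_gt0// ler_pdivrMl// mulrC.
by apply: (le_trans est); rewrite -/L ler_wpM2r// ltW.
Unshelve. all: by end_near.
Qed.

End almost_sure.

(** * The theorem *)

Lemma order_normal_cone (R : realType) (H : completeNormedModType R)
    (le : H -> H -> Prop) : vector_space_order le -> norm_compatible le ->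
  exists C : R, normal_cone (le 0) C.
Proof.
move=> ord [C C0 CP]; exists C; split => //.
- exact: vso_refl.
- move=> u v u0 v0; apply: (vso_trans ord v0).
  by have := vso_add ord v u0; rewrite add0r.
- by move=> a u a0 u0; have := vso_scale ord a0 u0; rewrite scaler0.
- move=> u v u0 v0.
  have : le u (u + v) by have := vso_add ord u v0; rewrite add0r addrC.
  by move=> /(CP _ _ _ u0); rewrite normr0 max_r.
Qed.

Lemma nonneg_normal_cone (R : realType) : @normal_cone R R [set t | 0 <= t] 1.
Proof.
split => //=; first by move=> u v; exact: addr_ge0.
  by move=> a u a0 u0; rewrite mulr_ge0.
by move=> u v u0 v0; rewrite mul1r !ger0_norm ?addr_ge0// lerDl.
Qed.

Lemma constant_coordinates (R : realType) (M : completeMetricType R) :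
  coordinates (fun _ : M => 1 : R) (fun i v => if i is 0%N then v else 0) setT.
Proof.
split => //.
- by case=> [//|i] a u v; rewrite mulr0 addr0.
- by case=> [|i] x; exact: cvg_cst.
- move=> v _; apply/cvg_lim => //; apply: cvg_near_cst.
  exists 1%N => // n /= n0; rewrite big_ltn//= big_nat big1 ?adde0.
    by rewrite real_normK ?num_real.
  by case=> [//|i] _; rewrite expr0n.
Qed.

Section energy_bounds.
Context {R : realType} {M : completeMetricType R} {H : completeNormedModType R}.
Variable mu : {measure set (borel_type M) -> \bar R}.
Hypothesis M_proper : proper_space M.
Hypothesis mu_fin : forall K : set M, compact K -> (mu K < +oo)%E.
Variables (o : M) (f : M -> H).
Hypothesis cf : continuous f.
Implicit Types z : M.

Let cnf : continuous (fun x => `|f x| ^+ 2).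
Proof. exact: continuous_norm_sqr. Qed.

(** Jensen, or Cauchy-Schwarz, for the square: integrate t y <= (t^2 + y^2) / 2
    with t = phi (f z) and y = |f x|. *)
Lemma ball_energy_ge (phi : H -> R) z r :
  (forall a u v, phi (a *: u + v) = a * phi u + phi v) ->
  (forall u, `|phi u| <= `|u|) -> 0 < phi (f z) ->
  \int[mu]_(x in ball z r) phi (f x) = phi (f z) * fine (mu (ball z r)) ->
  phi (f z) ^+ 2 * fine (mu (ball z r)) <= \int[mu]_(x in ball z r) `|f x| ^+ 2.
Proof.
move=> phiP phi_le t0 mean; set t := phi (f z) in t0 mean *.
set m := fine _ in mean *; set E := Rintegral _ _ _.
have mB := borel_ball z r.
have cphi : continuous (phi \o f) by exact: functional_continuous.
have cg : continuous (fun x => (2 * t)^-1 * `|f x| ^+ 2).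
  by move=> x; apply: cvgM; [exact: cvg_cst|exact: cnf].
have i1 := ball_integrable M_proper mu_fin z r cphi.
have i2 : mu.-integrable (ball z r) (EFin \o (fun=> t / 2)).
  by apply: (ball_integrable M_proper mu_fin) => x; exact: cvg_cst.
have i3 := ball_integrable M_proper mu_fin z r cg.
have : \int[mu]_(x in ball z r) phi (f x) <=
    \int[mu]_(x in ball z r) (t / 2 + (2 * t)^-1 * `|f x| ^+ 2).
  apply: le_Rintegral => //.
    by have := integrableD mB i2 i3; apply: eq_integrable.
  move=> x _; apply: (le_trans (le_trans (ler_norm _) (phi_le _))).
  rewrite -(ler_pM2l (mulr_gt0 (ltr0Sn R 1) t0)).
  have -> : 2 * t * (t / 2 + (2 * t)^-1 * `|f x| ^+ 2) = t ^+ 2 + `|f x| ^+ 2.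
    by field; rewrite gt_eqF.
  by have := sqr_ge0 (t - `|f x|); nra.
rewrite mean (RintegralD mB i2 i3) (RintegralZl _ mB (ball_integrable M_proper mu_fin z r cnf)).
rewrite Rintegral_cst// -/m -/E => le1.
have : t * m / 2 <= (2 * t)^-1 * E by lra.
rewrite -(ler_pM2l (mulr_gt0 (ltr0Sn R 1) t0)) [leRHS]mulrA.
rewrite [X in _ <= X * _]mulfV ?mul1r; last by rewrite gt_eqF// mulr_gt0.
by apply: le_trans; rewrite le_eqVlt; apply/orP; left; apply/eqP; field.
Qed.

(** On the ball the weight centred at o is at least its value at the distance
    r + d(z, o). *)
Lemma energy_lower_bound z r (E : R) t : 0 <= t ->
  E <= \int[mu]_(x in ball z r) `|f x| ^+ 2 ->
  ((expR (- (t * (r + mdist z o))) * E)%:E <= energy mu o f t)%E.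
Proof.
move=> t0 EB; have mB := borel_ball z r.
have i1 := ball_integrable M_proper mu_fin z r cnf.
have mE : measurable_fun setT (fun x : borel_type M => (weight t o x * `|f x| ^+ 2)%:E).
  apply/measurable_EFinP; apply: continuous_borel => x.
  by apply: cvgM; [exact: continuous_weight|exact: cnf].
have E0 (x : M) : (0 <= (weight t o x * `|f x| ^+ 2)%:E)%E.
  by rewrite lee_fin mulr_ge0 ?weight_ge0 ?exprn_ge0.
apply: (@le_trans _ _ (\int[mu]_(x in ball z r) (weight t o x * `|f x| ^+ 2)%:E)%E); last first.
  exact: ge0_subset_integral.
have mN : measurable_fun (ball z r : set (borel_type M)) (fun x => (`|f x| ^+ 2)%:E).
  by case/integrableP: i1.
apply: (@le_trans _ _ (\int[mu]_(x in ball z r)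
    ((expR (- (t * (r + mdist z o))))%:E * (`|f x| ^+ 2)%:E))%E).
  rewrite ge0_integralZl_EFin ?expR_ge0//.
  rewrite EFinM lee_wpmul2l ?lee_fin ?expR_ge0//.
  apply: (@le_trans _ _ (\int[mu]_(x in ball z r) `|f x| ^+ 2)%:E); first by rewrite lee_fin.
  by rewrite fineK// (integrable_fin_num mB i1).
apply: ge0_le_integral => //.
- exact: measurable_funeM.
- exact: measurable_funTS.
- move=> x /ballP xz; rewrite -EFinM lee_fin ler_wpM2r ?exprn_ge0//.
  rewrite ler_expR lerN2 ler_wpM2l//.
  by rewrite (le_trans (metric_triangle x z o))// lerD2r ltW.
Qed.

End energy_bounds.

Theorem theorem4p19 (R : realType) (M : completeMetricType R)
    (mu : {measure set (borel_type M) -> \bar R}) (o : M) (h beta : R)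
    (H : completeNormedModType R) (dot : {dot H for idfun})
    (le : H -> H -> Prop) (Pi : probability (conf_type M) R) (f : M -> H)
    (M_proper : proper_space M) (mu_radon : radon_measure mu)
    (h_gt0 : 0 < h) (beta_ge0 : 0 <= beta)
    (mu_growth : exponential_growth mu h beta)
    (H_hilbert : hilbert_norm dot)
    (le_order : vector_space_order le) (le_norm : norm_compatible le)
    (Pi_small_variance : small_variance Pi)
    (Pi_intensity : first_intensity Pi mu)
    (f_CMVP : CMVP_sharp mu o h beta le f) :
  {ae Pi, forall X : conf M,
    (forall (s : R) (z : M), h < s ->
      exists S : H, conf_has_sum X (fun x => expR (- (s * mdist x z)) *: f x) S)
    /\
    (forall z : M,
      (conf_sum X (fun x => expR (- (s * mdist x z)) : R))^-1 *:
      conf_sum X (fun x => expR (- (s * mdist x z)) *: f x)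
        @[s --> h^'+] --> f z)}.
Proof.
have mu_fin := mu_radon.1.
have [[fM cf fpos] [eps [eps_gt0 eps_decr eps_cvg0 eps_ratio sharp]]] := f_CMVP.
have [Cv Cv0 vb] := variance_sum_points M_proper Pi_intensity Pi_small_variance.
have [zs zsd] := dense_sequence M_proper.
have mean (phi : H -> R) z r : (forall a u v, phi (a *: u + v) = a * phi u + phi v) ->
    (forall u, `|phi u| <= `|u|) ->
    \int[mu]_(x in ball z r) phi (f x) = phi (f z) * fine (mu (ball z r)).
  exact: (functional_mean_value z r M_proper H_hilbert mu_fin cf fM).
have fc := hilbert_coordinates H_hilbert zsd cf.
have fmean i z r := mean _ z r (coordinateP dot (f \o zs) i) (coordinate_le H_hilbert (f \o zs) i).
have energy_sum : (\sum_(0 <= n <oo) ((eps n `^ (2 + 2 * beta))%:E *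
    energy mu o f (2 * (h + eps n))) < +oo)%E.
  apply: le_lt_trans sharp; rewrite le_eqVlt; apply/orP; left; apply/eqP.
  apply: eq_eseriesr => n _; congr (_ * _)%E; apply: eq_integral => x _.
  congr EFin; rewrite mulrAC -expRD; congr (expR _ * _); ring.
have [C cone] := order_normal_cone le_order le_norm.
have f_limit := ae_weighted_sums M_proper mu_fin h_gt0 beta_ge0 mu_growth Cv0 vb
  cf fc fmean eps_gt0 eps_decr eps_cvg0 energy_sum eps_ratio cone fpos.
(* When f = 0 nothing can be said of the sum of the weights, but the quotient
     is 0 whatever its denominator. *)
have [[x0 fx0]|f0] := pselect (exists x, f x != 0); last first.
  have f_eq0 x : f x = 0.
    by apply/eqP; apply: contrapT => /negP fx; apply: f0; exists x.
  apply: filterS f_limit => X [sums _]; split => // z.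
  have -> : (fun s : R => (conf_sum X (fun x => expR (- (s * mdist x z)) : R))^-1 *:
      conf_sum X (fun x => expR (- (s * mdist x z)) *: f x)) = cst 0.
    apply/funext => s; rewrite (_ : conf_sum X _ = 0 :> H) ?scaler0//.
    apply: (net_sum_conf_sum M_proper); rewrite -[0](big_nil 0 +%R xpredT (fun x : M => expR (- (s * mdist x z)) *: f x)).
    have p0 : precompact (set0 : set M).
      by rewrite precompactE closure0; exact: compact0.
    have := @net_sum_finite _ _ _ X (fun x => expR (- (s * mdist x z)) *: f x) set0 p0.
    rewrite /points_in set0I fset_set0 /=; apply => x _.
    by rewrite f_eq0 scaler0.
  by rewrite f_eq0; exact: cvg_cst.
have [a a0 [k0 volP]] := vol_lower h_gt0 beta_ge0 mu_growth x0.
pose r : R := k0.+2%:R.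
have m0 : 0 < fine (mu (ball x0 r)).
  have := volP k0.+1 (leqnSn k0); rewrite lerBrDr; apply: lt_le_trans.
  rewrite ltr_wpDr ?fine_ge0// !mulr_gt0 ?expR_gt0// powR_gt0//.
(* The functional that norms f x0. *)
pose phi u := dot u (normalize (f x0)).
have phiP a' u v : phi (a' *: u + v) = a' * phi u + phi v by exact: dotPl.
have phi_le u : `|phi u| <= `|u|.
  apply: (le_trans (dot_le H_hilbert _ _)); rewrite -[leRHS]mulr1.
  by rewrite ler_wpM2l// norm_normalize_le.
have phi0 : 0 < phi (f x0).
  rewrite /phi dotC -[normalize (f x0)]addr0 dotPl H_hilbert dot0l addr0 expr2.
  by rewrite mulKf ?normr_eq0// normr_gt0.
have Ege := ball_energy_ge M_proper mu_fin cf phiP phi_le phi0 (mean phi x0 r phiP phi_le).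
(* A lower bound for all the integrals in the sharpness condition. *)
pose kappa := expR (- (2 * (h + eps 0%N) * (r + mdist x0 o))) *
  (phi (f x0) ^+ 2 * fine (mu (ball x0 r))).
have kappa0 : 0 < kappa by rewrite !mulr_gt0 ?expR_gt0// exprn_gt0.
have eps_le n : eps n <= eps 0%N.
  by elim: n => // n; apply: le_trans; exact: ltW.
have kappa_le n : (kappa%:E <= energy mu o f (2 * (h + eps n)))%E.
  have pm0 : 0 <= phi (f x0) ^+ 2 * fine (mu (ball x0 r)).
    by rewrite mulr_ge0 ?sqr_ge0// ltW.
  have t0 : 0 <= 2 * (h + eps n) by rewrite mulr_ge0// addr_ge0// ltW.
  apply: le_trans (energy_lower_bound M_proper mu_fin o cf t0 Ege).
  rewrite lee_fin /kappa ler_wpM2r// ler_expR lerN2 ler_wpM2r//.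
    by rewrite addr_ge0// mdist_ge0.
  by rewrite ler_pM2l// lerD2l.
have G2 : mass mu (2 * h) o \is a fin_num.
  by apply: (mass_fin M_proper mu_fin h_gt0 beta_ge0 mu_growth); lra.
have energy1_sum : (\sum_(0 <= n <oo) ((eps n `^ (2 + 2 * beta))%:E *
    energy mu o (fun _ : M => 1%R : R) (2 * (h + eps n))) < +oo)%E.
  pose q := fine (mass mu (2 * h) o) / kappa.
  have q0 : 0 <= q.
    rewrite divr_ge0 ?(ltW kappa0)// fine_ge0//.
    by apply: integral_ge0 => x _; rewrite lee_fin weight_ge0.
  apply: (@le_lt_trans _ _ (\sum_(0 <= n <oo) (q%:E * ((eps n `^ (2 + 2 * beta))%:E *
    energy mu o f (2 * (h + eps n)))))%E).
    apply: lee_nneseries => [n _ _|n _].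
      by rewrite mule_ge0 ?energy_ge0// lee_fin powR_ge0.
    rewrite muleCA lee_wpmul2l ?lee_fin ?powR_ge0//.
    apply: (@le_trans _ _ (mass mu (2 * h) o)).
      apply: ge0_le_integral => //.
      + by move=> x _; rewrite normr1 expr1n mulr1 lee_fin weight_ge0.
      + under eq_fun do rewrite normr1 expr1n mulr1.
        by apply/measurable_EFinP; exact: measurable_weight.
      + by apply/measurable_EFinP; exact: measurable_weight.
      + move=> x _; rewrite normr1 expr1n mulr1 lee_fin ler_expR lerN2.
        by rewrite ler_wpM2r ?mdist_ge0// ler_pM2l// lerDl ltW.
    apply: (@le_trans _ _ (q%:E * kappa%:E)%E); last by rewrite lee_wpmul2l ?lee_fin.
    by rewrite -EFinM /q divfK ?gt_eqF// fineK.
  rewrite nneseriesZl; last first.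
    by move=> n _; rewrite mule_ge0 ?energy_ge0// lee_fin powR_ge0.
  by rewrite lte_mul_pinfty ?lee_fin.
have mean1 (i : nat) (z : M) (t : R) :
    \int[mu]_(x in ball z t) (if i is 0%N then (1 : R) else 0) =
    (if i is 0%N then 1 else 0) * fine (mu (ball z t)).
  by rewrite Rintegral_cst//; exact: borel_ball.
have c1 : continuous (fun _ : M => 1 : R) by move=> x; exact: cvg_cst.
have pos1 (x : M) : [set t : R | 0 <= t] 1 by rewrite /= ler01.
have mass_limit := @ae_weighted_sums _ _ R Pi mu M_proper mu_fin h beta h_gt0 beta_ge0
  mu_growth Cv Cv0 vb o _ _ _ c1 (constant_coordinates M) mean1 eps eps_gt0 eps_decr
  eps_cvg0 energy1_sum eps_ratio _ _ (nonneg_normal_cone R) pos1.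
move: f_limit mass_limit; apply: filterS2 => X [sums limF] [_ limG]; split => // z.
have lim : ((fine (mass mu s z))^-1 *: conf_sum X (fun x => weight s z x *: (1 : R)))^-1 *:
    ((fine (mass mu s z))^-1 *: conf_sum X (fun x => weight s z x *: f x))
    @[s --> h^'+] --> f z.
  have lV : ((fine (mass mu s z))^-1 *: conf_sum X (fun x => weight s z x *: (1 : R)))^-1
      @[s --> h^'+] --> (1 : R)^-1.
    by apply: cvgV (limG z); exact: oner_neq0.
  by rewrite -[f z]scale1r; apply: cvgZ (limF z); move: lV; rewrite invr1.
have ratioE s : h < s ->
    (conf_sum X (fun x => expR (- (s * mdist x z)) : R))^-1 *:
      conf_sum X (fun x => expR (- (s * mdist x z)) *: f x) =
    ((fine (mass mu s z))^-1 *: conf_sum X (fun x => weight s z x *: (1 : R)))^-1 *: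
      ((fine (mass mu s z))^-1 *: conf_sum X (fun x => weight s z x *: f x)).
  move=> hs.
  have G0 : fine (mass mu s z) != 0.
    rewrite gt_eqF// fine_gt0// (mass_gt0 M_proper mu_fin h_gt0 beta_ge0 mu_growth)//=.
    rewrite -ge0_fin_numE ?(mass_fin M_proper mu_fin h_gt0 beta_ge0 mu_growth)//.
    by apply: integral_ge0 => x _; rewrite lee_fin weight_ge0.
  rewrite (_ : (fun x : M => weight s z x *: (1 : R)) = fun x => expR (- (s * mdist x z))); last first.
    by apply/funext => x; rewrite /weight; exact: mulr1.
  rewrite [in RHS]scalerA; congr (_ *: _).
  rewrite [_ *: conf_sum _ _](_ : _ = (fine (mass mu s z))^-1 * conf_sum X (fun x => expR (- (s * mdist x z)) : R))//.
  by rewrite invfM invrK mulrAC mulfV// mul1r.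
apply/cvgrPdist_le => e e0; move/cvgrPdist_le : lim => /(_ e e0) lim.
near=> s; rewrite ratioE//; near: s; exact: lim.
Unshelve. all: by end_near.
Qed.
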